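(* Let $\Gamma$ be a ribbon graph of a connected graph $G(V,E)$ and let $n>1$. The isomorphism class of the complex $[[\Gamma]]$ regarded in $\mathrm{Kom}_{/h}(\mathrm{Mat}(\mathcal{UC}ob^n_{/l}))$ is an invariant of the ribbon graph $\Gamma$ up to chain homotopy of geometric chain complexes. Furthermore, the functor $\mathcal{F}$ takes $[[\Gamma]]$ to a complex of modules whose homology is equal to the $n$-color homologies, that is, $$H(\mathcal{F}([[\Gamma]])) = CH^{*,*}_n(\Gamma;\mathbb{C})$$ when $t$ is set to $0$ in the $U$ relation, and $$H(\mathcal{F}([[\Gamma]])) = \widehat{CH}^*_n(\Gamma;\mathbb{C})$$ when $t$ is set to $1$ in the $U$ relation.
   Context: Ribbon graphs and states. Graphs are finite multigraphs. A ribbon graph $\Gamma$ of a connected graph $G$ is a compact surface with boundary containing $G$ that deformation retracts onto $G$ (one disk per vertex, one band per edge); two are equivalent if there is a homeomorphism of the closed surfaces (obtained by gluing disks to the boundary) inducing an isomorphism of the graphs. Write $E=\{e_1,\dots,e_\ell\}$. For $\alpha\in\{0,1\}^\ell$ let $\Gamma_\alpha$ be obtained from $\Gamma$ by inserting a half-twist in the band of $e_i$ for each $\alpha_i=1$; the state $\Gamma_\alpha$ is its set of boundary circles, $k_\alpha$ their number, $|\alpha|=\sum\alpha_i$. If $\alpha'$ is obtained from $\alpha$ by changing one $0$ (position $p$) to $1$, passing from $\Gamma_\alpha$ to $\Gamma_{\alpha'}$ fuses two circles into one, splits one into two, or changes one circle to one circle. Put $m=\lfloor n/2\rfloor$. The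 category $\mathcal{UC}ob^n_{/l}$. Objects are finite disjoint unions of circles; morphisms are $\mathbb{C}$-linear combinations of 2-dimensional (possibly non-orientable) cobordisms built from the generating cobordisms: cylinder (identity), pair of pants from two circles to one, pair of pants from one circle to two, cap $\emptyset\to\bigcirc$, cup $\bigcirc\to\emptyset$, and the projective cylinder (a cylinder connect-summed with one $\mathbb{RP}^2$, drawn as a cylinder with a dot $\bullet$; $k$ dots stand for connected sum with $\#k\,\mathbb{RP}^2$), the relations among generators being the commutative Frobenius algebra relations with dots moving freely along connected components; modulo the local relations: (NC) a cylinder equals $\sum_{i=0}^{n-1}$ (disk with $i$ dots) $\sqcup$ (disk with $n-1-i$ dots), the two disks capping off the two boundary circles; (S) the sphere is $0$; (T) the torus is $n$ (hence $\#(n-1)\mathbb{RP}^2=1$). In addition one may impose the $U$ relation $U:=\#(2n-1)\mathbb{RP}^2=t$ for a chosen $t\in\mathbb{C}$. Gradings: a dot has degree $-1$, caps and cups degree $(n-1)/2$, the two pairs of pants degree $-(n-1)/2$. $\mathrm{Mat}(\cdot)$ is the additive closure (formal direct sums, with grading shifts $\{s\}$, and matrices of morphisms), $\mathrm{Kom}_{/h}$ the category of complexes modulo chain homotopy. The geometric complex $[[\Gamma]]$: in homological degree $i$ it is $\bigoplus_{|\alpha|=i}\Gamma_\alpha\{m|\alpha|\}$, and the component of the differential from $\Gamma_\alpha$ to $\Gamma_{\alpha'}$ is $(-1)^{\alpha_1+\dots+\alpha_{p-1}}$ times the cobordism which is the identity on unaffected circles and on the affected ones is: the pair of pants if two circles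 fuse; if one circle splits, the pair of pants when $n$ is odd, and the pair of pants with one dot when $n$ is even; and $\sqrt n$ times the cylinder with $m$ dots if one circle goes to one circle. The functor $\mathcal{F}$ to graded $\mathbb{C}$-modules (monoidal: disjoint unions go to tensor products), for the chosen $t$: $\mathcal{F}(\bigcirc)=V_t=\mathbb{C}[x]/(x^n-t)$ with basis $x^k$ of degree $m-k$, $0\le k\le n-1$; cap $\mapsto\iota$, $\iota(1)=1$; cup $\mapsto\epsilon$, $\epsilon(x^{n-1})=1$ and $\epsilon(x^k)=0$ for $k<n-1$; projective cylinder $\mapsto$ multiplication by $x$; pants from two circles to one $\mapsto$ multiplication of $V_t$; undotted pants from one circle to two $\mapsto$ the counital comultiplication of the Frobenius algebra $(V_t,\epsilon)$, determined by $1\mapsto\sum_{i=0}^{n-1}x^i\otimes x^{n-1-i}$; $U\mapsto t$. It extends to complexes. The $n$-color homologies. Bigraded: $V=\mathbb{C}[x]/(x^n)$, $\deg x^k=m-k$; $C^{i,*}=\bigoplus_{|\alpha|=i}V^{\otimes k_\alpha}\{m|\alpha|\}$, $j$ = shifted degree; differential the signed sum (signs $(-1)^{\alpha_1+\dots+\alpha_{p-1}}$) of maps that are the identity on unaffected circles and, in the fuse/split/one-to-one case, multiplication in $V$; $\Delta(x^k)=\sum_{i+j=k+2m,\,0\le i,j\le n-1}x^i\otimes x^j$; $\eta(x^k)=\sqrt n\,x^{k+m}$. $CH_n^{i,j}(\Gamma;\mathbb{C})$ is its homology. Filtered: the same with $\widehat V=\mathbb{C}[x]/(x^n-1)$, $\widehat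 m(x^i\otimes x^j)=x^{i+j}$; $\widehat\Delta(x^k)=\sum_{0\le i,j<n,\ i+j\equiv k+2m\bmod n}x^i\otimes x^j$; $\widehat\eta(x^k)=\sqrt n\,x^{k+m}$; its homology is $\widehat{CH}^*_n(\Gamma;\mathbb{C})$. *)

(* Defs.v *)
From HB Require Import structures.
From mathcomp Require Import all_boot all_order all_algebra.
From mathcomp Require Import generic_quotient ring_quotient.
Set Implicit Arguments.
Unset Strict Implicit.
Unset Printing Implicit Defensive.
Import Order.TTheory GRing.Theory Num.Theory.
Local Open Scope ring_scope.

Record mgraph := MGraph {
  verts : finType;
  nedges : nat;
  ends : 'I_nedges -> bool -> verts }.

Definition adjacent (G : mgraph) : rel (verts G) :=
  [rel v w | [exists e, exists b, (ends e b == v) && (ends e (~~ b) == w)]].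

Definition gconnected (G : mgraph) : Prop :=
  (0 < #|verts G|)%N /\ forall v w : verts G, connect (@adjacent G) v w.

(* The band of an edge e is a rectangle; (e, b, s) is the corner of this
   rectangle lying on the vertex disk at the end b of e, on the side s. *)
Definition flag (G : mgraph) : finType := ('I_(nedges G) * bool * bool)%type.

Section Flags.
Variable G : mgraph.
Implicit Types x : flag G.

Definition fedge x : 'I_(nedges G) := x.1.1.
Definition fvert x : verts G := ends x.1.1 x.1.2.
Definition across x : flag G := (x.1.1, x.1.2, ~~ x.2).
(* The free sides of the band of e join (e, b, s) to (e, ~~ b, s), and to
   (e, ~~ b, ~~ s) after a half-twist. *)
Definition along (alpha : {ffun 'I_(nedges G) -> bool}) x : flag G :=
  (x.1.1, ~~ x.1.2, x.2 (+) alpha x.1.1).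
Definition untwisted : {ffun 'I_(nedges G) -> bool} := [ffun=> false].
End Flags.

(* Each vertex disk is bounded by arcs glued to band ends alternating with free
   arcs; corner exchanges the endpoints of the free arcs.  The last field says
   that the arcs around one vertex form exactly one circle.  A vertex without
   incident edges carries no flag. *)
Record ribbon (G : mgraph) := Ribbon {
  corner : flag G -> flag G;
  cornerK : involutive corner;
  corner_neq : forall x, corner x != x;
  corner_vert : forall x y,
    connect [rel a b | (b == corner a) || (b == across a)] x y
      = (fvert x == fvert y) }.

(* A homeomorphism of the closed surfaces carrying one graph to the other is
   recorded by its action on vertices and flags; it may permute the edges, and
   reverse edges and local orientations. *)
Definition ribbon_equiv (G G' : mgraph) (Ga : ribbon G) (Ga' : ribbon G') :=
  exists (psi : verts G -> verts G') (phi : flag G -> flag G'),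
    [/\ bijective psi, bijective phi,
        forall x, fvert (phi x) = psi (fvert x) &
        [/\ forall x, phi (across x) = across (phi x),
            forall x, phi (along (untwisted G) x)
                        = along (untwisted G') (phi x) &
            forall x, phi (corner Ga x) = corner Ga' (phi x)]].

Section States.
Variables (G : mgraph) (Ga : ribbon G).
Implicit Types alpha : {ffun 'I_(nedges G) -> bool}.

(* inl F is the boundary circle through the set F of flags, inr v is the
   boundary of the disk of the vertex v when no band is attached to it. *)
Definition circle : finType := ({set flag G} + verts G)%type.

Definition bdry_step alpha : rel (flag G) :=
  [rel x y | (y == corner Ga x) || (y == along alpha x)].

Definition state alpha : {set circle} :=
  [set inl [set y | connect (bdry_step alpha) x y] | x : flag G]
  :|: [set inr v | v : verts G & [forall x : flag G, fvert x != v]].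

Definition passes (p : 'I_(nedges G)) (c : circle) : bool :=
  if c is inl F then [exists x in F, fedge x == p] else false.

(* The circles common to two states that avoid the band of p. *)
Definition unaffected p (S S' : {set circle}) : {set circle} :=
  [set c in S :&: S' | ~~ passes p c].

Definition weight alpha : nat := (\sum_p alpha p)%N.

Definition flip01 alpha alpha' (p : 'I_(nedges G)) : bool :=
  ~~ alpha p && (alpha' == [ffun q => if q == p then true else alpha q]).

Definition edge_sign (C : numClosedFieldType) alpha (p : 'I_(nedges G)) : C :=
  (-1) ^+ (\sum_(q < nedges G | (q < p)%N) alpha q)%N.
End States.

Record fbij (A B : finType) := FBij {
  fto : A -> B;
  ffrom : B -> A;
  ftoK : cancel fto ffrom;
  ffromK : cancel ffrom fto }.

Section Bijections.
Variables A B D E : finType.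

Lemma cancel_id (T : Type) : cancel (@id T) (@id T). Proof. by []. Qed.
Definition bid : fbij A A := FBij (@cancel_id A) (@cancel_id A).

Definition binv (f : fbij A B) : fbij B A := FBij (ffromK f) (ftoK f).

Definition bcomp (g : fbij B D) (f : fbij A B) : fbij A D :=
  FBij (can_comp (ftoK g) (ftoK f)) (can_comp (ffromK f) (ffromK g)).

Definition sum_map (T1 T2 U1 U2 : Type) (f : T1 -> U1) (g : T2 -> U2)
  (x : T1 + T2) : U1 + U2 :=
  match x with inl a => inl (f a) | inr b => inr (g b) end.

Lemma sum_mapK (f : fbij A B) (g : fbij D E) :
  cancel (sum_map (fto f) (fto g)) (sum_map (ffrom f) (ffrom g)).
Proof. by case=> a /=; rewrite ftoK. Qed.

Lemma sum_mapKV (f : fbij A B) (g : fbij D E) :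
  cancel (sum_map (ffrom f) (ffrom g)) (sum_map (fto f) (fto g)).
Proof. by case=> a /=; rewrite ffromK. Qed.

Definition bsum (f : fbij A B) (g : fbij D E) : fbij (A + D)%type (B + E)%type :=
  FBij (sum_mapK f g) (sum_mapKV f g).

Definition sum_assoc (x : (A + B) + D) : A + (B + D) :=
  match x with
  | inl (inl a) => inl a | inl (inr b) => inr (inl b) | inr d => inr (inr d)
  end.
Definition sum_assocV (x : A + (B + D)) : (A + B) + D :=
  match x with
  | inl a => inl (inl a) | inr (inl b) => inl (inr b) | inr (inr d) => inr d
  end.
Lemma sum_assocK : cancel sum_assoc sum_assocV. Proof. by case=> [[]|]. Qed.
Lemma sum_assocVK : cancel sum_assocV sum_assoc. Proof. by case=> [|[]]. Qed.
Definition bassoc : fbij ((A + B) + D)%type (A + (B + D))%type :=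
  FBij sum_assocK sum_assocVK.

Definition sum_swap (T U : Type) (x : T + U) : U + T :=
  match x with inl a => inr a | inr b => inl b end.
Lemma sum_swapK (T U : Type) : cancel (@sum_swap T U) (@sum_swap U T).
Proof. by case. Qed.
Definition bswap : fbij (A + B)%type (B + A)%type :=
  FBij (@sum_swapK A B) (@sum_swapK B A).

Definition sum_unit (x : void + A) : A :=
  match x with inl v => match v with end | inr a => a end.
Lemma sum_unitK : cancel sum_unit inr. Proof. by case=> [[]|]. Qed.
Lemma sum_unitVK : cancel inr sum_unit. Proof. by []. Qed.
Definition bunit : fbij (void + A)%type A := FBij sum_unitK sum_unitVK.

Section SameCard.
Hypothesis cardAB : #|A| = #|B|.
Definition card_to (a : A) : B := enum_val (cast_ord cardAB (enum_rank a)).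
Definition card_from (b : B) : A :=
  enum_val (cast_ord (esym cardAB) (enum_rank b)).
Lemma card_toK : cancel card_to card_from.
Proof.
by move=> a; rewrite /card_from /card_to enum_valK cast_ordK enum_rankK.
Qed.
Lemma card_fromK : cancel card_from card_to.
Proof.
by move=> b; rewrite /card_from /card_to enum_valK cast_ordKV enum_rankK.
Qed.
Definition bcard : fbij A B := FBij card_toK card_fromK.
End SameCard.
End Bijections.

Definition elts (T : finType) (S : {set T}) : finType := {x : T | x \in S}.

Section SplitSet.
Variables (T : finType) (U S : {set T}).
Hypothesis sUS : U \subset S.

Lemma split_out (x : elts S) : ~ (val x \in U) -> val x \in S :\: U.
Proof. by move/negP=> h; rewrite inE h (valP x). Qed.

Definition split_to (x : elts S) : elts U + elts (S :\: U) :=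
  match @idP (val x \in U) with
  | ReflectT h => inl (exist _ (val x) h)
  | ReflectF h => inr (exist _ (val x) (split_out h))
  end.

Lemma split_inU (y : elts U) : val y \in S.
Proof. exact: (subsetP sUS) (valP y). Qed.

Lemma split_inD (y : elts (S :\: U)) : val y \in S.
Proof. by have := valP y; rewrite inE => /andP[]. Qed.

Definition split_from (x : elts U + elts (S :\: U)) : elts S :=
  match x with
  | inl y => exist _ (val y) (split_inU y)
  | inr y => exist _ (val y) (split_inD y)
  end.

Lemma split_toK : cancel split_to split_from.
Proof. by move=> x; rewrite /split_to; case: {-}_ / idP => h; apply: val_inj. Qed.

Lemma split_fromK : cancel split_from split_to.
Proof.
case=> y; rewrite /split_to /=; case: {-}_ / idP => h.
- by congr inl; apply: val_inj.
- by case: h; apply: valP y.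
- by have := valP y; rewrite inE h.
- by congr inr; apply: val_inj.
Qed.

Definition bsplit : fbij (elts S) (elts U + elts (S :\: U))%type :=
  FBij split_toK split_fromK.
End SplitSet.

(* Morphisms A -> B between disjoint unions of circles indexed by the finite
   sets A and B: linear combinations of composites of disjoint unions of the
   generating cobordisms.  Relabel f is the union of the cylinders joining the
   incoming circle a to the outgoing circle f a. *)
Inductive mor (C : numClosedFieldType) : finType -> finType -> Type :=
| Relabel (A B : finType) of fbij A B : mor C A B
| Merge : mor C (unit + unit)%type unit
| Split : mor C unit (unit + unit)%type
| Cap : mor C void unit
| Cup : mor C unit void
| Dot : mor C unit unit
| Comp (A B D : finType) of mor C B D & mor C A B : mor C A D
| Union (A B A' B' : finType) of mor C A B & mor C A' B' :
    mor C (A + A')%type (B + B')%type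
| Zero (A B : finType) : mor C A B
| Add (A B : finType) of mor C A B & mor C A B : mor C A B
| Scale (A B : finType) of C & mor C A B : mor C A B.

Arguments Relabel {C A B}.
Arguments Merge {C}.
Arguments Split {C}.
Arguments Cap {C}.
Arguments Cup {C}.
Arguments Dot {C}.
Arguments Zero {C A B}.
Arguments Add {C A B}.

Definition Id (C : numClosedFieldType) (A : finType) : mor C A A :=
  Relabel (bid A).
Arguments Id {C} A.

Fixpoint dots (C : numClosedFieldType) (k : nat) : mor C unit unit :=
  if k is k'.+1 then Comp Dot (dots C k') else Id unit.

(* Equality of morphisms in the category with the local relations, together
   with the U relation when u = Some t: the congruence generated by the laws of
   a linear symmetric monoidal category, those of a commutative Frobenius
   object with dots, and the local relations. *)
Inductive eqcob (C : numClosedFieldType) (u : option C) (n : nat) :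
  forall A B : finType, mor C A B -> mor C A B -> Prop :=
| eqc_refl A B (f : mor C A B) : eqcob u n f f
| eqc_sym A B (f g : mor C A B) : eqcob u n f g -> eqcob u n g f
| eqc_trans A B (f g h : mor C A B) :
    eqcob u n f g -> eqcob u n g h -> eqcob u n f h
| eqc_Comp A B D (g g' : mor C B D) (f f' : mor C A B) :
    eqcob u n g g' -> eqcob u n f f' -> eqcob u n (Comp g f) (Comp g' f')
| eqc_Union A B A' B' (f g : mor C A B) (f' g' : mor C A' B') :
    eqcob u n f g -> eqcob u n f' g' -> eqcob u n (Union f f') (Union g g')
| eqc_Add A B (f f' g g' : mor C A B) :
    eqcob u n f f' -> eqcob u n g g' -> eqcob u n (Add f g) (Add f' g')
| eqc_Scale A B (c : C) (f g : mor C A B) :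
    eqcob u n f g -> eqcob u n (Scale c f) (Scale c g)
| eqc_addA A B (f g h : mor C A B) :
    eqcob u n (Add f (Add g h)) (Add (Add f g) h)
| eqc_addC A B (f g : mor C A B) : eqcob u n (Add f g) (Add g f)
| eqc_add0 A B (f : mor C A B) : eqcob u n (Add Zero f) f
| eqc_scale0 A B (f : mor C A B) : eqcob u n (Scale 0 f) Zero
| eqc_scale1 A B (f : mor C A B) : eqcob u n (Scale 1 f) f
| eqc_scaleA A B (a b : C) (f : mor C A B) :
    eqcob u n (Scale a (Scale b f)) (Scale (a * b) f)
| eqc_scaleDl A B (a b : C) (f : mor C A B) :
    eqcob u n (Scale (a + b) f) (Add (Scale a f) (Scale b f))
| eqc_scaleDr A B (a : C) (f g : mor C A B) :
    eqcob u n (Scale a (Add f g)) (Add (Scale a f) (Scale a g))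
| eqc_CompDl A B D (g g' : mor C B D) (f : mor C A B) :
    eqcob u n (Comp (Add g g') f) (Add (Comp g f) (Comp g' f))
| eqc_CompDr A B D (g : mor C B D) (f f' : mor C A B) :
    eqcob u n (Comp g (Add f f')) (Add (Comp g f) (Comp g f'))
| eqc_CompZl A B D (a : C) (g : mor C B D) (f : mor C A B) :
    eqcob u n (Comp (Scale a g) f) (Scale a (Comp g f))
| eqc_CompZr A B D (a : C) (g : mor C B D) (f : mor C A B) :
    eqcob u n (Comp g (Scale a f)) (Scale a (Comp g f))
| eqc_UnionDl A B A' B' (f g : mor C A B) (h : mor C A' B') :
    eqcob u n (Union (Add f g) h) (Add (Union f h) (Union g h))
| eqc_UnionDr A B A' B' (f : mor C A B) (g h : mor C A' B') :
    eqcob u n (Union f (Add g h)) (Add (Union f g) (Union f h))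
| eqc_UnionZl A B A' B' (a : C) (f : mor C A B) (h : mor C A' B') :
    eqcob u n (Union (Scale a f) h) (Scale a (Union f h))
| eqc_UnionZr A B A' B' (a : C) (f : mor C A B) (h : mor C A' B') :
    eqcob u n (Union f (Scale a h)) (Scale a (Union f h))
| eqc_compA A B D E (h : mor C D E) (g : mor C B D) (f : mor C A B) :
    eqcob u n (Comp h (Comp g f)) (Comp (Comp h g) f)
| eqc_idl A B (f : mor C A B) : eqcob u n (Comp (Id B) f) f
| eqc_idr A B (f : mor C A B) : eqcob u n (Comp f (Id A)) f
| eqc_relabel A B (f g : fbij A B) :
    fto f =1 fto g -> eqcob u n (Relabel f) (Relabel g)
| eqc_relabel_comp A B D (g : fbij B D) (f : fbij A B) :
    eqcob u n (Comp (Relabel g) (Relabel f)) (Relabel (bcomp g f))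
| eqc_relabel_union A B A' B' (f : fbij A B) (g : fbij A' B') :
    eqcob u n (Union (Relabel f) (Relabel g)) (Relabel (bsum f g))
| eqc_interchange A B D A' B' D' (g : mor C B D) (f : mor C A B)
    (g' : mor C B' D') (f' : mor C A' B') :
    eqcob u n (Comp (Union g g') (Union f f'))
              (Union (Comp g f) (Comp g' f'))
| eqc_assoc A B A' B' A'' B'' (f : mor C A B) (g : mor C A' B')
    (h : mor C A'' B'') :
    eqcob u n (Comp (Relabel (bassoc B B' B'')) (Union (Union f g) h))
              (Comp (Union f (Union g h)) (Relabel (bassoc A A' A'')))
| eqc_unit A B (f : mor C A B) :
    eqcob u n (Comp (Relabel (bunit B)) (Union (Id void) f))
              (Comp f (Relabel (bunit A)))
| eqc_swap A B A' B' (f : mor C A B) (g : mor C A' B') :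
    eqcob u n (Comp (Relabel (bswap B B')) (Union f g))
              (Comp (Union g f) (Relabel (bswap A A')))
| eqc_mergeA :
    eqcob u n (Comp Merge (Union Merge (Id unit)))
      (Comp Merge (Comp (Union (Id unit) Merge)
                        (Relabel (bassoc unit unit unit))))
| eqc_mergeC : eqcob u n (Comp Merge (Relabel (bswap unit unit))) Merge
| eqc_merge1 :
    eqcob u n (Comp Merge (Union Cap (Id unit))) (Relabel (bunit unit))
| eqc_splitA :
    eqcob u n (Comp (Relabel (bassoc unit unit unit))
                    (Comp (Union Split (Id unit)) Split))
              (Comp (Union (Id unit) Split) Split)
| eqc_splitC : eqcob u n (Comp (Relabel (bswap unit unit)) Split) Split
| eqc_split1 :
    eqcob u n (Comp (Union Cup (Id unit)) Split)
              (Relabel (binv (bunit unit)))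
| eqc_frobenius :
    eqcob u n (Comp (Union (Id unit) Merge)
                 (Comp (Relabel (bassoc unit unit unit))
                       (Union Split (Id unit))))
              (Comp Split Merge)
| eqc_dot_merge :
    eqcob u n (Comp Merge (Union Dot (Id unit))) (Comp Dot Merge)
| eqc_dot_split :
    eqcob u n (Comp (Union Dot (Id unit)) Split) (Comp Split Dot)
(* the composites through void are disjoint unions of two dotted disks *)
| eqc_NC :
    eqcob u n (Id unit)
      (\big[Add/Zero]_(i < n)
          Comp (Comp (dots C (n.-1 - i)) Cap) (Comp Cup (dots C i)))
| eqc_S : eqcob u n (Comp Cup Cap) Zero
| eqc_T :
    eqcob u n (Comp Cup (Comp Merge (Comp Split Cap))) (Scale n%:R (Id void))
| eqc_U t : u = Some t ->
    eqcob u n (Comp Cup (Comp (dots C n.*2.-1) Cap)) (Scale t (Id void)).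

Definition half_deg (n : nat) : rat := (n%:R - 1) / 2%:R.

Inductive mor_deg (C : numClosedFieldType) (n : nat) :
  forall A B : finType, mor C A B -> rat -> Prop :=
| deg_relabel A B (f : fbij A B) : mor_deg n (Relabel f) 0
| deg_merge : mor_deg n Merge (- half_deg n)
| deg_split : mor_deg n Split (- half_deg n)
| deg_cap : mor_deg n Cap (half_deg n)
| deg_cup : mor_deg n Cup (half_deg n)
| deg_dot : mor_deg n Dot (- 1)
| deg_comp A B D (g : mor C B D) (f : mor C A B) a b :
    mor_deg n f a -> mor_deg n g b -> mor_deg n (Comp g f) (a + b)
| deg_union A B A' B' (f : mor C A B) (g : mor C A' B') a b :
    mor_deg n f a -> mor_deg n g b -> mor_deg n (Union f g) (a + b)
| deg_zero A B a : mor_deg n (@Zero C A B) a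
| deg_add A B (f g : mor C A B) a :
    mor_deg n f a -> mor_deg n g a -> mor_deg n (Add f g) a
| deg_scale A B (c : C) (f : mor C A B) a :
    mor_deg n f a -> mor_deg n (Scale c f) a.

Section MatKom.
Variables (C : numClosedFieldType) (u : option C) (n : nat).

(* The formal direct sum, over k in midx, of the unions of circles mcirc k with
   their grading shifted by mshift k. *)
Record matobj := MatObj {
  midx : finType;
  mcirc : midx -> finType;
  mshift : midx -> int }.

Definition matmor (X Y : matobj) : Type :=
  forall (k : midx X) (l : midx Y), mor C (mcirc k) (mcirc l).

Definition mateq (X Y : matobj) (f g : matmor X Y) : Prop :=
  forall k l, eqcob u n (f k l) (g k l).

Definition matid (X : matobj) : matmor X X := fun k l =>
  match k =P l with
  | ReflectT e =>
      match e in _ = l' return mor C (mcirc k) (mcirc l') with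
      | erefl => Id (mcirc k)
      end
  | ReflectF _ => Zero
  end.

Definition matcomp (X Y Z : matobj) (g : matmor Y Z) (f : matmor X Y) :
  matmor X Z := fun k l => \big[Add/Zero]_(j : midx Y) Comp (g j l) (f k j).

Arguments matid : clear implicits.

Definition matadd (X Y : matobj) (f g : matmor X Y) : matmor X Y :=
  fun k l => Add (f k l) (g k l).

Definition matzero (X Y : matobj) : matmor X Y := fun k l => Zero.

Definition mat_deg0 (X Y : matobj) (f : matmor X Y) : Prop :=
  forall k l, exists2 f', eqcob u n (f k l) f' &
    mor_deg n f' ((mshift k)%:~R - (mshift l)%:~R).

(* Cochain complexes concentrated in degrees i >= 0; the equation on the
   differential is the predicate is_complex. *)
Record precomplex := PreComplex {
  cobj : nat -> matobj;
  cdiff : forall i, matmor (cobj i) (cobj i.+1) }.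

Arguments cdiff : clear implicits.

Definition is_complex (X : precomplex) : Prop :=
  forall i, mateq (matcomp (cdiff X i.+1) (cdiff X i))
                  (@matzero (cobj X i) (cobj X i.+2)).

Definition precomplex_map (X Y : precomplex) : Type :=
  forall i, matmor (cobj X i) (cobj Y i).

Definition is_chain_map (X Y : precomplex) (f : precomplex_map X Y) : Prop :=
  forall i, mateq (matcomp (cdiff Y i) (f i)) (matcomp (f i.+1) (cdiff X i)).

Definition homotopic (X Y : precomplex) (f g : precomplex_map X Y) : Prop :=
  exists h : forall i, matmor (cobj X i.+1) (cobj Y i),
    mateq (f 0%N) (matadd (g 0%N) (matcomp (h 0%N) (cdiff X 0%N))) /\
    forall i, mateq (f i.+1)
      (matadd (g i.+1) (matadd (matcomp (cdiff Y i) (h i))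
                               (matcomp (h i.+1) (cdiff X i.+1)))).

(* Isomorphism in Kom modulo homotopy, by chain maps that preserve the grading
   of the objects. *)
Definition kom_iso (X Y : precomplex) : Prop :=
  exists (f : precomplex_map X Y) (g : precomplex_map Y X),
    [/\ is_chain_map f, is_chain_map g,
        (forall i, mat_deg0 (f i)) /\ (forall i, mat_deg0 (g i)),
        homotopic (fun i => matcomp (g i) (f i)) (fun i => matid (cobj X i)) &
        homotopic (fun i => matcomp (f i) (g i)) (fun i => matid (cobj Y i))].
End MatKom.

Arguments cdiff {C}.

Section Bracket.
Variables (C : numClosedFieldType) (n : nat).

(* The cobordism between the affected circles, with m = n./2 and the factor
   sqrt n in the one-to-one case.  Other numbers of circles do not occur. *)
Definition saddle_core (X Y : finType) : mor C X Y :=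
  match #|X| =P #|{: unit}|, #|X| =P #|{: unit + unit}|,
        #|Y| =P #|{: unit}|, #|Y| =P #|{: unit + unit}| with
  | _, ReflectT x2, ReflectT y1, _ =>
      Comp (Relabel (binv (bcard y1))) (Comp Merge (Relabel (bcard x2)))
  | ReflectT x1, _, _, ReflectT y2 =>
      Comp (Relabel (binv (bcard y2)))
        (Comp (if odd n then Split else Comp Split Dot) (Relabel (bcard x1)))
  | ReflectT x1, _, ReflectT y1, _ =>
      Scale (sqrtC n%:R)
        (Comp (Relabel (binv (bcard y1)))
              (Comp (dots C n./2) (Relabel (bcard x1))))
  | _, _, _, _ => Zero
  end.

Variables (G : mgraph) (Ga : ribbon G).

Lemma unaffected_subl p (S S' : {set circle G}) : unaffected p S S' \subset S.
Proof. by apply/subsetP=> c; rewrite !inE => /andP[/andP[]]. Qed.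

Lemma unaffected_subr p (S S' : {set circle G}) : unaffected p S S' \subset S'.
Proof. by apply/subsetP=> c; rewrite !inE => /andP[/andP[]]. Qed.

Definition saddle p (S S' : {set circle G}) : mor C (elts S) (elts S') :=
  let U := unaffected p S S' in
  Comp (Relabel (binv (bsplit (unaffected_subr p S S'))))
    (Comp (Union (Id (elts U)) (saddle_core (elts (S :\: U)) (elts (S' :\: U))))
          (Relabel (bsplit (unaffected_subl p S S')))).

Definition cube_edge (alpha alpha' : {ffun 'I_(nedges G) -> bool}) :
  mor C (elts (state Ga alpha)) (elts (state Ga alpha')) :=
  match [pick p | flip01 alpha alpha' p] with
  | Some p => Scale (edge_sign C alpha p)
                    (saddle p (state Ga alpha) (state Ga alpha'))
  | None => Zero
  end.

Definition cube_vertex (i : nat) : finType :=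
  {alpha : {ffun 'I_(nedges G) -> bool} | weight alpha == i}.

Definition bracket : precomplex C :=
  @PreComplex C
    (fun i => @MatObj (cube_vertex i)
       (fun a => elts (state Ga (val a)))
       (fun a => (n./2 * weight (val a))%N%:Z))
    (fun i a b => cube_edge (val a) (val b)).
End Bracket.

Section Modules.
Variable C : numClosedFieldType.

(* Complexes of free modules with homogeneous bases; mdiff x y is the
   coefficient of y in the differential of x. *)
Record modcomplex := ModComplex {
  mbasis : nat -> finType;
  mbdeg : forall i, mbasis i -> int;
  mdiff : forall i, mbasis i -> mbasis i.+1 -> C }.

Variable K : modcomplex.

Definition chain (i : nat) : vectType C := {ffun mbasis K i -> C^o}.

Definition dfun (i : nat) (v : chain i) : chain i.+1 :=
  [ffun y => \sum_x v x * mdiff x y].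

Lemma dfun_is_linear i : linear (@dfun i).
Proof.
move=> a v w; apply/ffunP=> y; rewrite !ffunE scaler_sumr -big_split /=.
by apply: eq_bigr => x _; rewrite !ffunE mulrDl scalerAl.
Qed.

HB.instance Definition _ i :=
  GRing.isLinear.Build C (chain i) (chain i.+1) _ (@dfun i) (@dfun_is_linear i).

Definition diff (i : nat) : 'Hom(chain i, chain i.+1) := linfun (@dfun i).

Definition is_modcomplex : Prop := forall i v, diff i.+1 (diff i v) = 0.

Definition diff_deg0 : Prop :=
  forall i (x : mbasis K i) (y : mbasis K i.+1),
    mdiff x y != 0 -> mbdeg x = mbdeg y.

Definition deg_part (j : int) (i : nat) : {vspace chain i} :=
  <<[seq [ffun y => (y == x)%:R : C^o] | x <- enum (mbasis K i)
                                       & mbdeg x == j]>>%VS.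

Definition full_part (i : nat) : {vspace chain i} := fullv.

(* The homology in degree i of the part of the complex cut out by W is
   quotmod (cycles W i) (boundaries W i), with quotmod defined below. *)
Definition cycles (W : forall i, {vspace chain i}) (i : nat) :
  {vspace chain i} := (lker (diff i) :&: W i)%VS.

Definition boundaries (W : forall i, {vspace chain i}) (i : nat) :
  {vspace chain i} :=
  match i with 0%N => 0%VS | k.+1 => (diff k @: W k)%VS end.
End Modules.

Section QuotientModule.
Variables (C : fieldType) (V : vectType C) (Z B : {vspace V}).

Definition bnd_pred : {pred subvs_of Z} := [pred z | vsval z \in B].

Lemma bnd_zmod_closed : zmod_closed bnd_pred.
Proof.
split=> [|x y]; rewrite !inE ?linear0 ?mem0v // => xB yB.
by rewrite linearB rpredB.
Qed.
HB.instance Definition _ :=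
  GRing.isZmodClosed.Build (subvs_of Z) bnd_pred bnd_zmod_closed.

(* The quotient Z / (Z :&: B). *)
Definition quotmod := Quotient.quot bnd_pred.
HB.instance Definition _ := GRing.Zmodule.on quotmod.

Definition qclass (z : subvs_of Z) : quotmod := (\pi_quotmod z)%qT.

Definition qscale (a : C) (x : quotmod) : quotmod :=
  qclass (a *: (repr x : subvs_of Z)).

Lemma qclassP x y : (qclass x = qclass y) <-> (vsval (x - y) \in B).
Proof.
split=> [/eqP|h]; first by rewrite /qclass -Quotient.idealrBE inE.
by apply/eqP; rewrite /qclass -Quotient.idealrBE inE.
Qed.

Lemma qclassE x : exists y, x = qclass y.
Proof. by exists (repr x); rewrite /qclass reprK. Qed.

Lemma qclassD x y : qclass (x + y) = qclass x + qclass y.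
Proof. by rewrite /qclass Quotient.pi_add. Qed.

Lemma qscaleE a z : qscale a (qclass z) = qclass (a *: z).
Proof.
apply/qclassP; rewrite -scalerBr linearZ; apply: rpredZ.
by apply/qclassP; rewrite /qclass reprK.
Qed.

Lemma qscaleA a b v : qscale a (qscale b v) = qscale (a * b) v.
Proof. by have [y ->] := qclassE v; rewrite !qscaleE scalerA. Qed.
Lemma qscale1 : left_id 1 qscale.
Proof. by move=> v; have [y ->] := qclassE v; rewrite !qscaleE scale1r. Qed.
Lemma qscaleDr : right_distributive qscale +%R.
Proof.
move=> a v w; have [x ->] := qclassE v; have [y ->] := qclassE w.
by rewrite -qclassD !qscaleE -qclassD scalerDr.
Qed.
Lemma qscaleDl v : {morph qscale^~ v : a b / a + b}.
Proof.
by move=> a b; have [x ->] := qclassE v; rewrite !qscaleE -qclassD scalerDl.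
Qed.

HB.instance Definition _ := GRing.Zmodule_isLmodule.Build C quotmod
  qscaleA qscale1 qscaleDr qscaleDl.
End QuotientModule.

(* Equality of the homologies Z / B and Z' / B' formed inside one chain module:
   a linear bijection sending the class of each common cycle to its class.
   (Fcomplex n t (bracket C n Ga) and color_complex mu Ga have convertible chain
   modules, spanned by the monomials on the circles of the states.) *)
Definition same_quotient (C : fieldType) (V : vectType C)
  (Z B Z' B' : {vspace V}) : Prop :=
  exists2 Phi : {linear quotmod Z B -> quotmod Z' B'}, bijective Phi &
    forall (z : subvs_of Z) (z' : subvs_of Z'),
      vsval z = vsval z' -> Phi (qclass B z) = qclass B' z'.

Section Functor.
Variables (C : numClosedFieldType) (n : nat) (t : C).

(* The coefficient of x^l in the class of x^k in C[x]/(x^n - t). *)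
Definition red_coef (k l : nat) : C := ('X^k %% ('X^n - t%:P))`_l.

(* F sends a union of circles indexed by A to the tensor power of V_t over A,
   with basis the monomials f : A -> 'I_n (exponent f a on the factor a), and a
   morphism to its matrix: Fmor M f g is the coefficient of g in the image of
   f. *)
Fixpoint Fmor (A B : finType) (M : mor C A B) :
  {ffun A -> 'I_n} -> {ffun B -> 'I_n} -> C :=
  match M in mor _ A B return {ffun A -> 'I_n} -> {ffun B -> 'I_n} -> C with
  | Relabel _ _ s => fun f g => [forall a, g (fto s a) == f a]%:R
  | Merge => fun f g => red_coef (f (inl tt) + f (inr tt)) (g tt)
  | Split => fun f g =>
      \sum_(i < n) red_coef (f tt + i) (g (inl tt))
                   * (g (inr tt) == n.-1 - i :> nat)%N%:R
  | Cap => fun f g => (g tt == 0 :> nat)%N%:R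
  | Cup => fun f g => (f tt == n.-1 :> nat)%N%:R
  | Dot => fun f g => red_coef (f tt).+1 (g tt)
  | Comp _ _ _ N M => fun f g => \sum_h Fmor M f h * Fmor N h g
  | Union _ _ _ _ M N => fun f g =>
      Fmor M [ffun a => f (inl a)] [ffun b => g (inl b)]
      * Fmor N [ffun a => f (inr a)] [ffun b => g (inr b)]
  | Zero _ _ => fun f g => 0
  | Add _ _ M N => fun f g => Fmor M f g + Fmor N f g
  | Scale _ _ c M => fun f g => c * Fmor M f g
  end.

(* x^k has degree n./2 - k. *)
Definition monom_deg (A : finType) (f : {ffun A -> 'I_n}) : int :=
  \sum_a (n./2%:Z - (f a)%:Z).

Definition Fcomplex (X : precomplex C) : modcomplex C :=
  @ModComplex C
    (fun i => {k : midx (cobj X i) & {ffun mcirc k -> 'I_n}} : finType)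
    (fun i x => mshift (tag x) + monom_deg (tagged x))
    (fun i x y => Fmor (cdiff X i (tag x) (tag y)) (tagged x) (tagged y)).
End Functor.

(* Matrix coefficients of the three structure maps in the basis x^k. *)
Record color_maps (C : numClosedFieldType) (n : nat) := ColorMaps {
  col_mul : 'I_n -> 'I_n -> 'I_n -> C;
  col_comul : 'I_n -> 'I_n -> 'I_n -> C;
  col_eta : 'I_n -> 'I_n -> C }.

Definition bigraded_maps (C : numClosedFieldType) (n : nat) : color_maps C n :=
  {| col_mul := fun i j k => ('X^(i + j) %% 'X^n : {poly C})`_k;
     col_comul := fun k i j => (i + j == k + n./2.*2)%N%:R;
     col_eta := fun k l =>
       sqrtC n%:R * ('X^(k + n./2) %% 'X^n : {poly C})`_l |}.

Definition filtered_maps (C : numClosedFieldType) (n : nat) : color_maps C n :=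
  {| col_mul := fun i j k => ('X^(i + j) %% ('X^n - 1) : {poly C})`_k;
     col_comul := fun k i j => (i + j == k + n./2.*2 %[mod n])%N%:R;
     col_eta := fun k l =>
       sqrtC n%:R * ('X^(k + n./2) %% ('X^n - 1) : {poly C})`_l |}.

Section NColor.
Variables (C : numClosedFieldType) (n : nat) (mu : color_maps C n).
Variables (G : mgraph) (Ga : ribbon G).

Definition color_edge p (S S' : {set circle G})
  (f : {ffun elts S -> 'I_n}) (g : {ffun elts S' -> 'I_n}) : C :=
  let U := unaffected p S S' in
  if [forall c : elts S, forall c' : elts S',
        (val c \in U) && (val c == val c') ==> (f c == g c')]
  then match [seq f c | c <- enum (elts S) & val c \notin U],
             [seq g c | c <- enum (elts S') & val c \notin U] with
       | [:: i; j], [:: k] => col_mul mu i j k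
       | [:: k], [:: i; j] => col_comul mu k i j
       | [:: k], [:: l] => col_eta mu k l
       | _, _ => 0
       end
  else 0.

Definition color_diff (alpha alpha' : {ffun 'I_(nedges G) -> bool})
  (f : {ffun elts (state Ga alpha) -> 'I_n})
  (g : {ffun elts (state Ga alpha') -> 'I_n}) : C :=
  match [pick p | flip01 alpha alpha' p] with
  | Some p => edge_sign C alpha p * color_edge p f g
  | None => 0
  end.

Definition color_complex : modcomplex C :=
  @ModComplex C
    (fun i => {a : cube_vertex G i & {ffun elts (state Ga (val a)) -> 'I_n}}
              : finType)
    (fun i x => (n./2 * weight (val (tag x)))%N%:Z + monom_deg (tagged x))
    (fun i x y => color_diff (tagged x) (tagged y)).
End NColor.

(* Main.v *)
(* Neck cutting makes F faithful.  Cutting every circle reduces a cobordism to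
   its closed parts, spheres with dots; the torus relation forces a sphere with
   k < n - 1 dots to vanish and one with n - 1 dots to be 1, so that every closed
   part is a polynomial in U.  Hence two morphisms are equal as soon as F
   identifies them for all t <> 0.  For t = s^n with s <> 0 the algebra
   C[x]/(x^n - t) has a basis of orthogonal idempotents (the colours).  In it, up
   to a rescaling of the basis of each state, a saddle relates the colourings of
   the two states that agree along the boundary, with a coefficient depending
   only on the colour at the twisted band.  Therefore
   the faces of the cube commute up to the usual signs, and an equivalence of
   ribbon graphs acts by relabelling the circles, corrected by the sign of the
   induced reordering of the twisted edges.  For t = 0 and t = 1 the matrices of
   F([[Gamma]]) are those of the n-color complexes entry by entry. *)

From HB Require Import structures.
Require Import Defs.
From mathcomp Require Import all_boot all_order all_algebra.
From mathcomp Require Import reals complex.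
From mathcomp Require Import boolp separable cyclic cyclotomic zify ring.
Import Defs.
Set Implicit Arguments.
Unset Strict Implicit.
Unset Printing Implicit Defensive.
Import Order.TTheory GRing.Theory Num.Theory.
Local Open Scope ring_scope.

(** * Matrices of cobordisms *)

(** Completeness needs the values of all dotted spheres, while S and T give only those with 0 and n
    - 1 dots. Over a formal n-th root of U, neck cutting yields n commuting idempotents and the
    torus relation makes their sum equal to n; in characteristic 0 each of them is then the
    identity, and this yields the missing values. The argument runs on sequences with y_(n+k) = U
    y_k, so that no root of U has to be adjoined. At t = 0 there is no basis of idempotents:
    identities found at t = s^n are read as identities between polynomials in t, which specialise to
    t = 0 and also to the closed surface U when no value is imposed on it. The factor sqrt n and the
    extra dot for even n have one purpose in the colour basis: they make the splitting coefficient
    the square of the one-to-one coefficient, fusion having coefficient 1. Colourings of different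
    states become comparable because the circles of every state are parametrised by one fixed set,
    the flags and the isolated vertices. The two chain maps attached to an equivalence are inverse
    to each other exactly, so the homotopies are zero. *)

Section FfunSums.
Variables (K : comPzRingType) (I : finType).

Definition fjoin (A B : finType) (f : {ffun A -> I}) (g : {ffun B -> I}) :
  {ffun A + B -> I} :=
  [ffun x => match x with inl a => f a | inr b => g b end].

Lemma fjoinl (A B : finType) (f : {ffun A -> I}) (g : {ffun B -> I}) :
  [ffun a => fjoin f g (inl a)] = f.
Proof. by apply/ffunP=> a; rewrite !ffunE. Qed.

Lemma fjoinr (A B : finType) (f : {ffun A -> I}) (g : {ffun B -> I}) :
  [ffun b => fjoin f g (inr b)] = g.
Proof. by apply/ffunP=> a; rewrite !ffunE. Qed.

Lemma fjoinK (A B : finType) (h : {ffun A + B -> I}) :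
  fjoin [ffun a => h (inl a)] [ffun b => h (inr b)] = h.
Proof. by apply/ffunP=> -[a|a]; rewrite !ffunE. Qed.

Lemma big_fjoin (R : Type) (idx : R) (op : Monoid.com_law idx) (A B : finType)
    (F : {ffun A + B -> I} -> R) :
  \big[op/idx]_h F h = \big[op/idx]_f \big[op/idx]_g F (fjoin f g).
Proof.
rewrite pair_big /=.
rewrite (reindex (fun p : {ffun A -> I} * {ffun B -> I} => fjoin p.1 p.2)) //=.
exists (fun h : {ffun A + B -> I} =>
  ([ffun a => h (inl a)], [ffun b => h (inr b)])).
  by case=> f g _; rewrite fjoinl fjoinr.
by move=> h _; rewrite fjoinK.
Qed.

Lemma sum_fjoin (A B : finType) (F : {ffun A + B -> I} -> K) :
  \sum_h F h = \sum_f \sum_g F (fjoin f g).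
Proof. exact: big_fjoin. Qed.

Lemma sum_ffun_unit (F : {ffun unit -> I} -> K) :
  \sum_h F h = \sum_i F [ffun=> i].
Proof.
rewrite (reindex (fun i : I => [ffun _ : unit => i])) //=.
exists (fun h : {ffun unit -> I} => h tt) => [i|h] _; first by rewrite ffunE.
by apply/ffunP=> -[]; rewrite ffunE.
Qed.

Lemma ffun_void (f g : {ffun void -> I}) : f = g.
Proof. by apply/ffunP. Qed.

Lemma sum_ffun_void (F : {ffun void -> I} -> K) (h : {ffun void -> I}) :
  \sum_h F h = F h.
Proof. by rewrite (big_pred1 h) // => g; apply/esym/eqP/ffun_void. Qed.

Lemma sum_ffun_pull (A B : finType) (s : fbij A B) (f : {ffun A -> I})
    (F : {ffun B -> I} -> K) :
  \sum_(h : {ffun B -> I}) [forall a, h (fto s a) == f a]%:R * F h = F [ffun b => f (ffrom s b)].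
Proof.
rewrite (bigD1 [ffun b => f (ffrom s b)]) //= big1 ?addr0.
  suff ->: [forall a, [ffun b => f (ffrom s b)] (fto s a) == f a] by rewrite mul1r.
  by apply/forallP=> a; rewrite ffunE ftoK.
move=> h /eqP hne; case: forallP => [h1|_]; last by rewrite mul0r.
by case: hne; apply/ffunP=> b; rewrite ffunE -(eqP (h1 _)) ffromK.
Qed.

Lemma sum_ffun_push (A B : finType) (s : fbij A B) (g : {ffun B -> I})
    (F : {ffun A -> I} -> K) :
  \sum_(h : {ffun A -> I}) F h * [forall a, g (fto s a) == h a]%:R = F [ffun a => g (fto s a)].
Proof.
rewrite (bigD1 [ffun a => g (fto s a)]) //= big1 ?addr0.
  suff ->: [forall a, g (fto s a) == [ffun a => g (fto s a)] a] by rewrite mulr1.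
  by apply/forallP=> a; rewrite ffunE.
move=> h /eqP hne; case: forallP => [h1|_]; last by rewrite mulr0.
by case: hne; apply/ffunP=> b; rewrite ffunE (eqP (h1 _)).
Qed.
End FfunSums.

(** The structure constants stay abstract so that a single evaluation serves the monomial basis at a
    number t, at the indeterminate and at the closed surface U, as well as the colour basis. *)
Record gens (K : Type) (n : nat) := Gens {
  gen_merge : 'I_n -> 'I_n -> 'I_n -> K;
  gen_split : 'I_n -> 'I_n -> 'I_n -> K;
  gen_cap : 'I_n -> K;
  gen_cup : 'I_n -> K;
  gen_dot : 'I_n -> 'I_n -> K }.

Section Eval.
Variables (C : numClosedFieldType) (n : nat).

Section Def.
Variables (K : comPzRingType) (phi : {rmorphism C -> K}) (D : gens K n).

Fixpoint ev (A B : finType) (M : mor C A B) :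
  {ffun A -> 'I_n} -> {ffun B -> 'I_n} -> K :=
  match M in mor _ A B return {ffun A -> 'I_n} -> {ffun B -> 'I_n} -> K with
  | Relabel _ _ s => fun f g => [forall a, g (fto s a) == f a]%:R
  | Merge => fun f g => gen_merge D (f (inl tt)) (f (inr tt)) (g tt)
  | Split => fun f g => gen_split D (f tt) (g (inl tt)) (g (inr tt))
  | Cap => fun f g => gen_cap D (g tt)
  | Cup => fun f g => gen_cup D (f tt)
  | Dot => fun f g => gen_dot D (f tt) (g tt)
  | Comp _ _ _ N M => fun f g => \sum_h ev M f h * ev N h g
  | Union _ _ _ _ M N => fun f g =>
      ev M [ffun a => f (inl a)] [ffun b => g (inl b)]
      * ev N [ffun a => f (inr a)] [ffun b => g (inr b)]
  | Zero _ _ => fun f g => 0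
  | Add _ _ M N => fun f g => ev M f g + ev N f g
  | Scale _ _ c M => fun f g => phi c * ev M f g
  end.
End Def.

Lemma ev_map (K K' : comPzRingType) (phi : {rmorphism C -> K})
    (phi' : {rmorphism C -> K'}) (psi : {rmorphism K -> K'})
    (D : gens K n) (D' : gens K' n) :
  (forall c, psi (phi c) = phi' c) ->
  (forall i j k, psi (gen_merge D i j k) = gen_merge D' i j k) ->
  (forall i j k, psi (gen_split D i j k) = gen_split D' i j k) ->
  (forall i, psi (gen_cap D i) = gen_cap D' i) ->
  (forall i, psi (gen_cup D i) = gen_cup D' i) ->
  (forall i j, psi (gen_dot D i j) = gen_dot D' i j) ->
  forall (A B : finType) (M : mor C A B) f g,
    psi (ev phi D M f g) = ev phi' D' M f g.
Proof.
move=> hphi hM hS hI hE hD A B; elim=> //=.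
- by move=> *; rewrite rmorph_nat.
- move=> {}A {}B D0 N IHN M IHM f g; rewrite rmorph_sum; apply: eq_bigr => h _.
  by rewrite rmorphM IHN IHM.
- by move=> {}A {}B A' B' M IHM N IHN f g; rewrite rmorphM IHN IHM.
- by move=> *; rewrite rmorph0.
- by move=> {}A {}B M IHM N IHN f g; rewrite rmorphD IHN IHM.
- by move=> {}A {}B c M IHM f g; rewrite rmorphM IHM hphi.
Qed.

Section Intertwine.
Variables (D D' : gens C n) (P : 'I_n -> 'I_n -> C).
Notation ev1 := (ev idfun D).
Notation ev2 := (ev idfun D').

Definition tens (A : finType) (f c : {ffun A -> 'I_n}) : C :=
  \prod_a P (f a) (c a).

Lemma tens_fjoin (A B : finType) f f' (c : {ffun A + B -> 'I_n}) :
  tens (fjoin f f') c =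
  tens f [ffun a => c (inl a)] * tens f' [ffun b => c (inr b)].
Proof.
by rewrite /tens big_sumType /=; congr (_ * _); apply: eq_bigr => a _;
  rewrite !ffunE.
Qed.

Lemma tens_unit (f c : {ffun unit -> 'I_n}) : tens f c = P (f tt) (c tt).
Proof. by rewrite /tens (big_pred1 tt) // => -[]. Qed.

Lemma tens_void (f c : {ffun void -> 'I_n}) : tens f c = 1.
Proof. by rewrite /tens big_pred0 // => -[]. Qed.

Hypothesis hM : forall i j c,
  \sum_k gen_merge D i j k * P k c
  = \sum_d \sum_e P i d * P j e * gen_merge D' d e c.
Hypothesis hS : forall k c c',
  \sum_i \sum_j gen_split D k i j * (P i c * P j c')
  = \sum_d P k d * gen_split D' d c c'.
Hypothesis hI : forall c, \sum_k gen_cap D k * P k c = gen_cap D' c.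
Hypothesis hE : forall k, gen_cup D k = \sum_d P k d * gen_cup D' d.
Hypothesis hD : forall i c,
  \sum_k gen_dot D i k * P k c = \sum_d P i d * gen_dot D' d c.

Lemma tens_uu (f c : {ffun unit + unit -> 'I_n}) :
  tens f c = P (f (inl tt)) (c (inl tt)) * P (f (inr tt)) (c (inr tt)).
Proof. by rewrite -(fjoinK f) tens_fjoin !tens_unit !ffunE. Qed.

(** Tensor powers of [P] commute with relabelling, composition, union and linear combination, so a
    change of basis has to be checked on the generators only. *)
Lemma ev_intertwine (A B : finType) (M : mor C A B) f c :
  \sum_g ev1 M f g * tens g c = \sum_d tens f d * ev2 M d c.
Proof.
elim: M f c => {A B} /=.
- move=> A B s f c; rewrite sum_ffun_pull.
  rewrite (sum_ffun_push s c (tens f)) /tens.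
  rewrite (reindex (fto s)) /=; last first.
    by exists (ffrom s) => x _; rewrite (ftoK, ffromK).
  by apply: eq_bigr => a _; rewrite !ffunE ftoK.
- move=> f c; rewrite sum_ffun_unit sum_fjoin sum_ffun_unit.
  under eq_bigr do rewrite tens_unit !ffunE.
  rewrite hM; apply: eq_bigr => d _; rewrite sum_ffun_unit; apply: eq_bigr => e _.
  by rewrite tens_uu !ffunE.
- move=> f c; rewrite sum_fjoin !sum_ffun_unit.
  under eq_bigr => i _.
    rewrite sum_ffun_unit; under eq_bigr => j _ do rewrite tens_uu !ffunE.
    over.
  rewrite hS; apply: eq_bigr => d _.
  by rewrite tens_unit !ffunE.
- move=> f c; rewrite sum_ffun_unit (sum_ffun_void _ f) tens_void mul1r -hI.
  by apply: eq_bigr => k _; rewrite tens_unit !ffunE.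
- move=> f c; rewrite sum_ffun_unit (sum_ffun_void _ c) tens_void mulr1 hE.
  by apply: eq_bigr => k _; rewrite tens_unit !ffunE.
- move=> f c; rewrite !sum_ffun_unit.
  under eq_bigr do rewrite tens_unit !ffunE.
  by rewrite hD; apply: eq_bigr => d _; rewrite tens_unit !ffunE.
- move=> A B E N IHN M IHM f c.
  under eq_bigr do rewrite mulr_suml.
  rewrite exchange_big /=.
  under eq_bigr => h _.
    under eq_bigr do rewrite -mulrA.
    rewrite -mulr_sumr IHN mulr_sumr; over.
  rewrite exchange_big /=; under [RHS]eq_bigr do rewrite mulr_sumr.
  rewrite [RHS]exchange_big /=; apply: eq_bigr => h _.
  under [LHS]eq_bigr do rewrite mulrA.
  under [RHS]eq_bigr do rewrite mulrA.
  by rewrite -!mulr_suml IHM.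
- move=> A B A' B' M IHM N IHN f c; rewrite !sum_fjoin.
  rewrite -(fjoinK f).
  transitivity ((\sum_g ev1 M [ffun a => f (inl a)] g * tens g [ffun a => c (inl a)])
    * (\sum_g ev1 N [ffun a => f (inr a)] g * tens g [ffun a => c (inr a)])).
    rewrite mulr_suml; apply: eq_bigr => g _; rewrite mulr_sumr.
    by apply: eq_bigr => g' _; rewrite tens_fjoin !fjoinl !fjoinr mulrACA.
  rewrite IHM IHN mulr_suml; apply: eq_bigr => g _; rewrite mulr_sumr.
  by apply: eq_bigr => g' _; rewrite tens_fjoin !fjoinl !fjoinr mulrACA.
- by move=> A B f c; rewrite !big1 // => d _; rewrite (mul0r, mulr0).
- move=> A B M IHM N IHN f c.
  under eq_bigr do rewrite mulrDl.
  under [RHS]eq_bigr do rewrite mulrDr.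
  by rewrite !big_split /= IHM IHN.
- move=> A B a M IHM f c.
  under eq_bigr do rewrite -mulrA.
  under [RHS]eq_bigr do rewrite mulrCA.
  by rewrite -!mulr_sumr IHM.
Qed.

Variable (Q : 'I_n -> 'I_n -> C).
Hypothesis hPQ : forall i j, \sum_c P i c * Q c j = (i == j)%:R.

Lemma tens_inv (A : finType) (f g : {ffun A -> 'I_n}) :
  \sum_c tens f c * \prod_a Q (c a) (g a) = (f == g)%:R.
Proof.
under eq_bigr do rewrite -big_split /=.
rewrite -(bigA_distr_bigA (fun a i => P (f a) i * Q i (g a))) /=.
under eq_bigr do rewrite hPQ.
case: eqP => [->|fg]; first by rewrite big1 // => a _; rewrite eqxx.
have [a ha] : exists a, f a != g a.
  by apply/existsP; rewrite -negb_forall; apply/negP => /forallP h; apply: fg;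
     apply/ffunP=> a; apply/eqP.
by rewrite (bigD1 a) //= (negbTE ha) mul0r.
Qed.

(** Multiplying the intertwining relation by the tensor power of [Q] recovers the matrix in the
    first basis from the one in the second. *)
Lemma ev_inj (A B : finType) (M N : mor C A B) :
  (ev2 M =2 ev2 N) -> ev1 M =2 ev1 N.
Proof.
move=> h.
have key (L : mor C A B) f g :
    ev1 L f g = \sum_c (\sum_d tens f d * ev2 L d c) * \prod_a Q (c a) (g a).
  under eq_bigr do rewrite -ev_intertwine mulr_suml.
  rewrite exchange_big /=.
  under eq_bigr => g' _.
    under eq_bigr do rewrite -mulrA.
    rewrite -mulr_sumr tens_inv; over.
  rewrite (bigD1 g) //= eqxx mulr1 big1 ?addr0 // => g' /negbTE ->.
  by rewrite mulr0.
move=> f g; rewrite !key; apply: eq_bigr => c _; congr (_ * _).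
by apply: eq_bigr => d _; rewrite h.
Qed.
End Intertwine.
End Eval.

(** * Roots of unity and reduction modulo x^n - t *)

Section RootsOfUnity.
Variables (C : numClosedFieldType) (n : nat).
Hypothesis n_gt0 : (0 < n)%N.

(** X^n - 1 splits over C and is separable in characteristic 0, and n distinct n-th roots of unity
    always include a primitive one. *)
Lemma prim_root_exists : exists z : C, n.-primitive_root z.
Proof.
pose p : {poly C} := 'X^n - 1; have [r Dp] := closed_field_poly_normal p.
rewrite (monicP _) ?monicXnsubC // scale1r in Dp.
have rn1: all n.-unity_root r by apply/allP=> z; rewrite -root_prod_XsubC -Dp.
have sz_r: (n < (size r).+1)%N.
  by rewrite -(size_prod_XsubC r id) -Dp size_XnsubC.
have [|z] := hasP (has_prim_root n_gt0 rn1 _ sz_r); last by exists z.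
by rewrite -separable_prod_XsubC -Dp separable_Xn_sub_1 // pnatr_eq0 -lt0n.
Qed.

Variable z : C.
Hypothesis z_prim : n.-primitive_root z.

Lemma sum_prim_root i : \sum_(j < n) z ^+ (i * j) = (n %| i)%:R * n%:R.
Proof.
case: (boolP (n %| i)%N) => [|n_i].
  case/dvdnP=> k ->; under eq_bigr => j _.
    rewrite -mulnA mulnCA exprM (prim_expr_order z_prim) expr1n; over.
  by rewrite sumr_const card_ord mul1r.
have hz : z ^+ i - 1 != 0 by rewrite subr_eq0 -(prim_order_dvd z_prim).
apply: (mulfI hz); rewrite mul0r mulr0.
have := subrX1 (z ^+ i) n.
rewrite -exprM mulnC exprM (prim_expr_order z_prim) expr1n subrr => /esym.
by under eq_bigr do rewrite -exprM.
Qed.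
End RootsOfUnity.

Section Reduction.
Variables (K : comPzRingType) (n : nat).
Hypothesis n_gt0 : (0 < n)%N.

(** Closed form of [red_coef], meaningful over any commutative ring, so that t may be an
    indeterminate or a closed surface. *)
Definition red (t : K) (k l : nat) : K := (k %% n == l)%N%:R * t ^+ (k %/ n).

(** In the comultiplication of x^k, the sum of the x^(k+i) (x) x^(n-1-i), only i = n-1-j contributes
    to the second factor x^j; this is the splitting entry. *)
Definition gens_mono (t : K) : gens K n :=
  Gens (fun i j k => red t (i + j) k) (fun k i j => red t (k + (n.-1 - j)) i)
       (fun k => (k == 0 :> nat)%N%:R) (fun k => (k == n.-1 :> nat)%N%:R)
       (fun i k => red t i.+1 k).

Lemma sum_red t x k : x ^+ n = t -> \sum_(l < n) red t k l * x ^+ l = x ^+ k.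
Proof.
move=> xt; rewrite (bigD1 (Ordinal (ltn_pmod k n_gt0))) //= big1 ?addr0.
  by rewrite /red eqxx mul1r -xt -exprM -exprD mulnC -divn_eq.
move=> l /eqP hl; rewrite /red; case: eqP => [e|_]; last by rewrite !mul0r.
by case: hl; apply: val_inj.
Qed.
End Reduction.

Lemma red_coefE (C : numClosedFieldType) (n : nat) (t : C) k l :
  (0 < n)%N -> red_coef n t k l = red n t k l.
Proof.
move=> n_gt0; rewrite /red_coef.
have <- : t ^+ (k %/ n) *: 'X^(k %% n) = 'X^k %% ('X^n - t%:P).
  (* The geometric sum: quotient of (X^n)^a - t^a by X^n - t, with a = k %/ n. *)
  pose q := \sum_(i < k %/ n) ('X^n : {poly C}) ^+ ((k %/ n).-1 - i) * t%:P ^+ i.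
  apply: (@modpP _ _ (q * 'X^(k %% n))).
    rewrite mulrAC (mulrC q) -subrXX -exprM mulrBl -exprD mulnC -divn_eq.
    by rewrite -rmorphXn -mul_polyC subrK.
  rewrite size_XnsubC //; apply: leq_ltn_trans (size_scale_leq _ _) _.
  by rewrite size_polyXn ltnS ltn_pmod.
by rewrite coefZ coefXn /red eq_sym mulrC.
Qed.

Section Colours.
Variables (C : numClosedFieldType) (n : nat).
Hypothesis n_gt0 : (0 < n)%N.

Lemma Fmor_ev (t : C) (A B : finType) (M : mor C A B) f g :
  Fmor (n := n) t M f g = ev idfun (gens_mono n t) M f g.
Proof.
elim: M f g => //= {A B}.
- by move=> f g; rewrite red_coefE.
- move=> f g; have hj := ltn_ord (g (inr tt)).
  (* [rev_ord] gives the unique i with n-1-i equal to the second outgoing exponent. *)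
  rewrite (bigD1 (rev_ord (g (inr tt)))) //= big1 ?addr0.
    have -> : (n - (g (inr tt)).+1 = n.-1 - g (inr tt))%N by lia.
    by rewrite red_coefE // subKn ?eqxx ?mulr1 //; lia.
  move=> i hi; case: eqP => [e|_]; last by rewrite mulr0.
  case/eqP: hi; apply: val_inj; rewrite /= e; move: (ltn_ord i) => hi.
  lia.
- by move=> f g; rewrite red_coefE.
- by move=> A B D N IHN M IHM f g; apply: eq_bigr => h _; rewrite IHM IHN.
- by move=> A B A' B' M IHM N IHN f g; rewrite IHM IHN.
- by move=> A B M IHM N IHN f g; rewrite IHM IHN.
- by move=> A B c M IHM f g; rewrite IHM.
Qed.
End Colours.

(** * The colour basis *)

Section ColourBasis.
Variables (C : numClosedFieldType) (n : nat).
Hypothesis n_gt0 : (0 < n)%N.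
Variables (s z : C).
Hypotheses (s_neq0 : s != 0) (z_prim : n.-primitive_root z).

Definition lam (c : 'I_n) : C := s * z ^+ c.

(* The structure maps of C[x]/(x^n - s^n) in the basis of the idempotents e_c on
   which x acts by [lam c]; the counit of e_c is 1 / p'(lam c) for p = x^n - s^n. *)
Definition gens_colour : gens C n :=
  Gens (fun i j k => ((i == k) && (j == k))%:R)
       (fun k i j => ((k == i) && (k == j))%:R * (n%:R * lam k ^+ n.-1))
       (fun=> 1) (fun k => (n%:R * lam k ^+ n.-1)^-1)
       (fun i k => (i == k)%:R * lam i).

Lemma n_neq0 : n%:R != 0 :> C. Proof. by rewrite pnatr_eq0 -lt0n. Qed.

Lemma lam_neq0 c : lam c != 0.
Proof.
by rewrite mulf_neq0 // expf_neq0 // (prim_root_eq0 z_prim) -lt0n.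
Qed.

Lemma lamXn c : lam c ^+ n = s ^+ n.
Proof. by rewrite exprMn exprAC (prim_expr_order z_prim) expr1n mulr1. Qed.

Lemma lam_inj : injective lam.
Proof.
move=> i j /(mulfI s_neq0) /eqP.
by rewrite (eq_prim_root_expr z_prim) !modn_small // => /eqP /val_inj.
Qed.

Lemma sum_lam i j : (i < n)%N -> (j < n)%N ->
  \sum_c lam c ^+ i / lam c ^+ j = (i == j)%:R * n%:R.
Proof.
move=> hi hj.
under eq_bigr => c _.
  (* Dividing by z^(jc) is multiplying by z^((n-j)c), which keeps the exponents natural numbers as
     [sum_prim_root] requires. *)
  have -> : lam c ^+ i / lam c ^+ j = s ^+ i / s ^+ j * z ^+ ((i + (n - j)) * c).
    have zj : z ^+ (j * c) != 0.
      by rewrite expf_neq0 // (prim_root_eq0 z_prim) -lt0n.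
    rewrite !exprMn -!exprM invfM mulrACA; congr (_ * _).
    apply: (mulIf zj); rewrite (mulnC c j) divfK // -exprD.
    rewrite -mulnDl -addnA subnK 1?ltnW // mulnDl exprD.
    by rewrite [_ ^+ (n * c)]exprM (prim_expr_order z_prim) expr1n mulr1 mulnC.
  over.
rewrite -mulr_sumr (sum_prim_root z_prim) mulrA.
case: (ltngtP i j) => [ij|ji|->].
- rewrite (_ : n %| _ = false)%N ?mulr0 //.
  by apply/negbTE; rewrite /dvdn modn_small; lia.
- rewrite (_ : n %| _ = false)%N ?mulr0 //.
  apply/negbTE; rewrite /dvdn (_ : i + _ = i - j + n)%N; last by lia.
  by rewrite modnDr modn_small; lia.
- by rewrite subnKC 1?ltnW // dvdnn mulr1 divff ?expf_neq0.
Qed.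

(** The sum is the quotient of x^n - y^n by x - y. It vanishes at two distinct roots of x^n = s^n
    and equals the derivative n x^(n-1) on the diagonal. *)
Lemma sum_lam2 c c' :
  \sum_(j < n) lam c ^+ (n.-1 - j) * lam c' ^+ j
  = (c == c')%:R * (n%:R * lam c ^+ n.-1).
Proof.
case: eqP => [<-|/eqP cc'].
  under eq_bigr => j _ do
    (rewrite -exprD subnK; last by rewrite -ltnS prednK ?ltn_ord).
  by rewrite sumr_const card_ord mul1r mulr_natl.
have := subrXX (lam c) (lam c') n; rewrite !lamXn subrr => /esym/eqP.
rewrite mulf_eq0 subr_eq0 (inj_eq lam_inj) (negbTE cc') /= => /eqP ->.
by rewrite mul0r.
Qed.

Lemma sum_eq_l (K : comPzRingType) (I : finType) (a : I) (F : I -> K) :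
  \sum_i (i == a)%:R * F i = F a.
Proof.
rewrite (bigD1 a) //= eqxx mul1r big1 ?addr0 // => i /negbTE ->.
by rewrite mul0r.
Qed.

Lemma sum_eq_r (K : comPzRingType) (I : finType) (a : I) (F : I -> K) :
  \sum_i (a == i)%:R * F i = F a.
Proof. by under eq_bigr do rewrite eq_sym; rewrite sum_eq_l. Qed.

Lemma mono_of_colour (A B : finType) (M N : mor C A B) :
  ev idfun gens_colour M =2 ev idfun gens_colour N ->
  ev idfun (gens_mono n (s ^+ n)) M =2 ev idfun (gens_mono n (s ^+ n)) N.
Proof.
(* The change of basis is x^i = sum_c lam(c)^i e_c; orthogonality of the roots of unity inverts this
   Vandermonde matrix. The goals are merge, split, cap, cup, dot and the inverse. *)
apply: (@ev_inj _ _ _ _ (fun i c => lam c ^+ i) _ _ _ _ _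
   (fun c j => (n%:R * lam c ^+ j)^-1)).
- move=> i j c /=; rewrite (sum_red n_gt0 _ (lamXn c)).
  under eq_bigr => d _.
    under eq_bigr => e _ do rewrite -mulnb natrM mulrC mulrACA.
    rewrite -mulr_sumr sum_eq_l -mulrA; over.
  by rewrite sum_eq_l exprD.
- move=> k c c' /=.
  under [RHS]eq_bigr => d _ do rewrite mulrCA -mulnb natrM -mulrA.
  rewrite sum_eq_l; case: eqP => [->|/eqP hc]; last first.
    rewrite mul0r exchange_big /=.
    under eq_bigr => j _ do under eq_bigr => i _ do rewrite mulrA.
    under eq_bigr => j _ do rewrite -mulr_suml (sum_red n_gt0 _ (lamXn c)) exprD -mulrA.
    by rewrite -mulr_sumr sum_lam2 (negbTE hc) mul0r mulr0.
  rewrite mul1r exchange_big /=.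
  under eq_bigr => j _ do under eq_bigr => i _ do rewrite mulrA.
  under eq_bigr => j _ do rewrite -mulr_suml (sum_red n_gt0 _ (lamXn c')) exprD -mulrA.
  by rewrite -mulr_sumr sum_lam2 eqxx mul1r.
- move=> c /=; have h : (0 < n)%N by [].
  by under eq_bigr => k _ do rewrite -[k == 0 :> nat]/(k == Ordinal h); rewrite sum_eq_l.
- move=> k /=; under eq_bigr => d _ do rewrite invfM mulrCA.
  rewrite -mulr_sumr sum_lam ?ltn_ord ?prednK //.
  by rewrite mulrCA mulVf ?mulr1 ?n_neq0.
- move=> i c /=; rewrite (sum_red n_gt0 _ (lamXn c)).
  by under eq_bigr do rewrite mulrCA; rewrite sum_eq_l exprSr.
- move=> i j; under eq_bigr => c _ do rewrite invfM mulrCA.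
  by rewrite -mulr_sumr sum_lam ?ltn_ord // mulrCA mulVf ?mulr1 ?n_neq0.
Qed.
End ColourBasis.

(** * Polynomial dependence of F on t *)

Section Density.
Variables (C : numClosedFieldType) (n : nat).
Hypothesis n_gt0 : (0 < n)%N.

(** In characteristic 0 the positive integers up to the size of [p] are distinct and nonzero, and
    they are too many roots for a nonzero [p]. *)
Lemma poly_eq0_generic (p : {poly C}) : (forall t, t != 0 -> p.[t] = 0) -> p = 0.
Proof.
move=> h; apply/eqP; apply/negPn/negP => p0.
have := max_poly_roots p0 (rs := [seq i.+1%:R | i <- iota 0 (size p)]).
rewrite size_map size_iota ltnn => H; apply: notF; apply: H.
  by apply/allP=> _ /mapP[i _ ->]; apply/eqP/h; rewrite pnatr_eq0.
rewrite map_inj_uniq ?iota_uniq // => i j /eqP.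
by rewrite eqr_nat eqSS => /eqP.
Qed.

(** F with t an indeterminate: one matrix that specialises to every complex t and, in the
    completeness proof, to U. *)
Definition Fpoly (A B : finType) (M : mor C A B) :=
  ev (@polyC C : {rmorphism C -> {poly C}}) (gens_mono n 'X) M.

Lemma Fpoly_horner t (A B : finType) (M : mor C A B) f g :
  (Fpoly M f g).[t] = ev idfun (gens_mono n t) M f g.
Proof.
rewrite -[_.[t]]/(horner_eval t (Fpoly M f g)).
have hred k l : horner_eval t (red n 'X k l) = red n t k l.
  rewrite /red /horner_eval.
  by case: eqP => _; rewrite ?mul1r ?mul0r ?hornerXn ?horner0.
apply: ev_map => [c|i j k|i j k|i|i|i j].
- exact: hornerC.
- exact: hred.
- exact: hred.
- by rewrite rmorph_nat.
- by rewrite rmorph_nat.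
- exact: hred.
Qed.

Lemma Fpoly_generic (A B : finType) (M N : mor C A B) :
  (forall t, t != 0 -> Fmor (n := n) t M =2 Fmor t N) -> Fpoly M =2 Fpoly N.
Proof.
move=> h f g; apply/eqP; rewrite -subr_eq0; apply/eqP/poly_eq0_generic => t t0.
rewrite hornerD hornerN !Fpoly_horner -!Fmor_ev // h //; exact: subrr.
Qed.

Variables (z : C).
Hypotheses (z_prim : n.-primitive_root z).

Lemma Fmor_of_colour (A B : finType) (M N : mor C A B) :
  (forall s, s != 0 ->
    ev idfun (gens_colour n s z) M =2 ev idfun (gens_colour n s z) N) ->
  forall t, t != 0 -> Fmor (n := n) t M =2 Fmor t N.
Proof.
move=> h t t0 f g; rewrite !Fmor_ev // -(rootCK n_gt0 t).
have s0 : n.-root t != 0 by rewrite rootC_eq0.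
exact: (mono_of_colour n_gt0 s0 z_prim (h _ s0)).
Qed.

(** The colour basis exists only where x^n - t is separable; the value t = 0 is reached through the
    equality of the polynomial matrices. *)
Lemma mono_of_colours (A B : finType) (M N : mor C A B) :
  (forall s, s != 0 ->
    ev idfun (gens_colour n s z) M =2 ev idfun (gens_colour n s z) N) ->
  forall t, ev idfun (gens_mono n t) M =2 ev idfun (gens_mono n t) N.
Proof.
move=> /Fmor_of_colour/Fpoly_generic h t f g.
by rewrite -!Fpoly_horner h.
Qed.
End Density.

Lemma forall_unit (P : pred unit) : [forall a, P a] = P tt.
Proof. by apply/forallP/idP => [|h []]. Qed.

Lemma ev_bigAdd (C : numClosedFieldType) (n : nat) (K : comPzRingType)
    (phi : {rmorphism C -> K}) (D : gens K n) (A B : finType) (I : Type)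
    (r : seq I) (P : pred I) (F : I -> mor C A B) f g :
  ev phi D (\big[Add/Zero]_(i <- r | P i) F i) f g
  = \sum_(i <- r | P i) ev phi D (F i) f g.
Proof. by apply: (big_morph (fun M => ev phi D M f g)). Qed.

(** * The defining relations in the colour basis, and soundness of F *)

Section Soundness.
Variables (C : numClosedFieldType) (n : nat).
Hypothesis n_gt1 : (1 < n)%N.
Let n_gt0 : (0 < n)%N := ltnW n_gt1.
Variables (s z : C).
Hypotheses (s_neq0 : s != 0) (z_prim : n.-primitive_root z).
Notation lam := (lam s z).
Notation evc := (ev idfun (gens_colour n s z)).

Lemma evc_dots k f g :
  evc (dots C k) f g = (f tt == g tt)%:R * lam (f tt) ^+ k.
Proof.
elim: k g => [|k IH] g /=; first by rewrite forall_unit mulr1 eq_sym.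
rewrite sum_ffun_unit; under eq_bigr do rewrite IH ffunE -mulrA.
by rewrite sum_eq_r mulrCA -exprSr.
Qed.

Lemma sum_bool (K : pzRingType) (I : finType) (a : I) (F : I -> K) :
  (forall i, i != a -> F i = 0) -> \sum_i F i = F a.
Proof. by move=> h; rewrite (bigD1 a) //= big1 ?addr0. Qed.

Ltac kill h := rewrite ?forall_unit !ffunE h ?andbF /= ?mulr0 ?mul0r ?mulr0 ?mul0r //.

(** In the colour basis each generator is a multiple of a Kronecker delta. Every intermediate colour
    is therefore forced by an outer one, and [sum_bool] selects it; the Frobenius and dot relations
    below are all proved this way. *)
Lemma colour_mergeA :
  evc (Comp Merge (Union Merge (Id unit))) =2
  evc (Comp Merge (Comp (Union (Id unit) Merge)
                        (Relabel (bassoc unit unit unit)))).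
Proof.
move=> f g /=.
under [RHS]eq_bigr => h _ do rewrite (sum_ffun_pull (bassoc unit unit unit)).
rewrite !sum_fjoin !sum_ffun_unit.
under eq_bigr do rewrite sum_ffun_unit.
under [RHS]eq_bigr do rewrite sum_ffun_unit.
rewrite (sum_bool (a := g tt)); last first.
  move=> i /negbTE ig; rewrite big1 // => j _.
  by kill ig.
rewrite (sum_bool (a := g tt)); last first.
  by move=> i /negbTE ig; kill ig.
rewrite (sum_bool (a := g tt)); last first.
  move=> i /negbTE ig; rewrite big1 // => j _.
  by kill ig.
rewrite (sum_bool (a := g tt)); last first.
  by move=> i /negbTE ig; kill ig.
rewrite !forall_unit !ffunE /= !eqxx !mulr1 -!natrM !mulnb.
rewrite ![g tt == _]eq_sym; congr (_%:R).
by rewrite andbA.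
Qed.
Lemma colour_mergeC :
  evc (Comp Merge (Relabel (bswap unit unit))) =2 evc Merge.
Proof. by move=> f g /=; rewrite (sum_ffun_pull (bswap unit unit)) !ffunE andbC. Qed.

Lemma colour_merge1 :
  evc (Comp Merge (Union Cap (Id unit))) =2 evc (Relabel (bunit unit)).
Proof.
move=> f g /=; rewrite sum_fjoin !sum_ffun_unit.
under eq_bigr do rewrite sum_ffun_unit.
rewrite (sum_bool (a := g tt)); last first.
  by move=> i /negbTE ig; rewrite big1 // => j _; kill ig.
rewrite (sum_bool (a := g tt)); last first.
  by move=> i /negbTE ig; kill ig.
rewrite forall_unit !ffunE !eqxx mul1r mulr1; congr (nat_of_bool _)%:R.
by apply/eqP/forallP => [h [[]|[]]|/(_ (inr tt)) /eqP] //; apply/eqP.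
Qed.

Lemma colour_splitA :
  evc (Comp (Relabel (bassoc unit unit unit))
            (Comp (Union Split (Id unit)) Split)) =2
  evc (Comp (Union (Id unit) Split) Split).
Proof.
move=> f g /=; rewrite (sum_ffun_push (bassoc unit unit unit)) /= !sum_fjoin !sum_ffun_unit.
under eq_bigr do rewrite sum_ffun_unit.
under [RHS]eq_bigr do rewrite sum_ffun_unit.
rewrite (sum_bool (a := f tt)); last first.
  move=> i; rewrite eq_sym => /negbTE ig; rewrite big1 // => j _.
  by kill ig.
rewrite (sum_bool (a := f tt)); last first.
  by move=> i; rewrite eq_sym => /negbTE ig; kill ig.
rewrite (sum_bool (a := f tt)); last first.
  move=> i; rewrite eq_sym => /negbTE ig; rewrite big1 // => j _.
  by kill ig.
rewrite (sum_bool (a := f tt)); last first.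
  by move=> i; rewrite eq_sym => /negbTE ig; kill ig.
rewrite !forall_unit !ffunE /= !eqxx !mul1r; congr (_ * _).
rewrite [LHS]mulrAC [RHS]mulrA -!natrM !mulnb; congr (_%:R * _).
by rewrite ![_ == f tt]eq_sym andbA.
Qed.

Lemma colour_splitC :
  evc (Comp (Relabel (bswap unit unit)) Split) =2 evc Split.
Proof. by move=> f g /=; rewrite (sum_ffun_push (bswap unit unit)) /= !ffunE andbC. Qed.

Lemma colour_cup_split (c : 'I_n) :
  (n%:R * lam c ^+ n.-1) * (n%:R * lam c ^+ n.-1)^-1 = 1.
Proof.
by rewrite divff // mulf_neq0 ?expf_neq0 ?(lam_neq0 n_gt0 s_neq0 z_prim) //;
  rewrite (n_neq0 _ n_gt0).
Qed.

Lemma colour_split1 :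
  evc (Comp (Union Cup (Id unit)) Split) =2 evc (Relabel (binv (bunit unit))).
Proof.
move=> f g /=; rewrite !sum_fjoin !sum_ffun_unit.
under eq_bigr do rewrite sum_ffun_unit.
rewrite (sum_bool (a := f tt)); last first.
  move=> i; rewrite eq_sym => /negbTE ig; rewrite big1 // => j _.
  by kill ig.
rewrite (sum_bool (a := f tt)); last first.
  by move=> i; rewrite eq_sym => /negbTE ig; kill ig.
rewrite !forall_unit !ffunE /= !eqxx mul1r mulrA colour_cup_split mul1r.
by [].
Qed.

Lemma colour_frobenius :
  evc (Comp (Union (Id unit) Merge)
            (Comp (Relabel (bassoc unit unit unit)) (Union Split (Id unit)))) =2
  evc (Comp Split Merge).
Proof.
move=> f g /=; under eq_bigr => h _ do rewrite (sum_ffun_push (bassoc unit unit unit)).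
rewrite !sum_fjoin !sum_ffun_unit.
under eq_bigr do rewrite sum_fjoin sum_ffun_unit.
under eq_bigr do under eq_bigr do rewrite sum_ffun_unit.
rewrite (sum_bool (a := g (inl tt))); last first.
  move=> i; rewrite eq_sym => /negbTE ig; rewrite big1 // => j _.
  by rewrite big1 // => k _; kill ig.
rewrite (sum_bool (a := g (inr tt))); last first.
  move=> i /negbTE ig; rewrite big1 // => j _.
  by kill ig.
rewrite (sum_bool (a := g (inr tt))); last first.
  by move=> i /negbTE ig; kill ig.
rewrite (sum_bool (a := f (inl tt))); last first.
  by move=> i; rewrite eq_sym => /negbTE ig; kill ig.
rewrite !forall_unit !ffunE /= !eqxx !mulr1 /= mulrC !ffunE.
have [->|/negbTE ne] := eqVneq (f (inl tt)) (g (inr tt)).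
  by rewrite [g _ == f _]eq_sym.
by rewrite andbF !mul0r !mulr0.
Qed.

Lemma colour_dot_merge :
  evc (Comp Merge (Union Dot (Id unit))) =2 evc (Comp Dot Merge).
Proof.
move=> f g /=; rewrite !sum_fjoin !sum_ffun_unit.
under eq_bigr do rewrite sum_ffun_unit.
rewrite (sum_bool (a := g tt)); last first.
  move=> i /negbTE ig; rewrite big1 // => j _.
  by kill ig.
rewrite (sum_bool (a := g tt)); last first.
  by move=> i /negbTE ig; kill ig.
rewrite (sum_bool (a := g tt)); last first.
  by move=> i /negbTE ig; kill ig.
rewrite !forall_unit !ffunE /= !eqxx mul1r mulr1 -mulnb natrM.
rewrite [g tt == _]eq_sym mulrAC; case: eqP => [->|_]; last by rewrite !mul0r.
by [].
Qed.

Lemma colour_dot_split :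
  evc (Comp (Union Dot (Id unit)) Split) =2 evc (Comp Split Dot).
Proof.
move=> f g /=; rewrite !sum_fjoin !sum_ffun_unit.
under eq_bigr do rewrite sum_ffun_unit.
rewrite (sum_bool (a := f tt)); last first.
  move=> i; rewrite eq_sym => /negbTE ig; rewrite big1 // => j _.
  by kill ig.
rewrite (sum_bool (a := f tt)); last first.
  by move=> i; rewrite eq_sym => /negbTE ig; kill ig.
rewrite (sum_bool (a := f tt)); last first.
  by move=> i; rewrite eq_sym => /negbTE ig; kill ig.
rewrite !forall_unit !ffunE /= !eqxx !mul1r -mulnb natrM [g _ == f _]eq_sym.
by ring.
Qed.

(** Neck cutting is [sum_lam2]: off the diagonal the sum vanishes, and on it the value n lam^(n-1)
    is cancelled by the counit. *)
Lemma colour_NC :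
  evc (Id unit) =2
  evc (\big[Add/Zero]_(i < n)
          Comp (Comp (dots C (n.-1 - i)) Cap) (Comp Cup (dots C i))).
Proof.
move=> f g; rewrite ev_bigAdd /= forall_unit.
have hv : {ffun void -> 'I_n} by apply: finfun; case.
under eq_bigr => i _.
  rewrite (sum_ffun_void _ hv) !sum_ffun_unit.
  under eq_bigr do rewrite evc_dots ffunE -mulrA.
  rewrite sum_eq_r; under [X in _ * X]eq_bigr do rewrite evc_dots ffunE mul1r.
  rewrite sum_eq_l; over.
under eq_bigr => i _ do rewrite /= mulrAC [lam _ ^+ i * _]mulrC.
rewrite -mulr_suml (sum_lam2 n_gt0 s_neq0 z_prim); case: eqP => [->|_].
  by rewrite mul1r colour_cup_split.
by rewrite !mul0r.
Qed.

(** For each colour the coefficient of the splitting cancels the counit, so each of the n colours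
    contributes 1. *)
Lemma colour_T :
  evc (Comp Cup (Comp Merge (Comp Split Cap))) =2 evc (Scale n%:R (Id void)).
Proof.
move=> f g /=; rewrite sum_ffun_unit.
rewrite (_ : [forall a, _] = true) ?mulr1; last by apply/forallP; case.
under eq_bigr => c _.
  rewrite sum_fjoin sum_ffun_unit (sum_bool (a := c)); last first.
    move=> i /negbTE ig; rewrite sum_ffun_unit big1 // => j _.
    by kill ig.
  rewrite sum_ffun_unit (sum_bool (a := c)); last first.
    by move=> i /negbTE ig; kill ig.
  rewrite sum_ffun_unit (sum_bool (a := c)); last first.
    by move=> i /negbTE ig; kill ig.
  rewrite !ffunE !eqxx mulr1 !mul1r colour_cup_split; over.
by rewrite sumr_const card_ord.
Qed.
End Soundness.

Section MonoDots.
Variables (C : numClosedFieldType) (n : nat) (n_gt0 : (0 < n)%N).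
Variables (K : comPzRingType) (phi : {rmorphism C -> K}) (t : K).

Lemma red_red k l m :
  \sum_(i < n) red n t k i * red n t (i + l) m = red n t (k + l) m.
Proof.
rewrite (sum_bool (a := Ordinal (ltn_pmod k n_gt0))); last first.
  move=> i /eqP hi; rewrite /red; case: eqP => [e|_]; last by rewrite !mul0r.
  by case: hi; apply: val_inj.
rewrite /red eqxx mul1r mulrCA -exprD /= modnDml; congr (_ * t ^+ _).
by rewrite {3}(divn_eq k n) -addnA divnMDl.
Qed.

Lemma ev_mono_dots k f g :
  ev phi (gens_mono n t) (dots C k) f g = red n t (f tt + k) (g tt).
Proof.
elim: k g => [|k IH] g /=.
  rewrite forall_unit /red addn0 divn_small ?ltn_ord // modn_small ?ltn_ord //.
  by rewrite mulr1 eq_sym.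
rewrite sum_ffun_unit; under eq_bigr => i _ do rewrite IH ffunE -[i.+1]addn1.
by rewrite red_red -addnA addn1.
Qed.
End MonoDots.

(** The linear and monoidal laws hold for matrices over any structure constants. The Frobenius and
    dot relations, NC and T are verified in the colours and extended to all t; S and U are read off
    in the monomial basis. *)
Theorem Fmor_sound (C : numClosedFieldType) (n : nat) (u : option C) (t : C)
    (A B : finType) (M N : mor C A B) :
  (1 < n)%N -> (forall t', u = Some t' -> t' = t) -> eqcob u n M N ->
  Fmor (n := n) t M =2 Fmor t N.
Proof.
move=> n_gt1 ut h; have n_gt0 := ltnW n_gt1.
suff H : ev idfun (gens_mono n t) M =2 ev idfun (gens_mono n t) N.
  by move=> f g; rewrite !Fmor_ev.
have [z z_prim] := prim_root_exists C n_gt0.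
have col A0 B0 (M0 N0 : mor C A0 B0) h0 := @mono_of_colours C n n_gt0 z z_prim A0 B0 M0 N0 h0 t.
elim: h => {A B M N}.
- by [].
- by move=> A B f g _ IH x y; rewrite IH.
- by move=> A B f g h _ IH _ IH' x y; rewrite IH IH'.
- move=> A B D g g' f f' _ IH _ IH' x y /=.
  by apply: eq_bigr => h _; rewrite IH IH'.
- by move=> A B A' B' f g f' g' _ IH _ IH' x y /=; rewrite IH IH'.
- by move=> A B f f' g g' _ IH _ IH' x y /=; rewrite IH IH'.
- by move=> A B c f g _ IH x y /=; rewrite IH.
- by move=> A B f g h x y /=; rewrite addrA.
- by move=> A B f g x y /=; rewrite addrC.
- by move=> A B f x y /=; rewrite add0r.
- by move=> A B f x y /=; rewrite mul0r.
- by move=> A B f x y /=; rewrite mul1r.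
- by move=> A B a b f x y /=; rewrite mulrA.
- by move=> A B a b f x y /=; rewrite mulrDl.
- by move=> A B a f g x y /=; rewrite mulrDr.
- move=> A B D g g' f x y /=; rewrite -big_split /=.
  by apply: eq_bigr => h _; rewrite mulrDr.
- move=> A B D g f f' x y /=; rewrite -big_split /=.
  by apply: eq_bigr => h _; rewrite mulrDl.
- move=> A B D a g f x y /=; rewrite mulr_sumr.
  by apply: eq_bigr => h _; rewrite mulrCA.
- move=> A B D a g f x y /=; rewrite mulr_sumr.
  by apply: eq_bigr => h _; rewrite mulrA.
- by move=> A B A' B' f g h x y /=; rewrite mulrDl.
- by move=> A B A' B' f g h x y /=; rewrite mulrDr.
- by move=> A B A' B' a f h x y /=; rewrite mulrA.
- by move=> A B A' B' a f h x y /=; rewrite mulrCA.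
- move=> A B D E h g f x y /=.
  under eq_bigr do rewrite mulr_suml.
  rewrite exchange_big /=; apply: eq_bigr => k _.
  by rewrite mulr_sumr; apply: eq_bigr => l _; rewrite mulrA.
- move=> A B f x y /=; rewrite (sum_ffun_push (bid B)); congr ev.
  by apply/ffunP=> b; rewrite ffunE.
- move=> A B f x y /=; rewrite (sum_ffun_pull (bid A)).
  rewrite (_ : [ffun b => x b] = x) //.
  by apply/ffunP=> b; rewrite ffunE.
- move=> A B f g fg x y /=; congr (nat_of_bool _)%:R.
  by apply: eq_forallb => a; rewrite fg.
- move=> A B D g f x y /=; rewrite (sum_ffun_pull f); congr (nat_of_bool _)%:R.
  apply/forallP/forallP => h a.
    by have := h (fto f a); rewrite ffunE ftoK.
  by have := h (ffrom f a); rewrite /= ffromK ffunE.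
- move=> A B A' B' f g x y /=; rewrite -natrM mulnb; congr (nat_of_bool _)%:R.
  apply/andP/forallP => [[/forallP h /forallP h'] [a|a]|h].
  + by have := h a; rewrite !ffunE.
  + by have := h' a; rewrite !ffunE.
  + split; apply/forallP=> a; rewrite !ffunE; [exact: h (inl a)|exact: h (inr a)].
- move=> A B D A' B' D' g f g' f' x y /=; rewrite sum_fjoin mulr_suml.
  apply: eq_bigr => h _; rewrite mulr_sumr; apply: eq_bigr => k _.
  by rewrite !fjoinl !fjoinr mulrACA.
- move=> A B A' B' A'' B'' f g h x y /=.
  rewrite (sum_ffun_push (bassoc B B' B'')) (sum_ffun_pull (bassoc A A' A'')) /=.
  by rewrite -mulrA; congr (_ * (_ * _)); f_equal; apply/ffunP=> a; rewrite !ffunE.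
- move=> A B f x y /=.
  rewrite (sum_ffun_push (bunit B)) (sum_ffun_pull (bunit A)) /=.
  rewrite (_ : [forall a, _] = true) ?mul1r; last by apply/forallP; case.
  by f_equal; apply/ffunP=> a; rewrite !ffunE.
- move=> A B A' B' f g x y /=.
  rewrite (sum_ffun_push (bswap B B')) (sum_ffun_pull (bswap A A')) /= mulrC.
  by congr (_ * _); f_equal; apply/ffunP=> a; rewrite !ffunE.
- by apply: col => s s0; apply: colour_mergeA.
- by apply: col => s s0; apply: colour_mergeC.
- by apply: col => s s0; apply: colour_merge1.
- by apply: col => s s0; apply: colour_splitA.
- by apply: col => s s0; apply: colour_splitC.
- by apply: col => s s0; apply: colour_split1.
- by apply: col => s s0; apply: colour_frobenius.
- by apply: col => s s0; apply: colour_dot_merge.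
- by apply: col => s s0; apply: colour_dot_split.
- by apply: col => s s0; apply: colour_NC.
- move=> x y /=; rewrite sum_ffun_unit big1 // => i _; rewrite ffunE.
  case: eqP => [->|]; last by rewrite mul0r.
  by case: eqP; rewrite ?mulr0 //; lia.
- by apply: col => s s0; apply: colour_T.
- move=> t' /ut -> x y /=.
  rewrite (_ : [forall a, _] = true) ?mulr1; last by apply/forallP; case.
  have hn : (n.-1 < n)%N by lia.
  rewrite sum_ffun_unit (sum_bool (a := Ordinal hn)); last first.
    move=> i /eqP hi; rewrite ffunE [X in _ * X](_ : _ = 0) ?mulr0 //.
    by case: eqP => // e; case: hi; apply: val_inj.
  have h0 : (0 < n)%N by [].
  rewrite sum_ffun_unit (sum_bool (a := Ordinal h0)); last first.
    move=> i /eqP hi; rewrite ffunE [X in X * _](_ : _ = 0) ?mul0r //.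
    by case: eqP => // e; case: hi; apply: val_inj.
  rewrite !ffunE !eqxx mulr1 mul1r ev_mono_dots // !ffunE /= add0n /red.
  (* x^(2n-1) = t x^(n-1), and the counit reads off the coefficient of x^(n-1). *)
  have -> : (n.*2.-1 = 1 * n + n.-1)%N by lia.
  by rewrite modnMDl divnMDl // modn_small // divn_small // eqxx mul1r.
Qed.

(** * The category as a quotient *)

Section Cob.
Variables (C : numClosedFieldType) (u : option C) (n : nat).

(* [mor] quantifies over all finite types, which puts it in a universe too large
   for a [zmodType] structure: sums of classes are iterations of the commutative
   monoid law [hadd]. *)
Definition Cob (A B : finType) : Type :=
  {S : mor C A B -> Prop | exists f, S = eqcob u n f}.

Definition cls (A B : finType) (f : mor C A B) : Cob A B :=
  exist _ (eqcob u n f) (ex_intro _ f erefl).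

Lemma clsP (A B : finType) (f g : mor C A B) : cls f = cls g <-> eqcob u n f g.
Proof.
split=> [[/(congr1 (fun S => S g)) ->]|fg]; first exact: eqc_refl.
apply: eq_exist; apply/funext => h; apply/propext; split=> [fh|].
  exact: eqc_trans (eqc_sym fg) fh.
exact: eqc_trans.
Qed.

Lemma clsE (A B : finType) (x : Cob A B) : exists f, x = cls f.
Proof.
by case: x => S [f e]; exists f; apply: eq_exist.
Qed.

Definition rep (A B : finType) (x : Cob A B) : mor C A B :=
  projT1 (cid (clsE x)).

Lemma repK (A B : finType) (x : Cob A B) : cls (rep x) = x.
Proof. by rewrite /rep; case: cid => f /= ->. Qed.

Lemma rep_cls (A B : finType) (f : mor C A B) : eqcob u n (rep (cls f)) f.
Proof. by apply/clsP; rewrite repK. Qed.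

Section Linear.
Variables A B : finType.
Implicit Types x y : Cob A B.

Definition hadd x y : Cob A B := cls (Add (rep x) (rep y)).
Definition hscale (a : C) x : Cob A B := cls (Scale a (rep x)).

Lemma hadd_cls f g : hadd (cls f) (cls g) = cls (Add f g).
Proof. by apply/clsP; apply: eqc_Add; apply: rep_cls. Qed.
Lemma hscale_cls a f : hscale a (cls f) = cls (Scale a f).
Proof. by apply/clsP; apply: eqc_Scale; apply: rep_cls. Qed.

Lemma haddA : associative hadd.
Proof.
move=> x y w; rewrite -(repK x) -(repK y) -(repK w) !hadd_cls.
by apply/clsP; apply: eqc_addA.
Qed.
Lemma haddC : commutative hadd.
Proof.
move=> x y; rewrite -(repK x) -(repK y) !hadd_cls.
by apply/clsP; apply: eqc_addC.
Qed.
Lemma hadd0 : left_id (cls Zero) hadd.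
Proof. by move=> x; rewrite -(repK x) hadd_cls; apply/clsP/eqc_add0. Qed.
HB.instance Definition _ :=
  Monoid.isComLaw.Build (Cob A B) (cls Zero) hadd haddA haddC hadd0.

Lemma hscaleA a b x : hscale a (hscale b x) = hscale (a * b) x.
Proof. by rewrite -(repK x) !hscale_cls; apply/clsP/eqc_scaleA. Qed.
Lemma hscale1 : left_id 1 hscale.
Proof. by move=> x; rewrite -(repK x) !hscale_cls; apply/clsP/eqc_scale1. Qed.
Lemma hscale0 x : hscale 0 x = cls Zero.
Proof. by rewrite -(repK x) !hscale_cls; apply/clsP/eqc_scale0. Qed.
Lemma hscaleDl a b x : hscale (a + b) x = hadd (hscale a x) (hscale b x).
Proof.
by rewrite -(repK x) !hscale_cls hadd_cls; apply/clsP/eqc_scaleDl.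
Qed.

Lemma cls_bigadd (I : Type) (r : seq I) (P : pred I) F :
  cls (\big[Add/Zero]_(i <- r | P i) F i)
  = \big[hadd/cls Zero]_(i <- r | P i) cls (F i).
Proof. by apply: (big_morph _ (id1 := cls Zero) (op1 := hadd)) => // f g; rewrite hadd_cls. Qed.
End Linear.

Fact hom_key : unit. Proof. exact: tt. Qed.
Definition hcomp (A B D : finType) (y : Cob B D) (x : Cob A B) : Cob A D :=
  locked_with hom_key (cls (Comp (rep y) (rep x))).
Definition hunion (A B A' B' : finType) (x : Cob A B) (y : Cob A' B') :
  Cob (A + A')%type (B + B')%type :=
  locked_with hom_key (cls (Union (rep x) (rep y))).
Definition hrel (A B : finType) (s : fbij A B) : Cob A B := cls (Relabel s).

Local Notation "x +++ y" := (hadd x y) (at level 50, left associativity).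
Local Notation "a *:: x" := (hscale a x) (at level 40).
Local Notation h0 := (cls Zero).
Local Notation "y ** x" := (hcomp y x) (at level 40, left associativity).
Local Notation "x +|+ y" := (hunion x y) (at level 50, left associativity).

Lemma cls_comp (A B D : finType) (g : mor C B D) (f : mor C A B) :
  cls (Comp g f) = cls g ** cls f.
Proof.
by rewrite /hcomp unlock; apply/clsP; apply: eqc_Comp; apply/eqc_sym/rep_cls.
Qed.
Lemma cls_union (A B A' B' : finType) (f : mor C A B) (g : mor C A' B') :
  cls (Union f g) = cls f +|+ cls g.
Proof.
by rewrite /hunion unlock; apply/clsP; apply: eqc_Union; apply/eqc_sym/rep_cls.
Qed.

Lemma hcompA (A B D E : finType) (h : Cob D E) (g : Cob B D) (f : Cob A B) :
  h ** (g ** f) = h ** g ** f.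
Proof.
rewrite -(repK h) -(repK g) -(repK f) -!cls_comp.
by apply/clsP/eqc_compA.
Qed.
Lemma hcompDl (A B D : finType) (f : Cob A B) : {morph (fun g : Cob B D => g ** f) : g g' / g +++ g'}.
Proof.
move=> g g'; rewrite /= -(repK f) -(repK g) -(repK g') ?hadd_cls -!cls_comp ?hadd_cls.
by apply/clsP/eqc_CompDl.
Qed.
Lemma hcompDr (A B D : finType) (g : Cob B D) : {morph (fun f : Cob A B => g ** f) : f f' / f +++ f'}.
Proof.
move=> f f'; rewrite /= -(repK f) -(repK f') -(repK g) ?hadd_cls -!cls_comp ?hadd_cls.
by apply/clsP/eqc_CompDr.
Qed.
Lemma hcompZl (A B D : finType) a (g : Cob B D) (f : Cob A B) :
  (a *:: g) ** f = a *:: (g ** f).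
Proof.
rewrite -(repK g) -(repK f) ?hscale_cls -!cls_comp ?hscale_cls.
by apply/clsP/eqc_CompZl.
Qed.
Lemma hcompZr (A B D : finType) a (g : Cob B D) (f : Cob A B) :
  g ** (a *:: f) = a *:: (g ** f).
Proof.
rewrite -(repK g) -(repK f) ?hscale_cls -!cls_comp ?hscale_cls.
by apply/clsP/eqc_CompZr.
Qed.
Lemma hcomp0l (A B D : finType) (f : Cob A B) : h0 ** f = h0 :> Cob A D.
Proof. by rewrite -(hscale0 h0) hcompZl !hscale0. Qed.
Lemma hcomp0r (A B D : finType) (g : Cob B D) : g ** h0 = h0 :> Cob A D.
Proof. by rewrite -(hscale0 h0) hcompZr !hscale0. Qed.
Lemma hcomp_suml (A B D : finType) (I : Type) (r : seq I) (P : pred I)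
    (F : I -> Cob B D) (f : Cob A B) :
  (\big[@hadd _ _/h0]_(i <- r | P i) F i) ** f = \big[@hadd _ _/h0]_(i <- r | P i) (F i ** f).
Proof. exact: (big_morph (fun g => g ** f) (hcompDl f) (hcomp0l _ f)). Qed.
Lemma hcomp_sumr (A B D : finType) (I : Type) (r : seq I) (P : pred I)
    (F : I -> Cob A B) (g : Cob B D) :
  g ** (\big[@hadd _ _/h0]_(i <- r | P i) F i) = \big[@hadd _ _/h0]_(i <- r | P i) (g ** F i).
Proof. exact: (big_morph (fun f => g ** f) (hcompDr g) (hcomp0r _ g)). Qed.

Lemma hunionDl (A B A' B' : finType) (h : Cob A' B') :
  {morph (fun f : Cob A B => f +|+ h) : f g / f +++ g}.
Proof.
move=> f g; rewrite /= -(repK f) -(repK g) -(repK h) ?hadd_cls -!cls_union ?hadd_cls.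
by apply/clsP/eqc_UnionDl.
Qed.
Lemma hunionDr (A B A' B' : finType) (h : Cob A B) :
  {morph (fun f : Cob A' B' => h +|+ f) : f g / f +++ g}.
Proof.
move=> f g; rewrite /= -(repK f) -(repK g) -(repK h) ?hadd_cls -!cls_union ?hadd_cls.
by apply/clsP/eqc_UnionDr.
Qed.
Lemma hunionZl (A B A' B' : finType) a (f : Cob A B) (h : Cob A' B') :
  (a *:: f) +|+ h = a *:: (f +|+ h).
Proof.
rewrite -(repK f) -(repK h) ?hscale_cls -!cls_union ?hscale_cls.
by apply/clsP/eqc_UnionZl.
Qed.
Lemma hunionZr (A B A' B' : finType) a (f : Cob A B) (h : Cob A' B') :
  f +|+ (a *:: h) = a *:: (f +|+ h).
Proof.
rewrite -(repK f) -(repK h) ?hscale_cls -!cls_union ?hscale_cls.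
by apply/clsP/eqc_UnionZr.
Qed.
Lemma hunion0l (A B A' B' : finType) (h : Cob A' B') :
  (h0 : Cob A B) +|+ h = h0.
Proof. by rewrite -(hscale0 h0) hunionZl !hscale0. Qed.
Lemma hunion0r (A B A' B' : finType) (h : Cob A B) :
  h +|+ (h0 : Cob A' B') = h0.
Proof. by rewrite -(hscale0 h0) hunionZr !hscale0. Qed.
Lemma hunion_suml (A B A' B' : finType) (I : Type) (r : seq I) (P : pred I)
    (F : I -> Cob A B) (h : Cob A' B') :
  (\big[@hadd _ _/h0]_(i <- r | P i) F i) +|+ h = \big[@hadd _ _/h0]_(i <- r | P i) (F i +|+ h).
Proof. exact: (big_morph (fun g => g +|+ h) (hunionDl h) (hunion0l _ _ h)). Qed.
Lemma hunion_sumr (A B A' B' : finType) (I : Type) (r : seq I) (P : pred I)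
    (F : I -> Cob A' B') (h : Cob A B) :
  h +|+ (\big[@hadd _ _/h0]_(i <- r | P i) F i) = \big[@hadd _ _/h0]_(i <- r | P i) (h +|+ F i).
Proof. exact: (big_morph (fun g => h +|+ g) (hunionDr h) (hunion0r _ _ h)). Qed.

Lemma hcomp_idl (A B : finType) (f : Cob A B) : hrel (bid B) ** f = f.
Proof. by rewrite -(repK f) -cls_comp; apply/clsP/eqc_idl. Qed.
Lemma hcomp_idr (A B : finType) (f : Cob A B) : f ** hrel (bid A) = f.
Proof. by rewrite -(repK f) -cls_comp; apply/clsP/eqc_idr. Qed.
Lemma eq_hrel (A B : finType) (s s' : fbij A B) :
  fto s =1 fto s' -> hrel s = hrel s'.
Proof. by move=> h; apply/clsP; apply: eqc_relabel. Qed.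
Lemma hrel_comp (A B D : finType) (s : fbij B D) (s' : fbij A B) :
  hrel s ** hrel s' = hrel (bcomp s s').
Proof. by rewrite -cls_comp; apply/clsP/eqc_relabel_comp. Qed.
Lemma hrel_union (A B A' B' : finType) (s : fbij A B) (s' : fbij A' B') :
  hrel s +|+ hrel s' = hrel (bsum s s').
Proof. by rewrite -cls_union; apply/clsP/eqc_relabel_union. Qed.
Lemma hrelK (A B : finType) (s : fbij A B) : hrel (binv s) ** hrel s = hrel (bid A).
Proof. by rewrite hrel_comp; apply: eq_hrel => a /=; rewrite ftoK. Qed.
Lemma hrelVK (A B : finType) (s : fbij A B) : hrel s ** hrel (binv s) = hrel (bid B).
Proof. by rewrite hrel_comp; apply: eq_hrel => a /=; rewrite ffromK. Qed.
Lemma hcomp_hunion (A B D A' B' D' : finType) (g : Cob B D) (f : Cob A B)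
    (g' : Cob B' D') (f' : Cob A' B') :
  (g +|+ g') ** (f +|+ f') = (g ** f) +|+ (g' ** f').
Proof.
rewrite -(repK f) -(repK f') -(repK g) -(repK g') -!(cls_union, cls_comp).
by apply/clsP/eqc_interchange.
Qed.
Lemma hassoc (A B A' B' A'' B'' : finType) (f : Cob A B) (g : Cob A' B')
    (h : Cob A'' B'') :
  hrel (bassoc B B' B'') ** ((f +|+ g) +|+ h)
  = (f +|+ (g +|+ h)) ** hrel (bassoc A A' A'').
Proof.
rewrite -(repK f) -(repK h) -(repK g) -!(cls_union, cls_comp).
by apply/clsP/eqc_assoc.
Qed.
Lemma hunit (A B : finType) (f : Cob A B) :
  hrel (bunit B) ** (hrel (bid void) +|+ f) = f ** hrel (bunit A).
Proof.
rewrite -(repK f) -!(cls_union, cls_comp).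
by apply/clsP/eqc_unit.
Qed.
Lemma hswap (A B A' B' : finType) (f : Cob A B) (g : Cob A' B') :
  hrel (bswap B B') ** (f +|+ g) = (g +|+ f) ** hrel (bswap A A').
Proof.
rewrite -(repK f) -(repK g) -!(cls_union, cls_comp).
by apply/clsP/eqc_swap.
Qed.
End Cob.

Notation "x +++ y" := (hadd x y) (at level 50, left associativity).
Notation "a *:: x" := (hscale a x) (at level 40).
Notation h0 := (cls _ _ Zero).
Notation "y ** x" := (hcomp y x) (at level 40, left associativity).
Notation "x +|+ y" := (hunion x y) (at level 50, left associativity).

(** * Spheres with dots *)

Section DottedSpheres.
(* [v k] is the value of a sphere with k dots.  Over a root S of S^n = U the
   projector of colour j is sum_i v_(n-1-i) z^(ji) S^i; [mu j] is this element
   acting on sequences with y_(n+k) = U y_k, S being the shift. *)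
Variables (K : comPzRingType) (n : nat) (v : nat -> K) (z : K).
Hypothesis n_gt0 : (0 < n)%N.
Hypothesis v_neck : forall a b,
  v (a + b) = \sum_(i < n) v (a + i) * v (b + (n.-1 - i)).
Hypothesis v_torus : v n.-1 = 1.
Hypothesis sum_z : forall i, (0 < i < n)%N -> \sum_(j < n) z ^+ (j * i) = 0.
Hypothesis zn : z ^+ n = 1.
Hypothesis natK : forall m (x : K), m.+1%:R * x = 0 -> x = 0.

Let U := v (n + n.-1).

Lemma sum_shift (g : nat -> K) :
  g n = g 0%N -> \sum_(i < n) g i.+1 = \sum_(i < n) g i.
Proof.
move=> h; apply: (addrI (g 0%N)).
by rewrite -(big_ord_recl n (fun i => g i)) big_ord_recr /= addrC h.
Qed.

(** A sphere with a + b + 1 dots can be cut with the additional dot on either side of the neck. The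
    two sums differ only in their end terms, whence v_(a+n) v_b = v_a v_(b+n); take b = n - 1, where
    v is 1. *)
Lemma v_shift k : v (n + k) = U * v k.
Proof.
have h a b : v (a + n) * v b = v a * v (b + n).
  pose g i := v (a + i) * v (b + (n - i)).
  suff : g n = g 0%N by rewrite /g subnn subn0 !addn0.
  apply: (addrI (\sum_(i < n) g i)).
  have -> : \sum_(i < n) g i + g n = g 0%N + \sum_(i < n) g i.+1.
    by rewrite -(big_ord_recr n (fun i => g i)) big_ord_recl.
  rewrite addrC; congr (_ + _).
  transitivity (v (a.+1 + b)).
    rewrite v_neck; apply: eq_bigr => i _; rewrite /g addSnnS.
    by congr (_ * v (b + _)); lia.
  rewrite addSnnS v_neck; apply: eq_bigr => i _; rewrite /g.
  by congr (_ * v _); have := ltn_ord i; lia.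
by have := h k n.-1; rewrite v_torus mulr1 addnC => ->; rewrite mulrC /U addnC.
Qed.

Definition shifty (y : nat -> K) := forall k, y (n + k)%N = U * y k.

(** A shift moves from one factor of the convolution to the other: the term that wraps around picks
    up the same factor U from [g] as from [v]. *)
Lemma v_conv (g : nat -> K) i : shifty g ->
  \sum_(r < n) v (n.-1 - r) * g (i + r)%N = \sum_(r < n) v (i + (n.-1 - r)) * g r.
Proof.
elim: i g => [|i IH] g hg //.
under eq_bigr do rewrite addSn.
under eq_bigr => r _ do rewrite -[g _]/((fun m => g m.+1) (i + r)%N).
rewrite (IH (fun m => g m.+1)); last by move=> k; rewrite -addnS hg.
pose h r := v (i + (n - r)) * g r.
transitivity (\sum_(r < n) h r.+1).
  by apply: eq_bigr => r _; congr (v (i + _) * _); lia.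
rewrite sum_shift; last first.
  rewrite /h subnn subn0 addn0 -[n in g n]addn0 hg addnC v_shift; ring.
by apply: eq_bigr => r _; congr (v _ * _); have := ltn_ord r; lia.
Qed.

Definition mu j (y : nat -> K) k := \sum_(i < n) z ^+ (j * i) * (v (n.-1 - i) * y (k + i)%N).
Definition phi j (y : nat -> K) k := y k - mu j y k.

Lemma mu_mu j j' y k :
  mu j (mu j' y) k = \sum_(i < n) \sum_(i' < n)
   z ^+ (j * i) * z ^+ (j' * i') * (v (n.-1 - i) * v (n.-1 - i') * y (k + i + i')%N).
Proof.
apply: eq_bigr => i _; rewrite /mu !mulr_sumr; apply: eq_bigr => i' _; ring.
Qed.

Lemma muC j j' y : mu j (mu j' y) =1 mu j' (mu j y).
Proof.
move=> k; rewrite !mu_mu exchange_big /=.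
apply: eq_bigr => i _; apply: eq_bigr => i' _; rewrite addnAC; ring.
Qed.

(** After [v_conv] the double convolution contains the sum of v_(n-1-r+i) v_(n-1-i), which neck
    cutting collapses to v_(n-1-r). *)
Lemma mu_idem j y : shifty y -> mu j (mu j y) =1 mu j y.
Proof.
move=> hy k; rewrite mu_mu.
(* The root of unity is absorbed into the sequence; z^n = 1 keeps the recurrence, so [v_conv]
   applies to it. *)
pose g m := z ^+ (j * m) * y (k + m)%N.
have hg : shifty g.
  move=> m; rewrite /g mulnDr exprD mulnC exprM zn expr1n mul1r.
  by rewrite addnCA hy; ring.
transitivity (\sum_(i < n) v (n.-1 - i) * \sum_(r < n) v (i + (n.-1 - r)) * g r).
  apply: eq_bigr => i _; rewrite -v_conv // mulr_sumr; apply: eq_bigr => r _.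
  by rewrite /g mulnDr exprD addnA; ring.
under eq_bigr do rewrite mulr_sumr.
rewrite exchange_big /=; apply: eq_bigr => r _.
have E : v (n.-1 - r) = \sum_(i < n) v (n.-1 - r + i) * v (n.-1 - i).
  by have := v_neck (n.-1 - r) 0; rewrite addn0.
rewrite mulrCA -[z ^+ _ * y _]/(g r) E mulr_suml.
apply: eq_bigr => i _; rewrite addnC; ring.
Qed.

Lemma mu_sub j y y' : mu j (fun k => y k - y' k) =1 fun k => mu j y k - mu j y' k.
Proof. by move=> k; rewrite /mu -sumrB; apply: eq_bigr => i _; ring. Qed.

Lemma phiC j j' y : phi j (phi j' y) =1 phi j' (phi j y).
Proof. by move=> k; rewrite /phi !mu_sub muC; ring. Qed.

Lemma phi_idem j y : shifty y -> phi j (phi j y) =1 phi j y.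
Proof. by move=> hy k; rewrite /phi !mu_sub mu_idem //; ring. Qed.

Lemma shifty_phi j y : shifty y -> shifty (phi j y).
Proof.
move=> hy k; rewrite /phi hy mulrBr /mu; congr (_ - _).
by rewrite mulr_sumr; apply: eq_bigr => i _; rewrite -addnA hy; ring.
Qed.

Lemma phi_lin j m y (s : seq nat) :
  phi j (fun k => m%:R * y k + \sum_(i <- s) phi i y k) =1
  fun k => m%:R * phi j y k + \sum_(i <- s) phi i (phi j y) k.
Proof.
move=> k; have E : mu j (fun k => m%:R * y k + \sum_(i <- s) phi i y k) k
    = m%:R * mu j y k + \sum_(i <- s) mu j (phi i y) k.
  rewrite /mu exchange_big /= mulr_sumr -big_split; apply: eq_bigr => r _ /=.
  by rewrite -!mulr_sumr; ring.
transitivity (m%:R * y k + \sum_(i <- s) phi i y k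
    - (m%:R * mu j y k + \sum_(i <- s) mu j (phi i y) k)); first by rewrite -E.
have -> : \sum_(i <- s) phi i (phi j y) k
    = \sum_(i <- s) phi i y k - \sum_(i <- s) mu j (phi i y) k.
  by rewrite -sumrB; apply: eq_bigr => i _; rewrite phiC.
by rewrite -[phi j y k]/(y k - mu j y k); ring.
Qed.

(* The operators [phi j] are commuting idempotents, so in characteristic 0 a
   vanishing sum of them vanishes term by term. *)
Lemma phi_sum0 (s : seq nat) m y : shifty y ->
  (forall k, m.+1%:R * y k + \sum_(i <- s) phi i y k = 0) -> forall k, y k = 0.
Proof.
elim: s m y => [|j s IH] m y hy h k.
  by have := h k; rewrite big_nil addr0 => /natK.
have y0 : forall k, phi j y k = 0.
  (* Applying [phi j] to the vanishing sum turns its own term into one more copy of [phi j y], which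
     raises the multiplicity and shortens the list. *)
  apply: (IH m.+1); first exact: shifty_phi.
  move=> k'; have := phi_lin j m.+1 y (j :: s) k'.
  rewrite big_cons phi_idem // => E.
  rewrite -natr1 mulrDl mul1r -addrA -E /phi h sub0r.
  by rewrite /mu big1 ?oppr0 // => i _; rewrite h !mulr0.
apply: (IH m) => // k'; have := h k'.
by rewrite big_cons y0 add0r.
Qed.

(** Summing over j leaves only i = 0, with coefficient n v_(n-1) = n, so the operators [mu j] add up
    to n. *)
Lemma phi_sum y k : \sum_(j < n) phi j y k = 0.
Proof.
rewrite sumrB sumr_const card_ord /mu exchange_big /=.
under eq_bigr do rewrite -mulr_suml.
rewrite (bigD1 (Ordinal n_gt0)) //= [X in _ * _ + X]big1 => [|i hi]; last first.
  by rewrite sum_z ?mul0r // ltn_ord lt0n andbT.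
under eq_bigr do rewrite muln0 expr0.
by rewrite sumr_const card_ord subn0 v_torus addn0 addr0 mul1r mulr_natl subrr.
Qed.

(** [phi_sum] is applied to [phi 0 y], which [phi 0] fixes: this gives the leading term of
    multiplicity 1 that [phi_sum0] asks for, with the other indices as the list. *)
Lemma phi_eq0 y : shifty y -> forall k, phi 0 y k = 0.
Proof.
move=> hy; apply: (@phi_sum0 (iota 1 n.-1) 0); first exact: shifty_phi.
move=> k; have := phi_sum (phi 0 y) k.
rewrite -(big_mkord xpredT (fun j => phi j (phi 0 y) k)) big_ltn //.
by rewrite phi_idem // mul1r /index_iota subn1.
Qed.

Lemma sphere_value k : v k = (k %% n == n.-1)%N%:R * U ^+ (k %/ n).
Proof.
(* The expected answer serves as test sequence: for m < n only i = n-1-m survives in [mu 0 d m],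
   which is therefore v_m, while [phi_eq0] says that it is d_m. *)
pose d m : K := (m %% n == n.-1)%N%:R * U ^+ (m %/ n).
have hd : shifty d.
  by move=> m; rewrite /d modnDl divnDl // divnn n_gt0 add1n exprS; ring.
have vd m : (m < n)%N -> v m = d m.
  move=> hm; have := phi_eq0 hd m; rewrite /phi => /eqP; rewrite subr_eq0 => /eqP ->.
  have hi : (n.-1 - m < n)%N by lia.
  rewrite /mu (bigD1 (Ordinal hi)) //= big1 => [|i ne]; last first.
    rewrite mul0n expr0 mul1r /d; case: eqP => [e|_]; last by rewrite mul0r mulr0.
    have := ltn_ord i; move/eqP: ne => ne hin; case: ne; apply: val_inj => /=.
    have [lt|ge] := ltnP (m + i) n; first by move: e; rewrite modn_small //; lia.
    have e2 : (m + i = m + i - n + n)%N by lia.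
    by move: e; rewrite e2 modnDr modn_small; lia.
  rewrite mul0n expr0 mul1r addr0 subKn ?subnKC; [|lia|lia].
  by rewrite /d modn_small ?divn_small ?eqxx ?mul1r ?mulr1 //; lia.
elim/ltn_ind: k => k IH; have [/vd //|hk] := ltnP k n.
rewrite -(subnKC hk) v_shift IH; last by lia.
by rewrite -[RHS]/(d (n + (k - n))%N) hd.
Qed.
End DottedSpheres.

(** * Unions of cobordisms over a finite set *)

(** Standard finite sets made from [void], [unit] and sums, the operations in which unions of
    cobordisms are written. Unions over other sets are transported along a bijection. *)
Fixpoint sk (k : nat) : finType := if k is k'.+1 then (unit + sk k')%type else void.

Lemma card_sk k : #|sk k| = k.
Proof. by elim: k => [|k IH]; rewrite ?card_void // card_sum card_unit IH. Qed.

Definition idx_map (T T' X : Type) (s : T -> T') (p : T * X) := (s p.1, p.2).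
Lemma idx_mapK (T T' X : Type) (s : T -> T') (r : T' -> T) :
  cancel s r -> cancel (@idx_map T T' X s) (idx_map r).
Proof. by move=> h [a x]; rewrite /idx_map /= h. Qed.
Definition idx (T T' X : finType) (s : fbij T T') : fbij (T * X)%type (T' * X)%type :=
  FBij (idx_mapK (ftoK s)) (idx_mapK (ffromK s)).

Definition dist_to (T T' X : Type) (p : (T + T') * X) : T * X + T' * X :=
  match p.1 with inl a => inl (a, p.2) | inr b => inr (b, p.2) end.
Definition dist_from (T T' X : Type) (s : T * X + T' * X) : (T + T') * X :=
  match s with inl p => (inl p.1, p.2) | inr p => (inr p.1, p.2) end.
Lemma dist_toK (T T' X : Type) : cancel (@dist_to T T' X) (@dist_from T T' X).
Proof. by case=> -[]. Qed.
Lemma dist_fromK (T T' X : Type) : cancel (@dist_from T T' X) (@dist_to T T' X).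
Proof. by case=> -[]. Qed.
Definition dist (T T' X : finType) : fbij ((T + T') * X)%type (T * X + T' * X)%type :=
  FBij (@dist_toK T T' X) (@dist_fromK T T' X).

Definition unitl_to (X : Type) (p : unit * X) : X := p.2.
Lemma unitl_toK X : cancel (@unitl_to X) (pair tt). Proof. by case=> -[]. Qed.
Lemma unitl_fromK X : cancel (pair tt) (@unitl_to X). Proof. by []. Qed.
Definition unitl (X : finType) : fbij (unit * X)%type X :=
  FBij (@unitl_toK X) (@unitl_fromK X).

Definition unitr_to (X : Type) (p : X * unit) : X := p.1.
Definition unitr_from (X : Type) (x : X) : X * unit := (x, tt).
Lemma unitr_toK X : cancel (@unitr_to X) (@unitr_from X). Proof. by case=> ? -[]. Qed.
Lemma unitr_fromK X : cancel (@unitr_from X) (@unitr_to X). Proof. by []. Qed.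
Definition unitr (X : finType) : fbij (X * unit)%type X :=
  FBij (@unitr_toK X) (@unitr_fromK X).

Definition absurd (S T : Type) (hS : S -> void) (x : S) : T :=
  match hS x with end.
Lemma absurdK (S T : Type) (hS : S -> void) (hT : T -> void) :
  cancel (absurd T hS) (absurd S hT).
Proof. by move=> x; case: (hS x). Qed.
Definition bempty (S T : finType) (hS : S -> void) (hT : T -> void) : fbij S T :=
  FBij (absurdK hS hT) (absurdK hT hS).
Definition voidl (X : Type) (p : void * X) : void := p.1.
Definition voidr (X : Type) (p : X * void) : void := p.2.

Section BigUnion.
Variables (C : numClosedFieldType) (u : option C) (n : nat).
Notation Cob := (Cob u n).
Notation hrel := (hrel u n).
Variables (X Y : finType).

Definition bcons (T Z : finType) : fbij ((unit + T) * Z)%type (Z + T * Z)%type :=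
  bcomp (bsum (unitl Z) (bid _)) (dist unit T Z).

Fixpoint bigU (k : nat) : (sk k -> Cob X Y) -> Cob (sk k * X)%type (sk k * Y)%type :=
  match k with
  | 0 => fun _ => hrel (bempty (@voidl X) (@voidl Y))
  | k'.+1 => fun m => hrel (binv (bcons (sk k') Y)) **
      (m (inl tt) +|+ bigU (fun x => m (inr x))) ** hrel (bcons (sk k') X)
  end.

Lemma eq_conj (A B D E : finType) (s s' : fbij D E) (t t' : fbij A B) (f : Cob B D) :
  fto s =1 fto s' -> fto t =1 fto t' ->
  hrel s ** (f ** hrel t) = hrel s' ** (f ** hrel t').
Proof. by move=> /(eq_hrel u n) -> /(eq_hrel u n) ->. Qed.

Definition nat_at k (s : fbij (sk k) (sk k)) := forall m,
  hrel (idx Y s) ** bigU m = bigU (fun x => m (ffrom s x)) ** hrel (idx X s).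

Lemma nat_ext k (s s' : fbij (sk k) (sk k)) : fto s =1 fto s' ->
  nat_at s -> nat_at s'.
Proof.
move=> h hs m.
have E (Z : finType) : hrel (idx Z s') = hrel (idx Z s).
  by apply: eq_hrel => -[a z]; rewrite /idx /idx_map /= h.
rewrite !E hs; congr (bigU _ ** _); apply/funext => x; congr m.
by apply: (can_inj (ftoK s')); rewrite ffromK -h ffromK.
Qed.

Lemma nat_comp k (s s' : fbij (sk k) (sk k)) :
  nat_at s -> nat_at s' -> nat_at (bcomp s s').
Proof.
move=> hs hs' m.
have E (Z : finType) : hrel (idx Z (bcomp s s')) = hrel (idx Z s) ** hrel (idx Z s').
  by rewrite hrel_comp; apply: eq_hrel => -[a z].
by rewrite !E -hcompA hs' hcompA hs hcompA.
Qed.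

Lemma nat_id k : nat_at (bid (sk k)).
Proof.
move=> m.
have E (Z : finType) : hrel (idx Z (bid (sk k))) = hrel (bid _).
  by apply: eq_hrel => -[a z].
by rewrite !E hcomp_idl hcomp_idr.
Qed.

Lemma nat_cons k (s : fbij (sk k) (sk k)) : nat_at s -> @nat_at k.+1 (bsum (bid unit) s).
Proof.
move=> hs m /=.
have EY : hrel (idx Y (bsum (bid unit) s)) ** hrel (binv (bcons (sk k) Y)) =
    hrel (binv (bcons (sk k) Y)) ** hrel (bsum (bid Y) (idx Y s)).
  by rewrite !hrel_comp; apply: eq_hrel => -[a|[a z]].
have EX : hrel (bcons (sk k) X) ** hrel (idx X (bsum (bid unit) s)) =
    hrel (bsum (bid X) (idx X s)) ** hrel (bcons (sk k) X).
  by rewrite !hrel_comp; apply: eq_hrel => -[[a|a] z].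
rewrite !hcompA EY -!hcompA EX; congr (_ ** _); rewrite !hcompA; congr (_ ** _).
rewrite -!hrel_union !hcomp_hunion hs hcomp_idl.
by rewrite hcomp_idr.
Qed.

Definition flip2 (T : Type) (x : unit + (unit + T)) : unit + (unit + T) :=
  match x with
  | inl a => inr (inl a) | inr (inl a) => inl a | inr (inr b) => inr (inr b)
  end.
Lemma flip2K (T : Type) : involutive (@flip2 T). Proof. by case=> [|[]]. Qed.
Definition bflip2 (T : finType) : fbij (unit + (unit + T))%type (unit + (unit + T))%type :=
  FBij (@flip2K T) (@flip2K T).

Lemma nat_flip2 k : @nat_at k.+2 (bflip2 (sk k)).
Proof.
move=> m /=.
pose L (Z : finType) : fbij ((unit + (unit + sk k)) * Z)%type ((Z + Z) + sk k * Z)%type :=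
  bcomp (binv (bassoc _ _ _)) (bcomp (bsum (bid Z) (bcons (sk k) Z)) (bcons (unit + sk k)%type Z)).
(* Reassociation isolates the first two factors, so that exchanging them is an instance of
   [hswap]. *)
have key (x y : Cob X Y) (w : Cob (sk k * X)%type (sk k * Y)%type) :
  hrel (binv (bcons (unit + sk k)%type Y)) **
   (x +|+ hrel (binv (bcons (sk k) Y)) ** (y +|+ w) ** hrel (bcons (sk k) X)) **
   hrel (bcons (unit + sk k)%type X) =
  hrel (binv (L Y)) ** ((x +|+ y) +|+ w) ** hrel (L X).
  have -> : x +|+ hrel (binv (bcons (sk k) Y)) ** (y +|+ w) ** hrel (bcons (sk k) X)
    = (hrel (bid _) +|+ hrel (binv (bcons (sk k) Y))) ** (x +|+ (y +|+ w)) **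
      (hrel (bid _) +|+ hrel (bcons (sk k) X)).
    by rewrite !hcomp_hunion hcomp_idl hcomp_idr.
  have -> : x +|+ y +|+ w = hrel (binv (bassoc _ _ _)) ** (x +|+ (y +|+ w)) ** hrel (bassoc _ _ _).
    by rewrite -hcompA -hassoc hcompA hrelK hcomp_idl.
  rewrite !hrel_union !hcompA !hrel_comp -!hcompA !hrel_comp.
  by apply: eq_conj => [[a|[a|[a z]]]|[[a|[a|a]] z]].
rewrite !key.
have EY : hrel (idx Y (bflip2 (sk k))) ** hrel (binv (L Y)) =
    hrel (binv (L Y)) ** (hrel (bswap Y Y) +|+ hrel (bid _)).
  by rewrite hrel_union !hrel_comp; apply: eq_hrel => -[[a|a]|[a z]].
have EX : hrel (L X) ** hrel (idx X (bflip2 (sk k))) =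
    (hrel (bswap X X) +|+ hrel (bid _)) ** hrel (L X).
  by rewrite hrel_union !hrel_comp; apply: eq_hrel => -[[a|[a|a]] z].
rewrite !hcompA EY -!hcompA EX; congr (_ ** _); rewrite !hcompA; congr (_ ** _).
by rewrite !hcomp_hunion hswap hcomp_idl hcomp_idr.
Qed.

Lemma nat_fix k (s : fbij (unit + sk k)%type (unit + sk k)%type) :
  fto s (inl tt) = inl tt ->
  exists r : fbij (sk k) (sk k), fto s =1 fto (bsum (bid unit) r).
Proof.
move=> h; have h' : ffrom s (inl tt) = inl tt by rewrite -[in LHS]h ftoK.
pose f x := if fto s (inr x) is inr y then y else x.
pose g x := if ffrom s (inr x) is inr y then y else x.
have fE x : fto s (inr x) = inr (f x).
  rewrite /f; case e: (fto s (inr x)) => [[]|//].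
  by have := ftoK s (inr x); rewrite e h'.
have gE x : ffrom s (inr x) = inr (g x).
  rewrite /g; case e: (ffrom s (inr x)) => [[]|//].
  by have := ffromK s (inr x); rewrite e h.
have fK : cancel f g.
  by move=> x; have := ftoK s (inr x); rewrite fE gE => -[].
have gK : cancel g f.
  by move=> x; have := ffromK s (inr x); rewrite gE fE => -[].
by exists (FBij fK gK) => -[[]|x] //=; rewrite fE.
Qed.

(* The symmetric group is generated by the transposition of the first two points
   together with the permutations fixing the first one. *)
Lemma nat_all k (s : fbij (sk k) (sk k)) : nat_at s.
Proof.
elim: k s => [|k IH] s; first by apply: nat_ext (nat_id (k := 0)) => -[].
have fixed r : fto r (inl tt) = inl tt -> @nat_at k.+1 r.
  move=> h; have [r' e] := nat_fix h.
  by apply: (@nat_ext k.+1 (bsum (bid unit) r') r) (nat_cons (IH r')) => x; rewrite e.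
case e: (fto s (inl tt)) => [[]|y]; first exact: fixed.
case: k IH s fixed y e => [|k] IH s fixed y e; first by case: y e.
pose y0 : sk k.+1 := inl tt.
have yK : involutive (fun x : sk k.+1 => if x == y then y0 else if x == y0 then y else x).
  move=> x /=; case: (eqVneq x y) => [->|xy].
    by rewrite eqxx; case: eqVneq.
  case: (eqVneq x y0) => [->|xy0]; first by rewrite eqxx.
  by rewrite (negbTE xy) (negbTE xy0).
pose r := FBij yK yK.
(* [q] and the [p] below are mutually inverse. [p] sends the image [inr y] of the first point back
   to it, so p s fixes the first point and s = q (p s). *)
pose q : fbij (sk k.+2) (sk k.+2) := bcomp (bsum (bid unit) r) (bflip2 (sk k)).
have qs : nat_at q := nat_comp (nat_cons (IH r)) (nat_flip2 (k := k)).
pose p : fbij (sk k.+2) (sk k.+2) := bcomp (bflip2 (sk k)) (bsum (bid unit) r).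
have ps : @nat_at k.+2 (bcomp p s).
  by apply: fixed; rewrite /= e /= eqxx.
apply: nat_ext (nat_comp qs ps) => x.
change (sum_map id (fto r) (flip2 (flip2 (sum_map id (fto r) (fto s x)))) = fto s x).
by rewrite flip2K; case: (fto s x) => [[]|b] //=; rewrite yK.
Qed.
End BigUnion.

Section BigUnionAny.
Variables (C : numClosedFieldType) (u : option C) (n : nat).
Notation Cob := (Cob u n).
Notation hrel := (hrel u n).

Section Fixed.
Variables (X Y : finType).

Definition bindex (A : finType) : fbij (sk #|A|) A := bcard (card_sk #|A|).

Definition bigA (A : finType) (m : A -> Cob X Y) : Cob (A * X)%type (A * Y)%type :=
  hrel (idx Y (bindex A)) ** bigU (fun x => m (fto (bindex A) x))
  ** hrel (binv (idx X (bindex A))).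

(** Two enumerations of [A] differ by a permutation of [sk k], under which [bigU] is natural; hence
    the enumeration chosen in [bigA] can be replaced by a convenient one. *)
Lemma bigAE (A : finType) k (b : fbij (sk k) A) (m : A -> Cob X Y) :
  bigA m = hrel (idx Y b) ** bigU (fun x => m (fto b x)) ** hrel (binv (idx X b)).
Proof.
rewrite /bigA; move: (bindex A); set l := #|A| => c.
have kl : k = l.
  by rewrite -(card_sk k) -(card_sk l); apply: (bij_eq_card (f := ffrom c \o fto b));
    exists (ffrom b \o fto c) => x /=; rewrite ?ffromK ?ftoK // ffromK.
clearbody l; subst l.
pose s := bcomp (binv b) c.
have := nat_all s (fun x => m (fto c x)).
have -> : (fun x => m (fto c (ffrom s x))) = fun x => m (fto b x).
  by apply/funext => x; rewrite /= ffromK.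
have EY : hrel (idx Y b) ** hrel (idx Y s) = hrel (idx Y c).
  by rewrite hrel_comp; apply: eq_hrel => -[a z]; rewrite /= /idx_map /= ffromK.
have EX : hrel (idx X s) ** hrel (binv (idx X c)) = hrel (binv (idx X b)).
  by rewrite hrel_comp; apply: eq_hrel => -[a z]; rewrite /= /idx_map /= ffromK.
by move=> H; rewrite -EY -[X in X ** _]hcompA H -!hcompA EX.
Qed.

Lemma bigA_nat (A B : finType) (s : fbij A B) (m : A -> Cob X Y) :
  hrel (idx Y s) ** bigA m ** hrel (binv (idx X s)) = bigA (fun b => m (ffrom s b)).
Proof.
rewrite (bigAE (bcomp s (bindex A))) /bigA.
have -> : (fun x => m (ffrom s (fto (bcomp s (bindex A)) x))) =
  fun x => m (fto (bindex A) x) by apply/funext => x; rewrite /= ftoK.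
rewrite !hcompA hrel_comp -!hcompA hrel_comp.
by apply: eq_conj => -[a z].
Qed.

Lemma bigA_cons (A : finType) (m : unit + A -> Cob X Y) :
  bigA m = hrel (binv (bcons A Y)) **
    (m (inl tt) +|+ bigA (fun a => m (inr a))) ** hrel (bcons A X).
Proof.
rewrite (@bigAE _ #|A|.+1 (bsum (bid unit) (bindex A))) /= /bigA.
set B := bigU _.
have -> : m (inl tt) +|+ hrel (idx Y (bindex A)) ** B ** hrel (binv (idx X (bindex A)))
   = (hrel (bid _) +|+ hrel (idx Y (bindex A))) ** (m (inl tt) +|+ B) **
     (hrel (bid _) +|+ hrel (binv (idx X (bindex A)))).
  by rewrite !hcomp_hunion hcomp_idl hcomp_idr.
rewrite !hrel_union !hcompA !hrel_comp -!hcompA !hrel_comp.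
by apply: eq_conj => [[a|[a z]]|[[a|a] z]].
Qed.

Lemma bigA_void (m : void -> Cob X Y) :
  bigA m = hrel (bempty (@voidl X) (@voidl Y)).
Proof.
rewrite (@bigAE _ 0 (bid void)) /= !hrel_comp.
by apply: eq_hrel => -[[]].
Qed.

Lemma bigA_unit (m : unit -> Cob X Y) :
  bigA m = hrel (binv (unitl Y)) ** m tt ** hrel (unitl X).
Proof.
have sK : cancel (fun _ : unit + void => tt) (@inl unit void) by case=> [[]|[]].
have sK' : cancel (@inl unit void) (fun _ => tt) by case.
pose s : fbij (unit + void)%type unit := FBij sK sK'.
pose m' x := m (fto s x).
have -> : m = fun b => m' (ffrom s b) by apply/funext => -[].
rewrite -bigA_nat bigA_cons bigA_void.
set w := hrel (bempty _ _).
have e (Z : finType) : cancel (fun x : Z + void * Z => match x with inl z => z | inr p => match p.1 with end end) inl.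
  by case=> [z|[[]]].
have e' (Z : finType) : cancel (@inl Z (void * Z)) (fun x => match x with inl z => z | inr p => match p.1 with end end).
  by [].
pose r (Z : finType) : fbij (Z + void * Z)%type Z := FBij (e Z) (e' Z).
have key : hrel (r Y) ** (m tt +|+ w) = m tt ** hrel (r X).
  pose v (Z : finType) : fbij void (void * Z)%type := bempty id (@voidl Z).
  have -> : hrel (r Y) = hrel (bunit Y) ** (hrel (bswap Y void) ** (hrel (bid Y) +|+ hrel (binv (v Y)))).
    by rewrite hrel_union !hrel_comp; apply: eq_hrel => -[z|[[]]].
  rewrite -!hcompA hcomp_hunion hcomp_idl.
  have -> : hrel (binv (v Y)) ** w = hrel (bid void) ** hrel (binv (v X)).
    by rewrite !hrel_comp; apply: eq_hrel => -[[]].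
  rewrite -[m tt in LHS]hcomp_idr -hcomp_hunion [hrel (bswap _ _) ** _]hcompA hswap.
  rewrite !hcompA hunit -!hcompA; congr (_ ** _).
  by rewrite hrel_union !hrel_comp; apply: eq_hrel => -[z|[[]]].
have -> : m' (inl tt) +|+ w = hrel (binv (r Y)) ** m tt ** hrel (r X).
  by rewrite -hcompA -key hcompA hrelK hcomp_idl.
rewrite !hcompA !hrel_comp -!hcompA !hrel_comp.
rewrite -[m' (ffrom s tt)]/(m tt).
by apply: eq_conj => [z|[[] z]].
Qed.

Lemma bigA_sum (A B : finType) (m : A + B -> Cob X Y) :
  bigA m = hrel (binv (dist A B Y)) **
    (bigA (fun a => m (inl a)) +|+ bigA (fun b => m (inr b))) ** hrel (dist A B X).
Proof.
suff H k (m' : sk k + B -> Cob X Y) :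
  bigA m' = hrel (binv (dist (sk k) B Y)) **
    (bigA (fun a => m' (inl a)) +|+ bigA (fun b => m' (inr b))) ** hrel (dist (sk k) B X).
  pose s := bsum (bindex A) (bid B).
  pose m' x := m (fto s x).
  have e : m = fun x => m' (ffrom s x).
    by apply/funext => x; rewrite /m' ffromK.
  rewrite {1}e -bigA_nat H.
  have -> : (fun a => m (inl a)) = fun a => m' (inl (ffrom (bindex A) a)).
    apply/funext => a.
    exact: (congr1 (fun y => m (inl y)) (esym (ffromK (bindex A) a))).
  rewrite -(bigA_nat (bindex A) (fun x => m' (inl x))).
  rewrite -[bigA (fun b => m (inr b))]/(bigA (fun b => m' (inr b))).
  set p := bigA _; set q := bigA _; clearbody p q.
  rewrite -[q in RHS]hcomp_idr -[q in RHS]hcomp_idl.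
  rewrite -!hcomp_hunion !hrel_union !hcompA !hrel_comp -!hcompA !hrel_comp.
by apply: eq_conj => [[[a z]|[b z]]|[[a|b] z]].
elim: k m' => [|k IH] m'.
  have -> : bigA m' = hrel (idx Y (binv (bunit B))) ** bigA (fun b => m' (inr b))
      ** hrel (binv (idx X (binv (bunit B)))).
    by rewrite bigA_nat; congr bigA; apply/funext => -[].
  rewrite bigA_void; set w := bigA _; clearbody w.
  pose v (Z : finType) : fbij void (void * Z)%type := bempty id (@voidl Z).
  have -> : hrel (bempty (@voidl X) (@voidl Y)) +|+ w =
    (hrel (v Y) +|+ hrel (bid _)) ** (hrel (binv (bunit _)) ** w ** hrel (bunit _))
     ** (hrel (binv (v X)) +|+ hrel (bid _)).
    have -> : hrel (binv (bunit _)) ** w ** hrel (bunit _) = hrel (bid _) +|+ w.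
      by rewrite -hcompA -hunit hcompA hrelK hcomp_idl.
    rewrite !hcomp_hunion !hcomp_idr !hcomp_idl; congr (_ +|+ _).
    by rewrite hrel_comp; apply: eq_hrel => -[[]].
  rewrite !hrel_union !hcompA !hrel_comp -!hcompA !hrel_comp.
  by apply: eq_conj => [[b z]|[[[]|b] z]].
pose t x := m' (ffrom (bassoc unit (sk k) B) x).
have -> : bigA m' = hrel (idx Y (binv (bassoc unit (sk k) B))) ** bigA t
    ** hrel (binv (idx X (binv (bassoc unit (sk k) B)))).
  by rewrite bigA_nat; congr bigA; apply/funext => -[[a|a]|b].
rewrite bigA_cons IH bigA_cons /t /=.
set a := m' _; set b := bigA _; set c := bigA _; clearbody a b c.
have -> : a +|+ hrel (binv (dist (sk k) B Y)) ** (b +|+ c) ** hrel (dist (sk k) B X)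
  = (hrel (bid _) +|+ hrel (binv (dist (sk k) B Y))) ** (a +|+ (b +|+ c)) **
    (hrel (bid _) +|+ hrel (dist (sk k) B X)).
  by rewrite !hcomp_hunion hcomp_idl hcomp_idr.
have -> : a +|+ (b +|+ c) = hrel (bassoc _ _ _) ** (a +|+ b +|+ c) ** hrel (binv (bassoc _ _ _)).
  by rewrite hassoc -hcompA hrelVK hcomp_idr.
have -> : hrel (binv (bcons (sk k) Y)) ** (a +|+ b) ** hrel (bcons (sk k) X) +|+ c =
  (hrel (binv (bcons (sk k) Y)) +|+ hrel (bid _)) ** (a +|+ b +|+ c) **
  (hrel (bcons (sk k) X) +|+ hrel (bid _)).
  by rewrite !hcomp_hunion hcomp_idl hcomp_idr.
rewrite !hrel_union !hcompA !hrel_comp -!hcompA !hrel_comp.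
by apply: eq_conj => [[[z|[d z]]|[d z]]|[[[d|d]|d] z]].
Qed.
End Fixed.

Definition capm (A : finType) (m : A -> Cob void unit) : Cob void A :=
  hrel (unitr A) ** bigA m ** hrel (bempty id (@voidr A)).
Definition cupm (A : finType) (m : A -> Cob unit void) : Cob A void :=
  hrel (bempty (@voidr A) id) ** bigA m ** hrel (binv (unitr A)).

Lemma capm_nat (A B : finType) (s : fbij A B) m :
  hrel s ** capm m = capm (fun b => m (ffrom s b)).
Proof.
rewrite /capm -bigA_nat; set w := bigA m; clearbody w; rewrite !hcompA !hrel_comp -!hcompA !hrel_comp.
by apply: eq_conj => -[].
Qed.

Lemma cupm_nat (A B : finType) (s : fbij A B) m :
  cupm m ** hrel s = cupm (fun a => m (fto s a)).
Proof.
rewrite /cupm -[fun a => m (fto s a)]/(fun a => m (ffrom (binv s) a)).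
rewrite -bigA_nat; set w := bigA m; clearbody w; rewrite !hcompA !hrel_comp -!hcompA !hrel_comp.
by apply: eq_conj => // -[? []].
Qed.

Lemma capm_void m : capm (A := void) m = hrel (bid void).
Proof. by rewrite /capm bigA_void !hrel_comp; apply: eq_hrel => -[]. Qed.

Lemma cupm_void m : cupm (A := void) m = hrel (bid void).
Proof. by rewrite /cupm bigA_void !hrel_comp; apply: eq_hrel => -[]. Qed.

Lemma capm_unit m : capm m = m tt.
Proof.
rewrite /capm bigA_unit !hcompA hrel_comp -!hcompA hrel_comp.
rewrite -[RHS]hcomp_idl -[m tt in RHS]hcomp_idr.
by apply: eq_conj => -[].
Qed.

Lemma cupm_unit m : cupm m = m tt.
Proof.
rewrite /cupm bigA_unit !hcompA hrel_comp -!hcompA hrel_comp.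
rewrite -[RHS]hcomp_idl -[m tt in RHS]hcomp_idr.
by apply: eq_conj => -[].
Qed.

Lemma capm_sum (A B : finType) (m : A + B -> Cob void unit) :
  capm m = (capm (fun a => m (inl a)) +|+ capm (fun b => m (inr b)))
           ** hrel (binv (bunit void)).
Proof.
rewrite /capm bigA_sum; set a := bigA _; set b := bigA _; clearbody a b; rewrite -!hcomp_hunion !hrel_union !hcompA !hrel_comp -!hcompA !hrel_comp.
by apply: eq_conj => [[[x []]|[x []]]|[]].
Qed.

Lemma cupm_sum (A B : finType) (m : A + B -> Cob unit void) :
  cupm m = hrel (bunit void) **
    (cupm (fun a => m (inl a)) +|+ cupm (fun b => m (inr b))).
Proof.
rewrite /cupm bigA_sum; set a := bigA _; set b := bigA _; clearbody a b; rewrite -!hcomp_hunion !hrel_union !hcompA !hrel_comp -!hcompA !hrel_comp.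
by apply: eq_conj => [[[x []]|[x []]]|[x|x]].
Qed.
End BigUnionAny.

Lemma nat_scale (C : numClosedFieldType) (u : option C) n (A B : finType) m (x : Cob u n A B) :
  \big[@hadd _ _ _ _ _/h0]_(i < m) x = m%:R *:: x.
Proof.
elim: m => [|m IH]; first by rewrite big_ord0 hscale0.
by rewrite big_ord_recr IH /= -natr1 hscaleDl hscale1.
Qed.

(** * Neck cutting and dotted spheres in the category of cobordisms *)

Section Closed.
Variables (C : numClosedFieldType) (u : option C) (n : nat).
Hypothesis n_gt1 : (1 < n)%N.
Let n_gt0 : (0 < n)%N := ltnW n_gt1.
Notation Cob := (Cob u n).
Notation cls := (cls u n).
Notation hrel := (hrel u n).
Notation hid := (hrel (bid _)).
Notation hidu := (hrel (bid unit)).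

Definition hdot k : Cob unit unit := cls (dots C k).
Definition hcap : Cob void unit := cls Cap.
Definition hcup : Cob unit void := cls Cup.
Definition hmerge : Cob (unit + unit)%type unit := cls Merge.
Definition hsplit : Cob unit (unit + unit)%type := cls Split.
Definition capx i := locked (hdot i ** hcap).
Definition cupx i := locked (hcup ** hdot i).
Definition sphere k : Cob void void := locked (hcup ** hdot k ** hcap).

Lemma capxE i : capx i = hdot i ** hcap. Proof. by rewrite /capx -lock. Qed.
Lemma cupxE i : cupx i = hcup ** hdot i. Proof. by rewrite /cupx -lock. Qed.
Lemma sphereE k : sphere k = hcup ** hdot k ** hcap.
Proof. by rewrite /sphere -lock. Qed.

Lemma hdotS k : hdot k.+1 = hdot 1 ** hdot k.
Proof. by rewrite /hdot /= -!cls_comp; rewrite !cls_comp hcomp_idr. Qed.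

Lemma hdotD k l : hdot (k + l) = hdot k ** hdot l.
Proof.
elim: k => [|k IH]; first by rewrite hcomp_idl.
by rewrite addSn hdotS IH hcompA -hdotS.
Qed.

Lemma hNC : hid = \big[@hadd _ _ _ _ _/h0]_(i < n) (capx (n.-1 - i) ** cupx i).
Proof.
have /clsP := eqc_NC u n; rewrite cls_bigadd -[hid]/(cls (Id unit)) => -> .
by apply: eq_bigr => i _; rewrite !cls_comp capxE cupxE.
Qed.

Lemma hvoidl (h : Cob void void) :
  h = hrel (bunit _) ** (hid +|+ h) ** hrel (binv (bunit _)).
Proof. by rewrite hunit -hcompA hrelVK hcomp_idr. Qed.

Lemma hvoidr (h : Cob void void) :
  h = hrel (bunit _) ** (h +|+ hid) ** hrel (binv (bunit _)).
Proof.
rewrite {1}(hvoidl h).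
have e : hrel (bunit void) = hrel (bunit void) ** hrel (bswap void void).
  by rewrite hrel_comp; apply: eq_hrel => -[[]|[]].
rewrite [in LHS]e -[_ ** (hid +|+ h)]hcompA hswap hcompA -!hcompA.
by congr (_ ** _); congr (_ ** _); rewrite !hrel_comp; apply: eq_hrel => -[].
Qed.

Lemma hvoid_union (x y : Cob void void) :
  hrel (bunit _) ** (x +|+ y) ** hrel (binv (bunit _)) = x ** y.
Proof.
rewrite [in RHS](hvoidr x) [in RHS](hvoidl y) !hcompA.
have -> : hrel (bunit void) ** (x +|+ hid) ** hrel (binv (bunit void)) ** hrel (bunit void)
    = hrel (bunit void) ** (x +|+ hid).
  by rewrite -!hcompA hrelK hcomp_idr.
by rewrite -[in RHS](hcompA (hrel (bunit void)) (x +|+ _)) hcomp_hunion hcomp_idl hcomp_idr.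
Qed.

(** The Eckmann-Hilton argument: on endomorphisms of the empty set, composition agrees with disjoint
    union in either order. *)
Lemma hvoidC (x y : Cob void void) : x ** y = y ** x.
Proof.
rewrite -[RHS]hvoid_union [in LHS](hvoidl x) [in LHS](hvoidr y) !hcompA.
have -> : hrel (bunit void) ** (hid +|+ x) ** hrel (binv (bunit void)) ** hrel (bunit void)
    = hrel (bunit void) ** (hid +|+ x).
  by rewrite -!hcompA hrelK hcomp_idr.
by rewrite -[in LHS](hcompA (hrel (bunit void)) (_ +|+ x)) hcomp_hunion hcomp_idl hcomp_idr.
Qed.

Lemma cup_cap i j : cupx i ** capx j = sphere (i + j).
Proof. by rewrite cupxE capxE sphereE hdotD !hcompA. Qed.

Lemma sphere_neck a b :
  sphere (a + b) = \big[@hadd _ _ _ _ _/h0]_(i < n) (sphere (a + i) ** sphere (b + (n.-1 - i))).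
Proof.
rewrite addnC -cup_cap -[cupx b]hcomp_idr hNC hcomp_sumr hcomp_suml.
apply: eq_bigr => i _.
rewrite hcompA cup_cap -hcompA cup_cap hvoidC; congr (sphere _ ** _).
by rewrite addnC.
Qed.

Lemma dot_split : (hdot 1 +|+ hidu) ** hsplit = hsplit ** hdot 1.
Proof.
have e : hdot 1 = cls Dot by rewrite /hdot /= cls_comp hcomp_idr.
by have /clsP := eqc_dot_split u n; rewrite !cls_comp cls_union -e.
Qed.

Lemma dot_merge : hmerge ** (hdot 1 +|+ hidu) = hdot 1 ** hmerge.
Proof.
have e : hdot 1 = cls Dot by rewrite /hdot /= cls_comp hcomp_idr.
by have /clsP := eqc_dot_merge u n; rewrite !cls_comp cls_union -e.
Qed.

Lemma dots_split k : (hdot k +|+ hidu) ** hsplit = hsplit ** hdot k.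
Proof.
elim: k => [|k IH]; first by rewrite hrel_union [X in X ** _](_ : _ = hid) ?hcomp_idl ?hcomp_idr //;
  apply: eq_hrel => -[].
have -> : hdot k.+1 +|+ hidu = (hdot 1 +|+ hidu) ** (hdot k +|+ hidu).
  by rewrite hcomp_hunion hcomp_idl hdotS.
by rewrite -hcompA IH hcompA dot_split -hcompA -hdotS.
Qed.

Lemma dots_merge k : hmerge ** (hdot k +|+ hidu) = hdot k ** hmerge.
Proof.
elim: k => [|k IH]; first by rewrite hrel_union [X in _ ** X](_ : _ = hid) ?hcomp_idl ?hcomp_idr //;
  apply: eq_hrel => -[].
have -> : hdot k.+1 +|+ hidu = (hdot 1 +|+ hidu) ** (hdot k +|+ hidu).
  by rewrite hcomp_hunion hcomp_idl hdotS.
by rewrite hcompA dot_merge -hcompA IH hcompA -hdotS.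
Qed.

Lemma merge_capx i : hmerge ** (capx i +|+ hidu) = hdot i ** hrel (bunit unit).
Proof.
have -> : capx i +|+ hidu = (hdot i +|+ hidu) ** (hcap +|+ hidu).
  by rewrite hcomp_hunion hcomp_idl capxE.
rewrite hcompA dots_merge -hcompA; congr (_ ** _).
by have /clsP := eqc_merge1 u n; rewrite cls_comp cls_union.
Qed.

Lemma split_cupx i : (cupx i +|+ hidu) ** hsplit = hrel (binv (bunit unit)) ** hdot i.
Proof.
have -> : cupx i +|+ hidu = (hcup +|+ hidu) ** (hdot i +|+ hidu).
  by rewrite hcomp_hunion hcomp_idl cupxE.
rewrite -hcompA dots_split hcompA; congr (_ ** _).
by have /clsP := eqc_split1 u n; rewrite cls_comp cls_union.
Qed.

(** Cutting one of the two tubes of the handle leaves n terms, each a cylinder with i + (n-1-i)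
    dots. *)
Lemma handle : hmerge ** hsplit = n%:R *:: hdot n.-1.
Proof.
have -> : hsplit = (hidu +|+ hidu) ** hsplit.
  rewrite hrel_union [X in _ = X ** _](_ : _ = hid) ?hcomp_idl //.
  by apply: eq_hrel => -[].
rewrite {1}hNC hunion_suml hcomp_suml hcomp_sumr -nat_scale.
apply: eq_bigr => i _.
have -> : (capx (n.-1 - i) ** cupx i) +|+ hidu
    = (capx (n.-1 - i) +|+ hidu) ** (cupx i +|+ hidu) by rewrite hcomp_hunion hcomp_idl.
rewrite -hcompA split_cupx !hcompA merge_capx -[_ ** _ ** hrel _]hcompA hrelVK hcomp_idr.
by rewrite -hdotD subnK // -ltnS prednK ?ltn_ord.
Qed.

(** Closing up the handle makes the torus n times this sphere; the torus relation is then divided by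
    n. *)
Lemma sphere_torus : sphere n.-1 = hid.
Proof.
have n0 : n%:R != 0 :> C by rewrite pnatr_eq0 -lt0n.
have /clsP := eqc_T u n.
rewrite !cls_comp -hscale_cls -/hmerge -/hsplit -/hcap -/hcup.
rewrite [hmerge ** _]hcompA handle hcompZl hcompZr hcompA -sphereE => h.
by have := congr1 (hscale n%:R^-1) h; rewrite !hscaleA mulVf // !hscale1.
Qed.
End Closed.

(** * Closed surfaces and completeness of F *)

(* A small syntax for the endomorphisms of the empty set generated by dotted
   spheres: unlike [Cob void void] its quotient [surf] can carry a ring
   structure. *)
Inductive sterm (C : Type) :=
  | SConst of C | SSphere of nat | SAdd of sterm C & sterm C | SMul of sterm C & sterm C.
Arguments SSphere {C}.

Section Surfaces.
Variables (C : numClosedFieldType) (u : option C) (n : nat).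
Notation Cob := (Cob u n).
Notation cls := (cls u n).
Notation hrel := (hrel u n).
Notation hid := (hrel (bid void)).

Fixpoint sem (a : sterm C) : Cob void void :=
  match a with
  | SConst c => c *:: hid
  | SSphere k => sphere u n k
  | SAdd a b => sem a +++ sem b
  | SMul a b => sem a ** sem b
  end.

(** The proof of 1 < n is an argument of the type because the ring structure below needs it for 1 !=
    0. *)
Definition surf (n_gt1 : (1 < n)%N) : Type :=
  {S : sterm C -> Prop | exists a, S = fun b => sem a = sem b}.

Variable n_gt1 : (1 < n)%N.
Let n_gt0 : (0 < n)%N := ltnW n_gt1.
Notation K := (surf n_gt1).

Definition scls (a : sterm C) : K :=
  exist _ (fun b => sem a = sem b) (ex_intro _ a erefl).

Lemma sclsE (x : K) : exists a, x = scls a.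
Proof. by case: x => S [a e]; exists a; apply: eq_exist. Qed.

Definition surfval (x : K) : Cob void void := sem (projT1 (cid (sclsE x))).

Lemma surfval_cls a : surfval (scls a) = sem a.
Proof.
rewrite /surfval; case: cid => b /= /(congr1 (fun x => proj1_sig x b)) /= E.
by symmetry; rewrite E.
Qed.

Lemma surfval_inj : injective surfval.
Proof.
move=> x y; have [a ->] := sclsE x; have [b ->] := sclsE y.
rewrite !surfval_cls => e; apply: eq_exist; apply/funext => c; by rewrite e.
Qed.

HB.instance Definition _ := gen_eqMixin K.
HB.instance Definition _ := gen_choiceMixin K.

Definition srep (x : K) : sterm C := projT1 (cid (sclsE x)).
Definition sadd (x y : K) := scls (SAdd (srep x) (srep y)).
Definition smul (x y : K) := scls (SMul (srep x) (srep y)).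
Definition sconst (c : C) : K := scls (SConst c).
Definition sopp (x : K) := smul (sconst (-1)) x.

Lemma surfvalD x y : surfval (sadd x y) = surfval x +++ surfval y.
Proof. exact: surfval_cls. Qed.
Lemma surfvalM x y : surfval (smul x y) = surfval x ** surfval y.
Proof. exact: surfval_cls. Qed.
Lemma surfval_const c : surfval (sconst c) = c *:: hid.
Proof. exact: surfval_cls. Qed.

Lemma saddA : associative sadd.
Proof. by move=> x y w; apply: surfval_inj; rewrite !surfvalD haddA. Qed.
Lemma saddC : commutative sadd.
Proof. by move=> x y; apply: surfval_inj; rewrite !surfvalD haddC. Qed.
Lemma sadd0 : left_id (sconst 0) sadd.
Proof. by move=> x; apply: surfval_inj; rewrite surfvalD surfval_const hscale0 hadd0. Qed.
Lemma saddN : left_inverse (sconst 0) sopp sadd.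
Proof.
move=> x; apply: surfval_inj; rewrite surfvalD surfvalM !surfval_const hcompZl hcomp_idl.
by rewrite -{2}[surfval x]hscale1 -hscaleDl addNr !hscale0.
Qed.
HB.instance Definition _ := GRing.isZmodule.Build K saddA saddC sadd0 saddN.

Lemma smulA : associative smul.
Proof. by move=> x y w; apply: surfval_inj; rewrite !surfvalM hcompA. Qed.
Lemma smulC : commutative smul.
Proof. by move=> x y; apply: surfval_inj; rewrite !surfvalM hvoidC. Qed.
Lemma smul1 : left_id (sconst 1) smul.
Proof.
by move=> x; apply: surfval_inj; rewrite surfvalM surfval_const hscale1 hcomp_idl.
Qed.
Lemma smulDl : left_distributive smul sadd.
Proof. by move=> x y w; apply: surfval_inj; rewrite surfvalM !surfvalD !surfvalM hcompDl. Qed.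
Lemma s1_neq0 : sconst 1 != sconst 0.
Proof.
apply/eqP => /(congr1 surfval); rewrite !surfval_const hscale1 hscale0 => /clsP h.
(* Nontriviality comes from F, which sends the identity of the empty set to 1. With no U relation
   every t is sound, and 0 is taken. *)
pose t := if u is Some t then t else 0.
have hv : {ffun void -> 'I_n} by apply: finfun; case.
have ut t' : u = Some t' -> t' = t by rewrite /t => ->.
have := Fmor_sound n_gt1 ut h hv hv => /= /eqP.
rewrite (_ : [forall a, _] = true) ?oner_eq0 //.
by apply/forallP; case.
Qed.
HB.instance Definition _ :=
  GRing.Zmodule_isComNzRing.Build K smulA smulC smul1 smulDl s1_neq0.

Lemma sconst_additive : zmod_morphism sconst.
Proof.
move=> a b; apply: surfval_inj; have -> : sconst a - sconst b = sadd (sconst a) (sopp (sconst b)) by [].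
rewrite surfvalD surfvalM !surfval_const hcompZl hcomp_idl hscaleA -hscaleDl.
by rewrite mulN1r.
Qed.
Lemma sconst_monoid : monoid_morphism sconst.
Proof.
split=> // a b; apply: surfval_inj.
have -> : sconst a * sconst b = smul (sconst a) (sconst b) by [].
by rewrite surfvalM !surfval_const hcompZl hcomp_idl hscaleA.
Qed.
HB.instance Definition _ := GRing.isZmodMorphism.Build C K sconst sconst_additive.
HB.instance Definition _ := GRing.isMonoidMorphism.Build C K sconst sconst_monoid.

Definition ssphere k : K := scls (SSphere k).

Lemma surfval0 : surfval 0 = h0. Proof. by rewrite [LHS]surfval_const hscale0. Qed.
Lemma surfval1 : surfval 1 = hid. Proof. by rewrite [LHS]surfval_const hscale1. Qed.
Lemma surfval_add x y : surfval (x + y) = surfval x +++ surfval y. Proof. exact: surfvalD. Qed.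
Lemma surfval_mul x y : surfval (x * y) = surfval x ** surfval y. Proof. exact: surfvalM. Qed.
Lemma surfval_sum (I : Type) (r : seq I) (P : pred I) F :
  surfval (\sum_(i <- r | P i) F i) = \big[@hadd _ _ _ _ _/h0]_(i <- r | P i) surfval (F i).
Proof. exact: (big_morph surfval surfval_add surfval0). Qed.
Lemma surfval_sphere k : surfval (ssphere k) = sphere u n k.
Proof. exact: surfval_cls. Qed.

Definition Usurf : K := ssphere (n + n.-1).

Lemma ssphereE k : ssphere k = (k %% n == n.-1)%N%:R * Usurf ^+ (k %/ n).
Proof.
have [z z_prim] := prim_root_exists C n_gt0.
apply: (@sphere_value K n ssphere (sconst z)) => //.
- move=> a b; apply: surfval_inj; rewrite surfval_sum surfval_sphere sphere_neck //.
  by apply: eq_bigr => i _; rewrite surfval_mul !surfval_sphere.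
- by apply: surfval_inj; rewrite surfval_sphere sphere_torus // surfval1.
- move=> i /andP[i0 hi]; under eq_bigr do rewrite -rmorphXn.
  rewrite -rmorph_sum; under eq_bigr do rewrite mulnC.
  rewrite (sum_prim_root z_prim) (_ : (n %| i)%N = false) ?mul0r ?rmorph0 //.
  by apply/negbTE; rewrite /dvdn modn_small //; lia.
- by rewrite -rmorphXn (prim_expr_order z_prim) rmorph1.
- move=> m x h; have m0 : m.+1%:R != 0 :> C by rewrite pnatr_eq0.
  rewrite -[x]mul1r -(rmorph1 sconst) -(mulVf m0) rmorphM rmorph_nat -mulrA h.
  by rewrite mulr0.
Qed.

(** x^(n-1-l) is dual to x^l for the counit, so pairing it with x^k gives the coefficient of x^l in
    x^k modulo x^n - U. *)
Lemma ssphere_red k l : (l < n)%N -> ssphere (k + (n.-1 - l)) = red n Usurf k l.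
Proof.
move=> hl; rewrite ssphereE /red; have kn := ltn_pmod k n_gt0.
rewrite {1 2}(divn_eq k n) -addnA modnMDl divnMDl //.
have [lt|ge] := ltnP (k %% n + (n.-1 - l)) n.
  rewrite (modn_small lt) (divn_small lt) addn0; congr ((nat_of_bool _)%:R * _).
  by apply/eqP/eqP; lia.
have e : (k %% n + (n.-1 - l) = (k %% n + (n.-1 - l) - n) + n)%N by lia.
have -> : ((k %% n + (n.-1 - l)) %% n == n.-1)%N = false.
  by rewrite e modnDr modn_small; lia.
have -> : (k %% n == l)%N = false by lia.
by rewrite !mul0r.
Qed.
End Surfaces.

Lemma fin_ind (P : finType -> Prop) :
  P void -> P unit -> (forall A B : finType, P A -> P B -> P (A + B)%type) ->
  (forall A B : finType, fbij A B -> P A -> P B) -> forall A, P A.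
Proof.
move=> h0 h1 hD hb A; apply: (hb _ _ (bindex A)).
by elim: #|A| => //= k IH; apply: hD.
Qed.

Section Completeness.
Variables (C : numClosedFieldType) (u : option C) (n : nat).
Hypothesis n_gt1 : (1 < n)%N.
Let n_gt0 : (0 < n)%N := ltnW n_gt1.
Notation Cob := (Cob u n).
Notation cls := (cls u n).
Notation hrel := (hrel u n).
Notation hid := (hrel (bid void)).
Notation surfval := (@surfval C u n n_gt1).
Notation U := (Usurf u n_gt1).

Definition capf (A : finType) (f : {ffun A -> 'I_n}) : Cob void A :=
  locked (capm (fun a => capx u n (f a))).
Definition cupf (A : finType) (f : {ffun A -> 'I_n}) : Cob A void :=
  locked (cupm (fun a => cupx u n (n.-1 - f a))).

Lemma capf_nat (A B : finType) (s : fbij A B) f :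
  hrel s ** capf f = capf [ffun b => f (ffrom s b)].
Proof.
rewrite /capf -!lock capm_nat; congr capm; apply/funext => b; by rewrite ffunE.
Qed.
Lemma cupf_nat (A B : finType) (s : fbij A B) f :
  cupf f ** hrel s = cupf [ffun a => f (fto s a)].
Proof.
rewrite /cupf -!lock cupm_nat; congr cupm; apply/funext => b; by rewrite ffunE.
Qed.
Lemma capf_sum (A B : finType) (f : {ffun A + B -> 'I_n}) :
  capf f = (capf [ffun a => f (inl a)] +|+ capf [ffun b => f (inr b)])
           ** hrel (binv (bunit void)).
Proof.
rewrite /capf -!lock capm_sum; congr ((_ +|+ _) ** _); congr capm;
  by apply/funext => b; rewrite ffunE.
Qed.
Lemma cupf_sum (A B : finType) (f : {ffun A + B -> 'I_n}) :
  cupf f = hrel (bunit void) **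
   (cupf [ffun a => f (inl a)] +|+ cupf [ffun b => f (inr b)]).
Proof.
rewrite /cupf -!lock cupm_sum; congr (_ ** (_ +|+ _)); congr cupm;
  by apply/funext => b; rewrite ffunE.
Qed.
Lemma capf_void f : capf (A := void) f = hid.
Proof. by rewrite /capf -lock capm_void. Qed.
Lemma cupf_void f : cupf (A := void) f = hid.
Proof. by rewrite /cupf -lock cupm_void. Qed.
Lemma capf_unit f : capf (A := unit) f = capx u n (f tt).
Proof. by rewrite /capf -lock capm_unit. Qed.
Lemma cupf_unit f : cupf (A := unit) f = cupx u n (n.-1 - f tt).
Proof. by rewrite /cupf -lock cupm_unit. Qed.

Lemma sphere_red k l : (l < n)%N -> sphere u n (n.-1 - l + k) = surfval (red n U k l).
Proof. by move=> hl; rewrite addnC -ssphere_red // surfval_sphere. Qed.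

Lemma cup_cap_sum (A B : finType) (y : Cob A void) (y' : Cob B void)
    (x : Cob void A) (x' : Cob void B) :
  hrel (bunit void) ** (y +|+ y') ** ((x +|+ x') ** hrel (binv (bunit void)))
  = (y ** x) ** (y' ** x').
Proof.
rewrite hcompA -[_ ** (y +|+ y') ** _]hcompA hcomp_hunion; exact: hvoid_union.
Qed.

Lemma cupf_capf (A : finType) (f g : {ffun A -> 'I_n}) :
  cupf g ** capf f = surfval (f == g)%:R.
Proof.
move: A f g; apply: fin_ind => [f g|f g|A B hA hB f g|A B s hA f g].
- by rewrite capf_void cupf_void hcomp_idl (ffun_void f g) eqxx surfval1.
- rewrite capf_unit cupf_unit cup_cap sphere_red ?ltn_ord //.
  rewrite /red modn_small ?ltn_ord // divn_small ?ltn_ord // mulr1.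
  congr (surfval (nat_of_bool _)%:R); apply/eqP/eqP => [h|-> //].
  by apply/ffunP => -[]; apply: val_inj.
- rewrite capf_sum cupf_sum cup_cap_sum hA hB -surfval_mul -natrM mulnb.
  congr (surfval (nat_of_bool _)%:R).
  apply/andP/eqP => [[/eqP/ffunP h /eqP/ffunP h']|-> //].
  by apply/ffunP => -[a|a]; [have := h a|have := h' a]; rewrite !ffunE.
- have -> : capf f = hrel s ** capf [ffun a => f (fto s a)].
    by rewrite capf_nat; congr capf; apply/ffunP=> b; rewrite !ffunE ffromK.
  rewrite hcompA cupf_nat hA; congr (surfval (nat_of_bool _)%:R).
  apply/eqP/eqP => [/ffunP h|-> //]; apply/ffunP=> b.
  by have := h (ffrom s b); rewrite !ffunE ffromK.
Qed.

(** Neck cutting on all circles at once: NC is the case of one circle, and sums and bijections give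
    the rest. *)
Lemma resolution (A : finType) :
  hrel (bid A) = \big[@hadd _ _ _ _ _/h0]_(f : {ffun A -> 'I_n}) (capf f ** cupf f).
Proof.
move: A; apply: fin_ind => [||A B hA hB|A B s hA].
- have hv : {ffun void -> 'I_n} by apply: finfun; case.
  rewrite (big_pred1 hv) => [|f]; last exact/esym/eqP/ffun_void.
  by rewrite capf_void cupf_void hcomp_idl.
- rewrite hNC // (reindex (fun i : 'I_n => [ffun _ : unit => rev_ord i])) /=; last first.
    exists (fun f : {ffun unit -> 'I_n} => rev_ord (f tt)) => [i|f] _.
      by rewrite ffunE rev_ordK.
    by apply/ffunP => -[]; rewrite ffunE rev_ordK.
  apply: eq_bigr => i _; rewrite capf_unit cupf_unit ffunE /=.
  by congr (capx _ _ _ ** cupx _ _ _); have := ltn_ord i; lia.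
- rewrite big_fjoin; transitivity (hrel (bid A) +|+ hrel (bid B)).
    by rewrite hrel_union; apply: eq_hrel => -[].
  rewrite hA hB hunion_suml; apply: eq_bigr => f _.
  rewrite hunion_sumr; apply: eq_bigr => g _.
  rewrite capf_sum cupf_sum !fjoinl !fjoinr -hcomp_hunion.
  rewrite -hcompA [hrel (binv _) ** _]hcompA hrelK.
  by rewrite hcomp_idl.
- have -> : hrel (bid B) = hrel s ** hrel (bid A) ** hrel (binv s).
    by rewrite !hrel_comp; apply: eq_hrel => b /=; rewrite ffromK.
  rewrite hA hcomp_sumr hcomp_suml.
  rewrite [RHS](reindex (fun f : {ffun A -> 'I_n} => [ffun b => f (ffrom s b)])) /=; last first.
    exists (fun f : {ffun B -> 'I_n} => [ffun a => f (fto s a)]) => f _;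
      by apply/ffunP=> x; rewrite !ffunE ?ftoK ?ffromK.
  by apply: eq_bigr => f _; rewrite hcompA capf_nat -hcompA cupf_nat.
Qed.

(* [cupf g] is the dual basis vector of [capf g], since x^i and x^(n-1-i) are dual
   bases for the counit. *)
Lemma closed_eval (A B : finType) (M : mor C A B) f g :
  cupf g ** cls M ** capf f = surfval (ev (@sconst C u n n_gt1) (gens_mono n U) M f g).
Proof.
elim: M f g => /= {A B}.
- move=> A B s f g; rewrite -/(hrel s) -hcompA capf_nat cupf_capf.
  congr (surfval (nat_of_bool _)%:R).
  apply/eqP/forallP => [<- a|h]; first by rewrite ffunE ftoK.
  by apply/ffunP=> b; rewrite ffunE -(eqP (h _)) ffromK.
- move=> f g; rewrite cupf_unit capf_sum !capf_unit !ffunE -/(hmerge u n).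
  set i := f (inl tt); set j := f (inr tt).
  have -> : capx u n i +|+ capx u n j = (capx u n i +|+ hrel (bid unit)) ** (hid +|+ capx u n j).
    by rewrite hcomp_hunion hcomp_idl hcomp_idr.
  rewrite -!hcompA [hmerge u n ** _]hcompA merge_capx // -!hcompA.
  rewrite [hrel (bunit unit) ** _]hcompA hunit -hcompA hrelVK hcomp_idr.
  by rewrite capxE [hdot _ _ i ** _]hcompA -hdotD -capxE cup_cap sphere_red.
- move=> f g; rewrite capf_unit cupf_sum !cupf_unit !ffunE -/(hsplit u n).
  set p := g (inl tt); set q := g (inr tt); set k := f tt.
  have -> : cupx u n (n.-1 - p) +|+ cupx u n (n.-1 - q) =
     (hid +|+ cupx u n (n.-1 - q)) ** (cupx u n (n.-1 - p) +|+ hrel (bid unit)).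
    by rewrite hcomp_hunion hcomp_idl hcomp_idr.
  rewrite !hcompA hunit -![_ ** hsplit u n]hcompA split_cupx // !hcompA.
  rewrite -[_ ** hrel _ ** hrel _]hcompA hrelVK hcomp_idr.
  rewrite -hcompA capxE [hdot _ _ _ ** (_ ** _)]hcompA -hdotD -capxE cup_cap.
  rewrite -sphere_red ?ltn_ord //; congr sphere; lia.
- move=> f g; rewrite capf_void cupf_unit hcomp_idr -/(hcap u n).
  have -> : hcap u n = capx u n 0 by rewrite capxE hcomp_idl.
  rewrite cup_cap sphere_red ?ltn_ord // /red mod0n div0n mulr1.
  by rewrite eq_sym.
- move=> f g; rewrite cupf_void capf_unit hcomp_idl -/(hcup u n).
  have -> : hcup u n = cupx u n 0 by rewrite cupxE hcomp_idr.
  have hn : (n.-1 < n)%N by lia.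
  rewrite cup_cap -[X in sphere _ _ (X + _)](subnn n.-1) (sphere_red _ hn).
  rewrite /red modn_small ?ltn_ord // divn_small ?ltn_ord // mulr1.
  by [].
- move=> f g; rewrite cupf_unit capf_unit.
  have -> : cls Dot = hdot u n 1 by rewrite /hdot /= cls_comp hcomp_idr.
  rewrite -hcompA capxE [hdot _ _ 1 ** _]hcompA -hdotD -capxE cup_cap.
  by rewrite sphere_red.
- move=> A B D N IHN M IHM f g.
  rewrite cls_comp -[cls M]hcomp_idl resolution hcomp_suml !hcomp_sumr hcomp_suml.
  rewrite surfval_sum; apply: eq_bigr => h _.
  by rewrite mulrC surfval_mul -IHN -IHM !hcompA.
- move=> A B A' B' M IHM N IHN f g.
  rewrite cls_union capf_sum cupf_sum -[_ ** (_ +|+ _) ** (cls M +|+ _)]hcompA.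
  by rewrite hcomp_hunion cup_cap_sum IHM IHN surfval_mul.
- by move=> A B f g; rewrite hcomp0r hcomp0l surfval0.
- move=> A B M IHM N IHN f g; rewrite -hadd_cls hcompDr hcompDl IHM IHN.
  by rewrite -surfval_add.
- move=> A B c M IHM f g; rewrite -hscale_cls hcompZr hcompZl IHM surfval_mul.
  by rewrite [surfval (sconst _ _ c)]surfval_const hcompZl hcomp_idl.
Qed.

(** Resolving the identity on both sides writes a morphism as a sum of dotted caps and cups whose
    coefficients are closed surfaces, and by [closed_eval] these are its matrix entries over
    [surf]. *)
Lemma closed_eval_inj (A B : finType) (M N : mor C A B) :
  ev (@sconst C u n n_gt1) (gens_mono n U) M =2
  ev (@sconst C u n n_gt1) (gens_mono n U) N -> eqcob u n M N.
Proof.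
move=> h; apply/clsP.
have E (L : mor C A B) : cls L = \big[@hadd _ _ _ _ _/h0]_g \big[@hadd _ _ _ _ _/h0]_f
    (capf g ** (cupf g ** cls L ** capf f) ** cupf f).
  rewrite -[LHS]hcomp_idl -[cls L in LHS]hcomp_idr !resolution hcomp_suml.
  apply: eq_bigr => g _; rewrite !hcomp_sumr; apply: eq_bigr => f _.
  by rewrite !hcompA.
rewrite (E M) (E N); apply: eq_bigr => g _; apply: eq_bigr => f _.
by rewrite !closed_eval h.
Qed.

(** Agreement at all nonzero t is an equality of polynomial matrices, and this survives the
    substitution of U, an element of [surf] that need not be a scalar. *)
Theorem eqcob_complete (A B : finType) (M N : mor C A B) :
  (forall t, t != 0 -> Fmor (n := n) t M =2 Fmor t N) -> eqcob u n M N.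
Proof.
move=> /(Fpoly_generic n_gt0) h; apply: closed_eval_inj.
have cU : commr_rmorph (@sconst C u n n_gt1) U by move=> x; apply: mulrC.
have E (L : mor C A B) f g : horner_morph cU (Fpoly (n := n) L f g) =
    ev (@sconst C u n n_gt1) (gens_mono n U) L f g.
  have hred k l : horner_morph cU (red n 'X k l) = red n U k l.
    by rewrite /red rmorphM rmorph_nat rmorphXn /= horner_morphX.
  apply: ev_map => [c|i j k|i j k|i|i|i j].
  - exact: horner_morphC.
  - exact: hred.
  - exact: hred.
  - by rewrite rmorph_nat.
  - by rewrite rmorph_nat.
  - exact: hred.
by move=> f g; rewrite -!E h.
Qed.
End Completeness.

(** * Boundary circles and saddles *)

Definition single (T : finType) (a : T) := forall x : T, x = a.
Definition double (T : finType) (a b : T) := a != b /\ forall x : T, x = a \/ x = b.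

Lemma single_of (T : finType) (s : fbij T unit) : single (ffrom s tt).
Proof. by move=> x; rewrite -(ftoK s x); case: (fto s x). Qed.

Lemma double_of (T : finType) (s : fbij T (unit + unit)%type) :
  double (ffrom s (inl tt)) (ffrom s (inr tt)).
Proof.
split; first by rewrite (can_eq (ffromK s)).
by move=> x; rewrite -(ftoK s x); case: (fto s x) => [[]|[]]; [left|right].
Qed.

Section Core.
Variables (C : numClosedFieldType) (n : nat).
Variables (D : gens C n).
Notation ev := (ev idfun D).

(** The dependent matching in [saddle_core] is analysed once, for any structure constants, with the
    affected circles named; the colour, comparison and degree arguments all use this list of
    cases. *)
Variant core_spec (X Y : finType) : ({ffun X -> 'I_n} -> {ffun Y -> 'I_n} -> C) -> Prop :=
| CoreMerge a b y of #|X| = 2%N & #|Y| = 1%N & double a b & single y :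
    core_spec (fun f g => gen_merge D (f a) (f b) (g y))
| CoreSplit x a b of #|X| = 1%N & #|Y| = 2%N & single x & double a b :
    core_spec (fun f g => if odd n then gen_split D (f x) (g a) (g b)
      else \sum_i gen_dot D (f x) i * gen_split D i (g a) (g b))
| CoreOne x y of #|X| = 1%N & #|Y| = 1%N & single x & single y :
    core_spec (fun f g =>
      sqrtC n%:R * ev (dots C n./2) [ffun=> f x] [ffun=> g y])
| CoreOther of ~~ ((#|X| == 2)%N && (#|Y| == 1)%N || (#|X| == 1)%N && (#|Y| == 2)%N
      || (#|X| == 1)%N && (#|Y| == 1)%N) :
    core_spec (fun f g => 0).

Lemma core_ext (X Y : finType) (F F' : {ffun X -> 'I_n} -> {ffun Y -> 'I_n} -> C) :
  core_spec F -> (forall f g, F' f g = F f g) -> core_spec F'.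
Proof.
move=> h e; suff -> : F' = F by [].
by apply/funext => f; apply/funext => g.
Qed.

Lemma ev_conj (A B A' B' : finType) (N : mor C A' B') (a : fbij A A') (b : fbij B B') f g :
  ev (Comp (Relabel (binv b)) (Comp N (Relabel a))) f g =
  ev N [ffun x => f (ffrom a x)] [ffun y => g (ffrom b y)].
Proof. by rewrite /= (sum_ffun_push (binv b)) (sum_ffun_pull a). Qed.

Lemma core_specE (X Y : finType) : core_spec (ev (saddle_core C n X Y)).
Proof.
have cu : #|{: unit}| = 1%N by rewrite card_unit.
have cuu : #|{: unit + unit}| = 2%N by rewrite card_sum !card_unit.
rewrite /saddle_core.
case: (#|X| =P #|{: unit}|) => x1; case: (#|X| =P #|{: unit + unit}|) => x2;
  case: (#|Y| =P #|{: unit}|) => y1; case: (#|Y| =P #|{: unit + unit}|) => y2 /=;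
  try (by exfalso; lia); try (by apply: CoreOther; lia).
- apply: (core_ext (CoreOne _ _ (single_of (bcard x1)) (single_of (bcard y1)))); try lia.
  move=> f g; congr (_ * _); apply: (etrans (ev_conj _ (bcard x1) (bcard y1) f g)).
  by congr ev; apply/ffunP => -[]; rewrite !ffunE.
- apply: (core_ext (CoreSplit _ _ (single_of (bcard x1)) (double_of (bcard y2)))); try lia.
  move=> f g; apply: (etrans (ev_conj _ (bcard x1) (bcard y2) f g)).
  case: (odd n) => /=; first by rewrite !ffunE.
  by rewrite sum_ffun_unit; apply: eq_bigr => i _; rewrite !ffunE.
- apply: (core_ext (CoreMerge _ _ (double_of (bcard x2)) (single_of (bcard y1)))); try lia.
  move=> f g; apply: (etrans (ev_conj Merge (bcard x2) (bcard y1) f g)).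
  by rewrite /= !ffunE.
Qed.

Lemma ev_saddle (G : mgraph) p (S S' : {set circle G}) f g :
  let U := unaffected p S S' in
  let sl := bsplit (unaffected_subl p S S') in
  let sr := bsplit (unaffected_subr p S S') in
  ev (saddle C n p S S') f g =
  [forall a, g (ffrom sr (inl a)) == f (ffrom sl (inl a))]%:R *
  ev (saddle_core C n (elts (S :\: U)) (elts (S' :\: U)))
     [ffun x => f (ffrom sl (inr x))] [ffun y => g (ffrom sr (inr y))].
Proof.
move=> U sl sr; rewrite ev_conj /=; congr (_ * _).
  by congr (nat_of_bool _)%:R; apply: eq_forallb => a; rewrite !ffunE.
by congr ev; apply/ffunP => x; rewrite !ffunE.
Qed.
End Core.

Section CoreColours.
Variables (C : numClosedFieldType) (n : nat).
Hypothesis n_gt1 : (1 < n)%N.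
Let n_gt0 : (0 < n)%N := ltnW n_gt1.
Variables (s z : C).
Hypotheses (s_neq0 : s != 0) (z_prim : n.-primitive_root z).
Notation lam := (lam s z).
Notation evc := (ev idfun (gens_colour n s z)).

Definition kappa (c : 'I_n) : C := sqrtC n%:R * lam c ^+ n./2.

Lemma kappa_neq0 c : kappa c != 0.
Proof.
by rewrite mulf_neq0 ?expf_neq0 ?(lam_neq0 n_gt0 s_neq0 z_prim) // sqrtC_eq0 n_neq0.
Qed.

Lemma kappa2 c : kappa c * kappa c = n%:R * lam c ^+ (n./2).*2.
Proof.
by rewrite mulrACA -expr2 sqrtCK -exprD addnn.
Qed.

Definition wt (X : finType) (f : {ffun X -> 'I_n}) : C := \prod_x kappa (f x).

Lemma wt_single (X : finType) (x : X) (f : {ffun X -> 'I_n}) :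
  single x -> wt f = kappa (f x).
Proof. by move=> h; rewrite /wt (big_pred1 x) // => y; rewrite (h y) /= eqxx. Qed.

Lemma wt_double (X : finType) (a b : X) (f : {ffun X -> 'I_n}) :
  double a b -> wt f = kappa (f a) * kappa (f b).
Proof.
case=> ab h; rewrite /wt (bigD1 a) //= (big_pred1 b) // => y /=.
by case: (h y) => ->; rewrite ?eqxx ?(negbTE ab) // eq_sym ab.
Qed.

(** For odd n the exponent n-1 is already 2m; for even n the dot raises it to n = 2m. In both cases
    the coefficient is n lam^(2m) = kappa^2. *)
Lemma split_colour (k i j : 'I_n) :
  (if odd n then gen_split (gens_colour n s z) k i j
   else \sum_l gen_dot (gens_colour n s z) k l * gen_split (gens_colour n s z) l i j)
  = ((k == i) && (k == j))%:R * (kappa k * kappa k).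
Proof.
rewrite kappa2; case: ifP => odn /=.
  by congr (_ * (_ * _ ^+ _)); lia.
under eq_bigr do rewrite -mulrA.
rewrite sum_eq_r (_ : (n./2).*2 = n.-1.+1); last by lia.
by rewrite exprS; ring.
Qed.

Lemma core_colour (X Y : finType) (x0 : X) f g :
  (#|X| == 2)%N && (#|Y| == 1)%N || (#|X| == 1)%N && (#|Y| == 2)%N
      || (#|X| == 1)%N && (#|Y| == 1)%N ->
  wt f * evc (saddle_core C n X Y) f g =
  [&& [forall x, f x == f x0] & [forall y, g y == f x0]]%:R * (kappa (f x0) * wt g).
Proof.
move=> hXY; case: (core_specE (gens_colour n s z) X Y); last by rewrite hXY.
- move=> a b y _ _ dX sY; rewrite (wt_double _ dX) (wt_single _ sY) /=.
  have -> : [forall y0, g y0 == f x0] = (g y == f x0).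
    by apply/forallP/idP => [//|h y']; rewrite (sY y').
  have -> : [forall x, f x == f x0] = (f a == f b).
    apply/forallP/eqP => [h|h x].
      by rewrite (eqP (h a)) (eqP (h b)).
    by case: dX => _ dX; case: (dX x) => ->; case: (dX x0) => ->; rewrite ?h.
  case: (eqVneq (f a) (f b)) => [ab|ab] /=; last first.
    by case: (eqVneq (f a) (g y)) ab => [->|] ab; rewrite ?mul0r ?mulr0 // eq_sym (negbTE ab) /= mulr0.
  have e0 : f x0 = f a by case: dX => _ dX; case: (dX x0) => ->.
  rewrite e0 -ab andbb eq_sym.
  by case: eqP => [->|_]; rewrite ?mulr1 ?mulr0 ?mul1r ?mul0r.
- move=> x a b _ _ sX dY; rewrite (wt_single _ sX) (wt_double _ dY) split_colour.
  have -> : [forall y0, g y0 == f x0] = (f x == g a) && (f x == g b).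
    rewrite (sX x0); apply/forallP/andP => [h|[/eqP h /eqP h'] y].
      by split; rewrite eq_sym; apply: h.
    by case: dY => _ dY; case: (dY y) => ->; rewrite -?h -?h'.
  have -> : [forall x1, f x1 == f x0] by apply/forallP => x1; rewrite (sX x1) (sX x0).
  rewrite (sX x0) /=; case: eqP => [<-|]; last by rewrite !mul0r mulr0.
  by case: eqP => [<-|]; rewrite ?mul0r ?mulr0 ?mul1r //.
- move=> x y _ _ sX sY; rewrite (wt_single _ sX) (wt_single _ sY) (evc_dots _ _).
  have -> : [forall y0, g y0 == f x0] = (f x == g y).
    by rewrite (sX x0) eq_sym; apply/forallP/idP => [//|h y']; rewrite (sY y').
  have -> : [forall x1, f x1 == f x0] by apply/forallP => x1; rewrite (sX x1) (sX x0).
  rewrite (sX x0) !ffunE /=; case: eqP => [<-|]; last by rewrite !(mul0r, mulr0).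
  by rewrite !mul1r.
Qed.
End CoreColours.

Lemma even_card_involution (T : finType) (A : {set T}) (h : T -> T) :
  {in A, forall x, [/\ h x \in A, h (h x) = x & h x != x]} -> ~~ odd #|A|.
Proof.
have [m] := ubnP #|A|; elim: m A => // m IH A hm hA.
have [->|[x xA]] := set_0Vmem A; first by rewrite cards0.
have [hx hhx nx] := hA x xA.
have xA' : h x \in A :\ x by rewrite !inE nx.
have cA : #|A| = #|A :\ x :\ h x|.+2.
  by rewrite (cardsD1 x A) xA (cardsD1 (h x)) xA'.
rewrite cA /= negbK; apply: IH; first by lia.
move=> y; rewrite !inE => /and3P[y1 y2 yA]; have [k1 k2 k3] := hA y yA.
split=> //; rewrite k1 andbT; apply/andP; split.
  by apply: contraNneq y2 => e; rewrite -k2 e hhx.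
by apply: contraNneq y1 => e; rewrite -e k2.
Qed.

(** * Boundary circles, and the effect of flipping one band *)

Section Geometry.
Variables (G : mgraph) (Ga : ribbon G).
Implicit Types al be : {ffun 'I_(nedges G) -> bool}.
Notation cor := (corner Ga).

Lemma alongK al : involutive (along (G := G) al).
Proof. by case=> [[e b] s]; rewrite /along /= negbK addbK. Qed.

Lemma along_neq al x : along al x != x.
Proof. by case: x => [[e b] s]; apply/eqP => -[] /(congr1 (addb b)); rewrite addbN addbb. Qed.

Lemma fedge_along al x : fedge (along al x) = fedge x. Proof. by []. Qed.

Notation conn al := (connect (bdry_step Ga al)).

Lemma bdry_sym al : connect_sym (bdry_step Ga al).
Proof.
apply: sym_connect_sym => x y /=.
by apply/orP/orP => -[] /eqP ->; rewrite ?cornerK ?alongK ?eqxx; [left|right|left|right].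
Qed.

Lemma conn_corner al x : conn al x (cor x).
Proof. by apply: connect1; rewrite /bdry_step /= eqxx. Qed.
Lemma conn_along al x : conn al x (along al x).
Proof. by apply: connect1; rewrite /bdry_step /= eqxx orbT. Qed.

Lemma conn_ind al (P : flag G -> Prop) x y :
  conn al x y -> P x -> (forall w, P w -> P (cor w)) ->
  (forall w, conn al x w -> P w -> P (along al w)) -> P y.
Proof.
move=> xy Px Pc Pa.
have /connectP[q] := xy.
elim/last_ind: q y xy => [|q w IH] y xy; first by move=> _ ->.
rewrite rcons_path last_rcons => /andP[pq /orP[]] /eqP e ew; subst y w.
  by apply: Pc; apply: IH => //; apply/connectP; exists q.
by apply: Pa; [|apply: IH => //]; apply/connectP; exists q.
Qed.

Lemma conn_const (T : Type) al (f : flag G -> T) x y :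
  (forall w, f (cor w) = f w) -> (forall w, f (along al w) = f w) ->
  conn al x y -> f x = f y.
Proof.
move=> fc fa xy; apply: (conn_ind (P := fun y => f x = f y) xy) => // w.
  by rewrite fc.
by rewrite fa.
Qed.

Definition isolated (v : verts G) := [forall x : flag G, fvert x != v].
(** This set does not depend on [al] and maps onto the circles of every state, which is what allows
    colourings of different states to be compared. *)
Definition germ : finType := (flag G + {v : verts G | isolated v})%type.

Definition circ_val al (w : germ) : circle G :=
  match w with
  | inl x => inl [set y | conn al x y]
  | inr v => inr (val v)
  end.

Lemma circ_in al w : circ_val al w \in state Ga al.
Proof.
rewrite inE; apply/orP; case: w => [x|v]; [left|right]; apply/imsetP.
  by exists x.
by exists (val v) => //; rewrite inE; exact: (valP v).
Qed.

Definition circ al w : elts (state Ga al) := exist _ (circ_val al w) (circ_in al w).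

Lemma circ_valP al c : c \in state Ga al -> exists w, c = circ_val al w.
Proof.
rewrite inE => /orP[] /imsetP[x hx ->]; first by exists (inl x).
by rewrite inE in hx; exists (inr (exist _ x hx)).
Qed.

Lemma circ_surj al (c : elts (state Ga al)) : exists w, c = circ al w.
Proof.
have [w e] := circ_valP (valP c); exists w; exact: val_inj.
Qed.

Lemma circ_eq al x y : (circ_val al (inl x) = circ_val al (inl y)) <-> conn al x y.
Proof.
split=> [[/setP/(_ y)]|xy]; first by rewrite !inE connect0.
congr inl; apply/setP=> w; rewrite !inE; exact: (same_connect (@bdry_sym al)).
Qed.

Lemma circ_corner al x : circ al (inl (cor x)) = circ al (inl x).
Proof. by apply: val_inj; apply/circ_eq; rewrite bdry_sym conn_corner. Qed.
Lemma circ_along al x : circ al (inl (along al x)) = circ al (inl x).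
Proof. by apply: val_inj; apply/circ_eq; rewrite bdry_sym conn_along. Qed.

Lemma passes_conn al p x :
  reflect (exists2 y, conn al x y & fedge y = p) (passes p (circ_val al (inl x))).
Proof.
apply: (iffP existsP) => [[y /andP[]]|[y xy e]].
  by rewrite inE => xy /eqP e; exists y.
by exists y; rewrite inE xy e eqxx.
Qed.

Definition agree_off p al be := forall q, q != p -> al q = be q.

Lemma agree_sym p al be : agree_off p al be -> agree_off p be al.
Proof. by move=> h q /h. Qed.

Lemma along_off p al be x : agree_off p al be -> fedge x != p -> along al x = along be x.
Proof. by move=> h hx; rewrite /along (h _ hx). Qed.

Section Flip.
Variables (p : 'I_(nedges G)) (al be : {ffun 'I_(nedges G) -> bool}).
Hypothesis ab : agree_off p al be.

Lemma circ_off w : ~~ passes p (circ_val al w) -> circ_val be w = circ_val al w.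
Proof.
case: w => [x|//] hx.
have np y : conn al x y -> fedge y != p.
  by move=> xy; apply: contra hx => /eqP e; apply/passes_conn; exists y.
congr inl; apply/setP=> y; rewrite !inE; apply/idP/idP => xy.
  apply: (conn_ind (P := fun y => conn al x y) xy) => // [w h|w _ h].
    exact: connect_trans h (conn_corner _ _).
  by rewrite -(along_off ab (np _ h)); apply: connect_trans h (conn_along _ _).
apply: (conn_ind (P := fun y => conn be x y) xy) => // [w h|w h h'].
  exact: connect_trans h (conn_corner _ _).
by rewrite (along_off ab (np _ h)); apply: connect_trans h' (conn_along _ _).
Qed.
End Flip.

Section Flip2.
Variables (p : 'I_(nedges G)) (al be : {ffun 'I_(nedges G) -> bool}).
Hypothesis ab : agree_off p al be.
Notation S := (state Ga al).
Notation S' := (state Ga be).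

Lemma passes_off w : passes p (circ_val be w) = passes p (circ_val al w).
Proof.
case: (boolP (passes p (circ_val al w))) => h; last by rewrite (circ_off ab h) (negbTE h).
apply/negPn/negP => h'.
by move: h; rewrite (circ_off (agree_sym ab) h') (negbTE h').
Qed.

Lemma in_unaffected w : (circ_val al w \in unaffected p S S') = ~~ passes p (circ_val al w).
Proof.
rewrite /unaffected in_set in_setI circ_in /=; case: (boolP (passes p _)) => h; rewrite ?andbF // andbT.
by rewrite -(circ_off ab h) circ_in.
Qed.

Lemma unaffectedC : unaffected p S' S = unaffected p S S'.
Proof. by rewrite /unaffected setIC. Qed.
End Flip2.

Definition pf p b s : flag G := (p, b, s).

Definition off_step p al : rel (flag G) :=
  [rel x y | (y == cor x) || (fedge x != p) && (y == along al x)].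

Lemma off_sub p al be x y : agree_off p al be ->
  connect (off_step p al) x y -> conn be x y.
Proof.
move=> h; apply: connect_sub => {}x {}y /= /orP[/eqP ->|/andP[hx /eqP ->]].
  exact: conn_corner.
by rewrite (along_off h hx) conn_along.
Qed.

(* The part of a boundary circle cut off by the band of [p] contains evenly many
   ends of the two free sides of the band. *)
Lemma off_even p al x :
  ~~ odd #|[set y | connect (off_step p al) x y && (fedge y == p)]|.
Proof.
set R := [set y | connect (off_step p al) x y].
have Rc y : y \in R -> cor y \in R.
  rewrite !inE => h; apply: connect_trans h _; apply: connect1.
  by rewrite /off_step /= eqxx.
have eR : ~~ odd #|R|.
  apply: (@even_card_involution _ _ cor) => y yR.
  by rewrite Rc // cornerK corner_neq.
have eR' : ~~ odd #|R :\: [set y | fedge y == p]|.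
  apply: (@even_card_involution _ _ (along al)) => y.
  rewrite !inE => /andP[yp yR]; rewrite alongK along_neq; split=> //.
  rewrite fedge_along yp /=; apply: connect_trans yR _; apply: connect1.
  by rewrite /off_step /= yp eqxx orbT.
move: eR; rewrite -(cardsID [set y | fedge y == p]) oddD (negbTE eR') addbF.
by congr (~~ odd _); apply: eq_card => y; rewrite !inE.
Qed.

(* At most one of the two positions of the band of [p] has two circles through
   it: a free arc ending at one corner of the band ends at another corner. *)
Lemma conn_flip p al be : agree_off p al be -> be p = ~~ al p ->
  ~~ conn al (pf p false false) (pf p false true) ->
  conn be (pf p false false) (pf p false true).
Proof.
move=> ab bp nc.
(* [y] is the corner joined by a free side of the band to (p, false, true) under [al] and to (p,
   false, false) under [be]. If [al] separates these two corners, the part [T] starting at the first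
   can only contain [y] besides, and parity puts [y] in it. *)
pose y := pf p true (~~ al p).
have ay : along al (pf p false true) = y by rewrite /along /y /pf /=.
have by_ : along be (pf p false false) = y by rewrite /along /y /pf /= bp.
set T := [set w | connect (off_step p al) (pf p false true) w && (fedge w == p)].
have sub w : w \in T -> (w == pf p false true) || (w == y).
  rewrite inE => /andP[h /eqP e]; have {}h := off_sub (fun q _ => erefl) h.
  apply/negPn/negP; rewrite negb_or => /andP[n1 n2]; case/negP: nc.
  case: w h e n1 n2 => [[q b] s] h; rewrite /fedge /= => e n1 n2; subst q.
  have a0 : along al (pf p false false) = pf p true (al p) by rewrite /along /pf /=.
  rewrite bdry_sym; apply: connect_trans h _.
  case: b n1 n2 => n1 n2.
    have -> : s = al p.
      by move: n2; rewrite /y /pf; case: (s); case: (al p) => //; rewrite eqxx.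
    by rewrite -/(pf p true _) -a0 bdry_sym conn_along.
  have -> : s = false by case: s n1 {n2} => //; rewrite eqxx.
  exact: connect0.
have pT : pf p false true \in T by rewrite inE connect0 /= eqxx.
have yT : y \in T.
  apply/negPn/negP => ny; have := off_even p al (pf p false true); rewrite -/T.
  suff -> : T = [set pf p false true] by rewrite cards1.
  apply/setP=> w; rewrite inE; apply/idP/eqP => [wT|-> //].
  by case/orP: (sub w wT) => /eqP e //; rewrite -e wT in ny.
have h : conn be (pf p false true) y.
  by move: yT; rewrite inE => /andP[h _]; apply: off_sub ab h.
apply: connect_trans (conn_along be _) _; rewrite by_ bdry_sym; exact: h.
Qed.
End Geometry.

Definition mkelt (T : finType) (S : {set T}) (x : T) (h : x \in S) : elts S :=
  exist (fun y => y \in S) x h.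

Section Affected.
Variables (G : mgraph) (Ga : ribbon G).
Variables (p : 'I_(nedges G)) (al be : {ffun 'I_(nedges G) -> bool}).
Hypotheses (ab : agree_off p al be).
Notation S := (state Ga al).
Notation S' := (state Ga be).
Notation U := (unaffected p S S').

Lemma passes_pf ga b s : passes p (circ_val Ga ga (inl (pf p b s))).
Proof. by apply/passes_conn; exists (pf p b s); rewrite ?connect0. Qed.

Lemma affectedP c : c \in S :\: U -> passes p c.
Proof.
rewrite inE => /andP[cU cS]; have [w e] := circ_valP cS.
by move: cU; rewrite e (in_unaffected Ga ab) negbK.
Qed.

Lemma passes_affected c : c \in S -> passes p c -> c \in S :\: U.
Proof.
move=> cS cp; rewrite inE cS andbT; have [w e] := circ_valP cS.
by rewrite e (in_unaffected Ga ab) -e negbK.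
Qed.

(** Of the four corners of the band, the two at the end [true] are joined by its free sides to those
    at the end [false], so the latter meet every affected circle. *)
Lemma affectedE : S :\: U =
  [set circ_val Ga al (inl (pf p false false)); circ_val Ga al (inl (pf p false true))].
Proof.
apply/setP=> c; rewrite in_set2; apply/idP/orP => [h|].
  have cp := affectedP h; have := h; rewrite inE => /andP[_ /circ_valP[[x|v] e]]; last by rewrite e in cp.
  move: cp; rewrite e => /passes_conn[[[q b] s] xy eq]; rewrite /fedge /= in eq; subst q.
  have {e xy} e : circ_val Ga al (inl x) = circ_val Ga al (inl (pf p b s)).
    exact/circ_eq.
  case: b e => e.
    have e' : circ_val Ga al (inl (pf p true s)) = circ_val Ga al (inl (pf p false (s (+) al p))).
      by apply/circ_eq; apply: (conn_along Ga al (pf p true s)).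
    by rewrite e e'; case: (s (+) al p); [right|left].
  by rewrite e; case: s {e}; [right|left].
by case=> /eqP ->; apply: passes_affected (passes_pf _ _ _); apply: circ_in.
Qed.

Lemma affected_flag c : c \in S :\: U -> exists t, c = circ_val Ga al (inl (pf p false t)).
Proof. by rewrite affectedE in_set2 => /orP[] /eqP ->; [exists false|exists true]. Qed.

Lemma card_affected :
  #|elts (S :\: U)| = (~~ connect (bdry_step Ga al) (pf p false false) (pf p false true)).+1.
Proof.
rewrite card_sig -[LHS](eq_card (A := S :\: U)) => [|c]; last by rewrite !inE.
rewrite affectedE cards2; congr (nat_of_bool _).+1; congr negb.
by apply/eqP/idP => /circ_eq.
Qed.
End Affected.

(** Each side has one or two affected circles, and [conn_flip] excludes two on both sides; the
    default [Zero] of [saddle_core] is never reached. *)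
Lemma card_affected_flip (G : mgraph) (Ga : ribbon G) p (al be : {ffun 'I_(nedges G) -> bool}) :
  agree_off p al be -> be p = ~~ al p ->
  let S := state Ga al in let S' := state Ga be in let U := unaffected p S S' in
  (#|elts (S :\: U)| == 2)%N && (#|elts (S' :\: U)| == 1)%N
  || (#|elts (S :\: U)| == 1)%N && (#|elts (S' :\: U)| == 2)%N
  || (#|elts (S :\: U)| == 1)%N && (#|elts (S' :\: U)| == 1)%N.
Proof.
move=> ab bp /=; rewrite card_affected // -unaffectedC card_affected; last exact: agree_sym.
case: (boolP (connect _ _ _)) => h /=; first by case: (connect _ _ _).
by rewrite (conn_flip ab bp h).
Qed.

Section SaddleColours.
Variables (C : numClosedFieldType) (n : nat).
Hypothesis n_gt1 : (1 < n)%N.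
Let n_gt0 : (0 < n)%N := ltnW n_gt1.
Variables (s z : C).
Hypotheses (s_neq0 : s != 0) (z_prim : n.-primitive_root z).
Notation evc := (ev idfun (gens_colour n s z)).
Notation kappa := (@kappa C n s z).
Notation wt := (@wt C n s z _).
Variables (G : mgraph) (Ga : ribbon G).
Implicit Types al be ga : {ffun 'I_(nedges G) -> bool}.

Definition compat al be (f : {ffun elts (state Ga al) -> 'I_n})
    (g : {ffun elts (state Ga be) -> 'I_n}) : bool :=
  [forall w : germ G, f (circ Ga al w) == g (circ Ga be w)].

(** A free side for [al] and one for [be] end at the same corner of the opposite end. Colours that
    agree in both states are thus constant on the band. *)
Lemma compat_pf p al be f g x y : be p = ~~ al p -> @compat al be f g ->
  f (circ Ga al (inl (pf p false x))) = f (circ Ga al (inl (pf p false y))).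
Proof.
move=> bp /forallP h.
have e1 : along al (pf p false false) = along be (pf p false true).
  by rewrite /along /pf /= bp; case: (al p).
suff e : f (circ Ga al (inl (pf p false false))) = f (circ Ga al (inl (pf p false true))).
  by case: x; case: y.
rewrite -circ_along (eqP (h _)) e1 circ_along -(eqP (h _)).
by [].
Qed.

Lemma wt_bij (T A B : finType) (b : fbij T (A + B)%type) (f : {ffun T -> 'I_n}) :
  wt f = (\prod_a kappa (f (ffrom b (inl a)))) * wt [ffun x => f (ffrom b (inr x))].
Proof.
rewrite /wt (reindex (ffrom b)) /=; last first.
  by exists (fto b) => x _; rewrite ?ftoK ?ffromK.
by rewrite big_sumType /=; congr (_ * _); apply: eq_bigr => x _; rewrite ffunE.
Qed.

(* A fusion has coefficient 1, a one-to-one saddle [kappa] and a splitting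
   [kappa ^ 2 = n * lam ^ (2m)]; rescaling the colourings by [wt] turns all three
   into [kappa]. *)
Lemma saddle_colour p al be f g : agree_off p al be -> be p = ~~ al p ->
  wt f * evc (saddle C n p (state Ga al) (state Ga be)) f g =
  (@compat al be f g)%:R * (kappa (f (circ Ga al (inl (pf p false false)))) * wt g).
Proof.
move=> ab bp; set S := state Ga al; set S' := state Ga be; set U := unaffected p S S'.
have ba := agree_sym ab.
rewrite ev_saddle; set sl := bsplit (unaffected_subl p S S').
set sr := bsplit (unaffected_subr p S S').
rewrite (wt_bij sl f) (wt_bij sr g).
set fD := finfun _; set gD := finfun _.
have x0S : circ_val Ga al (inl (pf p false false)) \in S :\: U.
  by apply: passes_affected => //; [exact: circ_in | exact: passes_pf].
pose x0 : elts (S :\: U) := mkelt x0S.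
have fx0 : fD x0 = f (circ Ga al (inl (pf p false false))).
  by rewrite ffunE; congr (f _); apply: val_inj.
have := core_colour n_gt1 s_neq0 z_prim x0 fD gD (card_affected_flip Ga ab bp).
rewrite -/U -/S -/S' fx0 => core.
set c0 := f (circ Ga al (inl (pf p false false))) in core fx0 *.
rewrite mulrACA core.
(* Compatibility splits into equality on the unaffected circles and the single colour [c0] on all
   affected ones, the two factors found in the matrix. *)
suff E : @compat al be f g =
    [forall a, g (ffrom sr (inl a)) == f (ffrom sl (inl a))] &&
    ([forall x, fD x == c0] && [forall y, gD y == c0]).
  rewrite E; case: forallP => [h|_] /=; last by rewrite mulr0 !mul0r.
  rewrite mulr1 mulrCA; congr (_ * _); rewrite mulrCA; congr (_ * (_ * _)).
  by apply: eq_bigr => a _; rewrite -(eqP (h a)).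
apply/idP/and3P => [cfg|[/forallP hU /forallP hf /forallP hg]].
  have /forallP h := cfg; split; apply/forallP.
  - move=> a; have aU := valP a; have aS : val a \in S by move: aU; rewrite !in_set => /andP[/andP[]].
    have [w e] := circ_valP aS.
    have np : ~~ passes p (circ_val Ga al w) by rewrite -(in_unaffected Ga ab) -e.
    have -> : ffrom sl (inl a) = circ Ga al w by apply: val_inj.
    have -> : ffrom sr (inl a) = circ Ga be w.
      by apply: val_inj; rewrite /= (circ_off ab np) -e.
    by rewrite eq_sym; apply: h.
  - move=> x; rewrite ffunE; have [t e] := affected_flag ab (valP x).
    have -> : ffrom sl (inr x) = circ Ga al (inl (pf p false t)) by apply: val_inj.
    by rewrite (compat_pf _ false bp cfg).
  - move=> x; rewrite ffunE; have xS : val x \in S' :\: unaffected p S' S.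
      by rewrite [unaffected p S' S]unaffectedC; apply: valP x.
    have [t e] := affected_flag ba xS.
    have -> : ffrom sr (inr x) = circ Ga be (inl (pf p false t)) by apply: val_inj.
    by rewrite -(eqP (h _)) (compat_pf _ false bp cfg).
apply/forallP=> w; case: (boolP (passes p (circ_val Ga al w))) => hw.
  have wS : circ_val Ga al w \in S :\: U by apply: passes_affected => //; apply: circ_in.
  have wS' : circ_val Ga be w \in S' :\: U.
    rewrite /U -unaffectedC; apply: passes_affected => //; first exact: circ_in.
    by rewrite (passes_off Ga ab).
  have := hf (mkelt wS); have := hg (mkelt wS'); rewrite !ffunE.
  have -> : ffrom sr (inr (mkelt wS')) = circ Ga be w by apply: val_inj.
  have -> : ffrom sl (inr (mkelt wS)) = circ Ga al w by apply: val_inj.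
  by move=> /eqP -> /eqP ->.
have wU : circ_val Ga al w \in U by rewrite in_unaffected.
have := hU (mkelt wU).
have -> : ffrom sl (inl (mkelt wU)) = circ Ga al w by apply: val_inj.
have -> : ffrom sr (inl (mkelt wU)) = circ Ga be w.
  by apply: val_inj; rewrite /= (circ_off ab hw).
by rewrite eq_sym.
Qed.
End SaddleColours.

(** * Edge signs of the cube *)

Section CubeSigns.
Variables (C : numClosedFieldType) (G : mgraph).
Implicit Types al be ga : {ffun 'I_(nedges G) -> bool}.

Definition turn_on al p : {ffun 'I_(nedges G) -> bool} :=
  [ffun q => if q == p then true else al q].

Lemma flip01E al be p : flip01 al be p = ~~ al p && (be == turn_on al p).
Proof. by []. Qed.

Lemma flip01_uniq al be p q : flip01 al be p -> flip01 al be q -> p = q.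
Proof.
rewrite !flip01E => /andP[pn /eqP ->] /andP[qn /eqP/ffunP/(_ q)].
by rewrite !ffunE eqxx; case: eqP => [->//|_ e]; rewrite e in qn.
Qed.

Lemma flip01_agree al be p : flip01 al be p -> agree_off p al be /\ be p = ~~ al p.
Proof.
rewrite flip01E => /andP[pn /eqP ->]; split; last by rewrite ffunE eqxx pn.
by move=> q /negbTE qp; rewrite ffunE qp.
Qed.

Definition esgn al be : C :=
  if [pick p | flip01 al be p] is Some p then edge_sign C al p else 0.

Lemma esgnE al be p : flip01 al be p -> esgn al be = edge_sign C al p.
Proof.
move=> h; rewrite /esgn; case: pickP => [q hq|/(_ p)]; last by rewrite h.
by rewrite (flip01_uniq hq h).
Qed.

Lemma esgn_sum al be :
  esgn al be = \sum_p (flip01 al be p)%:R * edge_sign C al p.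
Proof.
case: (pickP (flip01 al be)) => [p h|h].
  rewrite (esgnE h) (sum_bool (a := p)) ?h ?mul1r // => q qp.
  case: (boolP (flip01 al be q)) => hq; last by rewrite mul0r.
  by rewrite (flip01_uniq hq h) eqxx in qp.
rewrite /esgn; case: pickP => [q|_]; first by rewrite h.
by rewrite big1 // => p _; rewrite h mul0r.
Qed.

Lemma weight_turn_on al p : ~~ al p -> weight (turn_on al p) = (weight al).+1.
Proof.
move=> pn; rewrite /weight (bigD1 p) //= ffunE eqxx [in RHS](bigD1 p) //= (negbTE pn).
by congr _.+1; apply: eq_bigr => q /negbTE qp; rewrite ffunE qp.
Qed.

Lemma flip01_weight al be p : flip01 al be p -> weight be = (weight al).+1.
Proof. by rewrite flip01E => /andP[pn /eqP ->]; apply: weight_turn_on. Qed.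

Lemma esgn_weight al be : weight be != (weight al).+1 -> esgn al be = 0.
Proof.
by move=> h; rewrite /esgn; case: pickP => // p /flip01_weight e; rewrite e eqxx in h.
Qed.

(** Sums over a layer of the cube become sums over all twistings, which can be reindexed freely. *)
Lemma sum_cube_vertex i (F : {ffun 'I_(nedges G) -> bool} -> C) :
  (forall be, weight be != i -> F be = 0) ->
  \sum_(b : cube_vertex G i) F (val b) = \sum_be F be.
Proof.
move=> h; rewrite [RHS](bigID (fun be => weight be == i)) /= [X in _ + X]big1 ?addr0 //.
rewrite [RHS](reindex_omap (val : cube_vertex G i -> _) insub) /=; last first.
  by move=> be hb; rewrite insubT.
by apply: eq_bigl => b; rewrite (valP b) valK eqxx.
Qed.

Lemma edge_sign_turn_on al p q : ~~ al p ->
  edge_sign C (turn_on al p) q = (-1) ^+ (p < q)%N * edge_sign C al q.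
Proof.
move=> pn; rewrite /edge_sign -exprD; congr (_ ^+ _).
case: (boolP (p < q)%N) => pq.
  rewrite (bigD1 p) //= ffunE eqxx [in RHS](bigD1 p) //= (negbTE pn) add0n.
  by congr (_ + _)%N; apply: eq_bigr => r /andP[_ /negbTE rp]; rewrite ffunE rp.
rewrite add0n; apply: eq_bigr => r rq; rewrite ffunE; case: eqP => // rp.
by rewrite -rp rq in pq.
Qed.

Lemma esgn_esgn al ga : \sum_be esgn al be * esgn be ga = 0.
Proof.
pose T p q : C := (~~ al p && flip01 (turn_on al p) ga q)%:R *
   (edge_sign C al p * edge_sign C (turn_on al p) q).
have -> : \sum_be esgn al be * esgn be ga = \sum_p \sum_q T p q.
  under eq_bigr => be _.
    rewrite !esgn_sum mulr_suml; under eq_bigr do rewrite mulr_sumr.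
    over.
  rewrite exchange_big /=; apply: eq_bigr => p _.
  rewrite exchange_big /=; apply: eq_bigr => q _.
  rewrite (sum_bool (a := turn_on al p)) => [|be /negbTE bp]; last first.
    by rewrite flip01E bp andbF !mul0r.
  by rewrite /T [in LHS]flip01E eqxx andbT -mulnb natrM; ring.
(* Exchanging the order of the two flips gives X = -X for the total, and 2 is invertible. *)
suff anti p q : T p q = - T q p.
  set X := \sum_p _; suff : X = - X.
    move/eqP; rewrite -subr_eq0 opprK -mulr2n mulrn_eq0 /= => /eqP //.
  rewrite {2}/X exchange_big /= -sumrN; apply: eq_bigr => p _.
  by rewrite -sumrN; apply: eq_bigr => q _; apply: anti.
have swap r t : turn_on (turn_on al r) t = turn_on (turn_on al t) r.
  by apply/ffunP=> x; rewrite !ffunE; case: eqP => //; case: eqP.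
rewrite /T !flip01E !ffunE eq_sym.
case: (eqVneq p q) => [->|pq]; first by rewrite !andbF !mul0r oppr0.
case: (boolP (al p)) => ap; rewrite ?andbF /= ?mul0r ?oppr0 //.
case: (boolP (al q)) => aq; rewrite ?andbF /= ?mul0r ?oppr0 //.
rewrite swap; case: eqP => _; rewrite ?mul0r ?oppr0 // !mul1r.
rewrite !edge_sign_turn_on //.
have [lt|ge] := ltnP p q.
  by rewrite ltnNge (ltnW lt) /= expr1 expr0; ring.
have -> : (q < p)%N by rewrite ltn_neqAle ge andbT eq_sym; exact: pq.
by rewrite expr1 expr0; ring.
Qed.
End CubeSigns.

(** * Commuting faces of the cube in the colour basis *)

Section CubeColours.
Variables (C : numClosedFieldType) (n : nat).
Hypothesis n_gt1 : (1 < n)%N.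
Let n_gt0 : (0 < n)%N := ltnW n_gt1.
Variables (s z : C).
Hypotheses (s_neq0 : s != 0) (z_prim : n.-primitive_root z).
Notation evc := (ev idfun (gens_colour n s z)).
Notation kappa := (@kappa C n s z).
Notation wt := (@wt C n s z _).
Notation esgn := (@esgn C _).
Variables (G : mgraph) (Ga : ribbon G).
Implicit Types al be ga : {ffun 'I_(nedges G) -> bool}.

Lemma wt_neq0 (X : finType) (f : {ffun X -> 'I_n}) : wt f != 0.
Proof. by apply/prodf_neq0 => x _; apply: kappa_neq0. Qed.

Definition kdiff al be (f : {ffun elts (state Ga al) -> 'I_n}) : C :=
  \prod_(r | al r != be r) kappa (f (circ Ga al (inl (pf r false false)))).

(** Defined for every pair of states and not only for edges, so that a composite of two edges has
    again this form and depends on its ends alone. *)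
Definition unsigned_edge al be (f : {ffun elts (state Ga al) -> 'I_n})
    (g : {ffun elts (state Ga be) -> 'I_n}) : C :=
  (@compat n G Ga al be f g)%:R * (kdiff be f * (wt g / wt f)).

Lemma edge_colour al be f g :
  evc (cube_edge C n Ga al be) f g = esgn al be * @unsigned_edge al be f g.
Proof.
rewrite /cube_edge /esgn; case: pickP => [p h|_]; last by rewrite mul0r.
have [ab bp] := flip01_agree h.
rewrite -[LHS]/(edge_sign C al p * evc (saddle C n p (state Ga al) (state Ga be)) f g).
congr (_ * _).
have := saddle_colour n_gt1 s_neq0 z_prim f g ab bp.
move/(congr1 (fun x => (wt f)^-1 * x)); rewrite mulKf ?wt_neq0 // => ->.
rewrite /unsigned_edge /kdiff (big_pred1 p) => [|q /=]; last first.
  case: (eqVneq q p) => [->|qp]; first by rewrite bp; case: (al p).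
  by rewrite (ab _ qp) eqxx.
ring.
Qed.

Definition between al be ga := forall r, be r = al r \/ be r = ga r.

(** Every free side of a band in [be] is one in [al] or in [ga], and the common colour is constant
    along both; it therefore descends to the circles of [be]. *)
Lemma compat_between al be ga f g : between al be ga ->
  @compat n G Ga al ga f g -> exists h, @compat n G Ga al be f h.
Proof.
move=> btw /forallP c.
have inv w w' : circ Ga be w = circ Ga be w' -> f (circ Ga al w) = f (circ Ga al w').
  move=> e; have {e} : circ_val Ga be w = circ_val Ga be w' by rewrite -[LHS]/(val (circ Ga be w)) e.
  case: w w' => [x|v] [y|v'] // => [/circ_eq|[] /val_inj -> //].
  apply: (conn_const (f := fun x => f (circ Ga al (inl x)))) => w.
    by rewrite circ_corner.
  case: (btw (fedge w)) => e.
    by rewrite (_ : along be w = along al w) ?circ_along // /along e.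
  rewrite (_ : along be w = along ga w); last by rewrite /along e.
  by rewrite (eqP (c _)) circ_along -(eqP (c _)).
have sur (c' : elts (state Ga be)) : exists w, circ Ga be w == c'.
  by have [w ->] := circ_surj c'; exists w.
exists [ffun c' => f (circ Ga al (xchoose (sur c')))].
apply/forallP=> w; rewrite ffunE; apply/eqP/inv.
by rewrite (eqP (xchooseP (sur _))).
Qed.

Lemma compat_uniq al be f h h' :
  @compat n G Ga al be f h -> @compat n G Ga al be f h' -> h = h'.
Proof.
move=> /forallP c /forallP c'; apply/ffunP=> x; have [w ->] := circ_surj x.
by rewrite -(eqP (c w)) (eqP (c' w)).
Qed.

Lemma compat_trans al be ga f h g :
  @compat n G Ga al be f h -> @compat n G Ga be ga h g = @compat n G Ga al ga f g.
Proof.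
by move=> /forallP c; apply: eq_forallb => w; rewrite (eqP (c w)).
Qed.

(** The intermediate colouring exists and is unique, the weights telescope, and the flipped bands of
    the two steps partition those of the composite. Both ways round a face thus give the same
    value. *)
Lemma unsigned_comp al be ga f g : between al be ga ->
  (forall r, (al r != ga r) = (al r != be r) (+) (be r != ga r)) ->
  \sum_h @unsigned_edge al be f h * @unsigned_edge be ga h g
  = @unsigned_edge al ga f g.
Proof.
move=> btw diff.
case: (boolP (compat f g)) => cfg; last first.
  rewrite {3}/unsigned_edge (negbTE cfg) mul0r big1 // => h _.
  rewrite /unsigned_edge; case: (boolP (compat f h)) => cfh; last by rewrite !mul0r.
  by rewrite (compat_trans g cfh) (negbTE cfg) !mul0r mulr0.
have [h cfh] := compat_between btw cfg.
rewrite (sum_bool (a := h)) => [|h' /eqP ne]; last first.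
  rewrite /unsigned_edge; case: (boolP (compat f h')) => c; last by rewrite !mul0r.
  by case: ne; apply: compat_uniq c cfh.
rewrite /unsigned_edge cfh (compat_trans g cfh) cfg !mul1r.
have -> : kdiff ga f = kdiff be f * kdiff ga h.
  rewrite /kdiff [LHS](bigID (fun r => al r != be r)) /=; congr (_ * _).
    apply: eq_bigl => r; case: (btw r) => e; rewrite e ?eqxx ?andbF ?andbT //.
    by rewrite andbb.
  apply: eq_big => [r|r _]; last by rewrite (eqP (forallP cfh _)).
  by have := diff r; case: (btw r) => e; rewrite e ?eqxx ?andbT ?andbF // addbF; case: (_ == _).
have := wt_neq0 f; have := wt_neq0 h; set a := wt h; set b := wt f => a0 b0.
rewrite mulrACA; congr (_ * _); rewrite mulrC mulrA -[wt g / a * a]mulrA mulVf // mulr1.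
by [].
Qed.

Lemma edge_comp al be ga f g :
  \sum_h evc (cube_edge C n Ga al be) f h * evc (cube_edge C n Ga be ga) h g
  = esgn al be * esgn be ga * @unsigned_edge al ga f g.
Proof.
under eq_bigr do rewrite !edge_colour mulrACA.
rewrite -mulr_sumr.
case: (pickP (flip01 al be)) => [p hp|h]; last first.
  by rewrite {1 3}/esgn; case: pickP => [q|_]; rewrite ?h // !mul0r.
case: (pickP (flip01 be ga)) => [q hq|h]; last first.
  by rewrite {2 4}/esgn; case: (pickP (flip01 be ga)) => [r|_]; rewrite ?h // mulr0 !mul0r.
congr (_ * _); have [ab bp] := flip01_agree hp; have [bg gq] := flip01_agree hq.
have pq : p != q.
  apply: contraTneq hp => e; subst q; move: hq; rewrite !flip01E bp => /andP[h _].
  by rewrite (negbNE h).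
apply: unsigned_comp => r.
  by case: (eqVneq r p) => [->|rp]; [right; rewrite bg|left; rewrite ab].
case: (eqVneq r p) => [->|rp]; first by rewrite -(bg _ pq) eqxx addbF.
by rewrite (ab _ rp) eqxx.
Qed.

Lemma matcomp_diff_colour i (k : cube_vertex G i) (l : cube_vertex G i.+2) f g :
  evc (matcomp (cdiff (bracket C n Ga) i.+1) (cdiff (bracket C n Ga) i) k l) f g = 0.
Proof.
rewrite /matcomp ev_bigAdd /=.
under eq_bigr do rewrite edge_comp.
rewrite -mulr_suml (sum_cube_vertex (i := i.+1) (F := fun be => esgn (val k) be * esgn be (val l))).
  by rewrite esgn_esgn mul0r.
move=> be hb; rewrite esgn_weight ?mul0r //.
by rewrite (eqP (valP k)).
Qed.
End CubeColours.

Section Criterion.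
Variables (C : numClosedFieldType) (n : nat).
Hypothesis n_gt1 : (1 < n)%N.

Lemma eqcob_of_colours (u : option C) (A B : finType) (M N : mor C A B) :
  (forall s z, s != 0 -> n.-primitive_root z ->
    ev idfun (gens_colour n s z) M =2 ev idfun (gens_colour n s z) N) ->
  eqcob u n M N.
Proof.
move=> h; have n_gt0 := ltnW n_gt1; have [z z_prim] := prim_root_exists C n_gt0.
apply: eqcob_complete => // t t0; apply: (Fmor_of_colour n_gt0 z_prim) => // s s0.
exact: h.
Qed.

Theorem bracket_complex (u : option C) (G : mgraph) (Ga : ribbon G) :
  is_complex u n (bracket C n Ga).
Proof.
move=> i k l; apply: eqcob_of_colours => s z s0 z_prim f g.
exact: matcomp_diff_colour.
Qed.
End Criterion.

(** * Invariance *)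

Record requiv (G G' : mgraph) (Ga : ribbon G) (Ga' : ribbon G') := REquiv {
  rv : verts G -> verts G';
  rvi : verts G' -> verts G;
  rf : flag G -> flag G';
  rfi : flag G' -> flag G;
  rvK : cancel rv rvi;
  rviK : cancel rvi rv;
  rfK : cancel rf rfi;
  rfiK : cancel rfi rf;
  rf_vert : forall x, fvert (rf x) = rv (fvert x);
  rf_across : forall x, rf (across x) = across (rf x);
  rf_along0 : forall x, rf (along (untwisted G) x) = along (untwisted G') (rf x);
  rf_corner : forall x, rf (corner Ga x) = corner Ga' (rf x) }.

Lemma requiv_of (G G' : mgraph) (Ga : ribbon G) (Ga' : ribbon G') :
  ribbon_equiv Ga Ga' -> exists q : requiv Ga Ga', True.
Proof.
case=> psi [phi [[psi' p1 p2] [phi' f1 f2] hv [ha hl hc]]].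
by exists (REquiv p1 p2 f1 f2 hv ha hl hc).
Qed.

Section Inverse.
Variables (G G' : mgraph) (Ga : ribbon G) (Ga' : ribbon G') (q : requiv Ga Ga').

Lemma rf_inv (h : flag G -> flag G) (h' : flag G' -> flag G') :
  (forall x, rf q (h x) = h' (rf q x)) -> forall x, rfi q (h' x) = h (rfi q x).
Proof. by move=> e x; apply: (can_inj (rfK q)); rewrite e !rfiK. Qed.

Lemma rfi_vert x : fvert (rfi q x) = rvi q (fvert x).
Proof. by apply: (can_inj (rvK q)); rewrite -rf_vert rviK rfiK. Qed.

Definition rinv : requiv Ga' Ga :=
  REquiv (rviK q) (rvK q) (rfiK q) (rfK q) rfi_vert (rf_inv (rf_across q))
    (rf_inv (rf_along0 q)) (rf_inv (rf_corner q)).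
End Inverse.

Section Equiv.
Variables (G G' : mgraph) (Ga : ribbon G) (Ga' : ribbon G') (q : requiv Ga Ga').
Implicit Types al be : {ffun 'I_(nedges G) -> bool}.

Definition redge (e : 'I_(nedges G)) : 'I_(nedges G') := fedge (rf q (pf e false false)).

(** The four flags of a band are linked by [across] and the untwisted [along], with which the
    equivalence commutes. *)
Lemma fedge_rf x : fedge (rf q x) = redge (fedge x).
Proof.
case: x => [[e b] t]; rewrite /redge.
have e1 y : fedge (rf q (across y)) = fedge (rf q y) by rewrite rf_across.
have e2 y : fedge (rf q (along (untwisted G) y)) = fedge (rf q y) by rewrite rf_along0.
have h c : fedge (rf q (pf e c false)) = fedge (rf q (pf e false false)).
  case: c => //; rewrite -(e2 (pf e false false)).
  by rewrite /along /pf /untwisted /= ffunE.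
case: t; last exact: h.
by rewrite -(h b) -(e1 (pf e b false)).
Qed.

(** A half-twist composes [along] with [across], so an equivalence of the untwisted graphs respects
    the sides of all twisted bands. *)
Lemma along_twist (H : mgraph) (al : {ffun 'I_(nedges H) -> bool}) x :
  along al x = if al (fedge x) then across (along (untwisted H) x)
               else along (untwisted H) x.
Proof.
case: x => [[e b] t]; rewrite /along /across /untwisted /fedge /= ffunE addbF.
by case: (al e); rewrite ?addbT ?addbF.
Qed.
End Equiv.

Lemma redgeK (G G' : mgraph) (Ga : ribbon G) (Ga' : ribbon G') (q : requiv Ga Ga') :
  cancel (redge q) (redge (rinv q)).
Proof.
move=> e; rewrite -[redge q e]/(fedge (rf q (pf e false false))).
by rewrite -(fedge_rf (rinv q)) /= rfK.
Qed.

Lemma redgeVK (G G' : mgraph) (Ga : ribbon G) (Ga' : ribbon G') (q : requiv Ga Ga') :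
  cancel (redge (rinv q)) (redge q).
Proof.
move=> e; rewrite -[redge (rinv q) e]/(fedge (rfi q (pf e false false))).
by rewrite -(fedge_rf q) rfiK.
Qed.

Definition push (G G' : mgraph) (Ga : ribbon G) (Ga' : ribbon G') (q : requiv Ga Ga')
  (al : {ffun 'I_(nedges G) -> bool}) : {ffun 'I_(nedges G') -> bool} :=
  [ffun e => al (redge (rinv q) e)].

Section Push.
Variables (G G' : mgraph) (Ga : ribbon G) (Ga' : ribbon G') (q : requiv Ga Ga').
Implicit Types al be : {ffun 'I_(nedges G) -> bool}.

Lemma push_redge al e : push q al (redge q e) = al e.
Proof. by rewrite ffunE redgeK. Qed.

Lemma pushK : cancel (push q) (push (rinv q)).
Proof.
move=> al; apply/ffunP=> e; rewrite ffunE.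
rewrite -[redge _ e]/(redge q e); exact: push_redge.
Qed.

Lemma weight_push al : weight (push q al) = weight al.
Proof.
rewrite /weight (reindex (redge q)) /=.
  by apply: eq_bigr => e _; rewrite push_redge.
by exists (redge (rinv q)) => e _; [apply: redgeK|apply: redgeVK].
Qed.

Lemma rf_along al x : rf q (along al x) = along (push q al) (rf q x).
Proof.
rewrite (along_twist al) (along_twist (push q al)) fedge_rf push_redge.
by case: (al _); rewrite ?rf_across rf_along0.
Qed.

Lemma conn_rf al x y : connect (bdry_step Ga al) x y ->
  connect (bdry_step Ga' (push q al)) (rf q x) (rf q y).
Proof.
move=> xy; apply: (conn_ind (P := fun y =>
  connect (bdry_step Ga' (push q al)) (rf q x) (rf q y)) xy) => // [w h|w _ h].
  by rewrite rf_corner; apply: connect_trans h (conn_corner _ _ _).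
by rewrite rf_along; apply: connect_trans h (conn_along _ _ _).
Qed.
End Push.

Section Transport.
Variables (G G' : mgraph) (Ga : ribbon G) (Ga' : ribbon G') (q : requiv Ga Ga').
Implicit Types al be : {ffun 'I_(nedges G) -> bool}.

Lemma conn_rfE al x y : connect (bdry_step Ga' (push q al)) (rf q x) (rf q y)
  = connect (bdry_step Ga al) x y.
Proof.
apply/idP/idP => [|/conn_rf h]; last exact: h.
by move/(conn_rf (rinv q)); rewrite pushK /= !rfK.
Qed.

Lemma isolated_rv (v : {v : verts G | isolated v}) : isolated (rv q (val v)).
Proof.
apply/forallP=> x; rewrite -(rfiK q x) rf_vert (can_eq (rvK q)).
exact: (forallP (valP v)).
Qed.

Definition gmap (w : germ G) : germ G' :=
  match w with
  | inl x => inl (rf q x)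
  | inr v => inr (exist _ (rv q (val v)) (isolated_rv v))
  end.

Definition cmap (c : circle G) : circle G' :=
  match c with
  | inl F => inl [set rf q x | x in F]
  | inr v => inr (rv q v)
  end.

Lemma cmap_circ al w : cmap (circ_val Ga al w) = circ_val Ga' (push q al) (gmap w).
Proof.
case: w => [x|v] //=; congr inl; apply/setP=> y; rewrite inE.
apply/imsetP/idP => [[y0 + ->]|h]; first by rewrite inE conn_rfE.
by exists (rfi q y); rewrite ?rfiK // inE -conn_rfE rfiK.
Qed.
End Transport.

Section Transport2.
Variables (G G' : mgraph) (Ga : ribbon G) (Ga' : ribbon G') (q : requiv Ga Ga').
Implicit Types al be : {ffun 'I_(nedges G) -> bool}.

Lemma cmapK : cancel (cmap q) (cmap (rinv q)).
Proof.
case=> [F|v] /=; last by rewrite rvK.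
congr inl; apply/setP=> x; apply/imsetP/idP => [[_ /imsetP[y yF ->] ->]|xF].
  by rewrite rfK.
by exists (rf q x); rewrite ?rfK // imset_f.
Qed.

Lemma cmap_in al c : c \in state Ga al -> cmap q c \in state Ga' (push q al).
Proof. by move/circ_valP=> [w ->]; rewrite cmap_circ circ_in. Qed.

Lemma gmap_surj w' : exists w, w' = gmap q w.
Proof.
case: w' => [x|v]; first by exists (inl (rfi q x)); rewrite /= rfiK.
have hv : isolated (rvi q (val v)) by apply: (isolated_rv (rinv q) v).
exists (inr (exist (fun y => isolated y) _ hv)); rewrite /=; congr inr; apply: val_inj => /=.
by rewrite rviK.
Qed.
End Transport2.

Section Transport3.
Variables (G G' : mgraph) (Ga : ribbon G) (Ga' : ribbon G') (q : requiv Ga Ga').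
Variables (al : {ffun 'I_(nedges G) -> bool}) (be : {ffun 'I_(nedges G') -> bool}).
Hypothesis e : be = push q al.

Lemma cmap_to (c : elts (state Ga al)) : cmap q (val c) \in state Ga' be.
Proof. by rewrite e cmap_in // (valP c). Qed.
Lemma cmap_from (c : elts (state Ga' be)) : cmap (rinv q) (val c) \in state Ga al.
Proof.
have -> : al = push (rinv q) be by rewrite e pushK.
exact: cmap_in (valP c).
Qed.
Lemma cmap_toK : cancel (fun c => mkelt (cmap_to c)) (fun c => mkelt (cmap_from c)).
Proof. by move=> c; apply: val_inj; rewrite /= cmapK. Qed.
Lemma cmap_fromK : cancel (fun c => mkelt (cmap_from c)) (fun c => mkelt (cmap_to c)).
Proof. by move=> c; apply: val_inj; apply: (cmapK (rinv q)). Qed.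
Definition cbij : fbij (elts (state Ga al)) (elts (state Ga' be)) :=
  FBij cmap_toK cmap_fromK.

Lemma cbij_circ w : fto cbij (circ Ga al w) = circ Ga' be (gmap q w).
Proof. by apply: val_inj; rewrite /= cmap_circ e. Qed.
End Transport3.

Section TransportMor.
Variables (C : numClosedFieldType) (n : nat).
Variables (G G' : mgraph) (Ga : ribbon G) (Ga' : ribbon G') (q : requiv Ga Ga').
Variable eps : {ffun 'I_(nedges G) -> bool} -> C.

Definition transport al be : mor C (elts (state Ga al)) (elts (state Ga' be)) :=
  match be =P push q al with
  | ReflectT e => Scale (eps al) (Relabel (cbij e))
  | ReflectF _ => Zero
  end.

Definition trel al be (f : {ffun elts (state Ga al) -> 'I_n})
    (g : {ffun elts (state Ga' be) -> 'I_n}) : bool :=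
  [forall w : germ G, g (circ Ga' be (gmap q w)) == f (circ Ga al w)].

Lemma transportE (D : gens C n) al be f g :
  ev idfun D (transport al be) f g =
  (be == push q al)%:R * eps al * (@trel al be f g)%:R.
Proof.
rewrite /transport; case: eqP => e /=; last by rewrite !mul0r.
rewrite mul1r; congr (_ * (nat_of_bool _)%:R); apply/forallP/forallP => h.
  by move=> w; rewrite -(cbij_circ e); apply: h.
by move=> c; have [w ->] := circ_surj c; have := h w; rewrite -(cbij_circ e).
Qed.

Lemma trel_push al be f : be = push q al -> exists g, @trel al be f g.
Proof.
move=> e; exists [ffun c => f (ffrom (cbij e) c)].
by apply/forallP=> w; rewrite ffunE -(cbij_circ e) ftoK.
Qed.

Lemma trel_pull al be g : be = push q al -> exists f, @trel al be f g.
Proof.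
move=> e; exists [ffun c => g (fto (cbij e) c)].
by apply/forallP=> w; rewrite ffunE -(cbij_circ e).
Qed.

Lemma trel_uniq al be f g g' : @trel al be f g -> @trel al be f g' -> g = g'.
Proof.
move=> /forallP h /forallP h'; apply/ffunP=> c.
have [w' ->] := circ_surj c; have [w ->] := gmap_surj q w'.
by rewrite (eqP (h w)) (eqP (h' w)).
Qed.

Lemma trel_inj al be f f' g : @trel al be f g -> @trel al be f' g -> f = f'.
Proof.
move=> /forallP h /forallP h'; apply/ffunP=> c.
by have [w ->] := circ_surj c; rewrite -(eqP (h w)) (eqP (h' w)).
Qed.

Lemma trel_wt (s z : C) al be f g : be = push q al -> @trel al be f g ->
  wt s z f = wt s z g.
Proof.
move=> e h; rewrite /wt [RHS](reindex (fto (cbij e))); last first.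
  by exists (ffrom (cbij e)) => c _; [apply: ftoK|apply: ffromK].
apply: eq_bigr => c _; have [w ->] := circ_surj c.
by rewrite (cbij_circ e) (eqP (forallP h w)).
Qed.
End TransportMor.

Section InversionSign.
Variables (C : numClosedFieldType).
Variables (G G' : mgraph) (Ga : ribbon G) (Ga' : ribbon G') (q : requiv Ga Ga').
Implicit Types al be : {ffun 'I_(nedges G) -> bool}.
Notation sg := (redge q).

(* The edge signs depend on the order of the edges, which an equivalence need not
   preserve; the sign of the inversions among the twisted edges compensates. *)
Definition inverted (r t : 'I_(nedges G)) : nat := ((r < t) && (sg t < sg r))%N.

Definition inversions al : nat := (\sum_r \sum_t al r * al t * inverted r t)%N.

Definition isgn al : C := (-1) ^+ inversions al.

Lemma inversions_turn_on al p : ~~ al p ->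
  inversions (turn_on al p) =
  (inversions al + \sum_t al t * (inverted p t + inverted t p))%N.
Proof.
move=> pn.
have E r : turn_on al p r = (al r + (r == p))%N :> nat.
  by rewrite ffunE; case: eqP => [->|_]; rewrite ?(negbTE pn) ?addn0.
rewrite /inversions.
under eq_bigr => r _ do under eq_bigr => t _ do rewrite !E mulnDl !mulnDr !mulnDl.
under eq_bigr => r _ do rewrite !big_split /=.
rewrite !big_split /= -!addnA; congr addn.
have S1 (F : 'I_(nedges G) -> 'I_(nedges G) -> nat) :
  (\sum_r \sum_t (r == p) * al t * F r t = \sum_t al t * F p t)%N.
  rewrite (bigD1 p) //= [X in (_ + X)%N]big1 ?addn0 => [|r /negbTE ->]; last first.
    by rewrite big1.
  by apply: eq_bigr => t _; rewrite eqxx mul1n.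
have S2 (F : 'I_(nedges G) -> 'I_(nedges G) -> nat) :
  (\sum_r \sum_t al r * (t == p) * F r t = \sum_t al t * F t p)%N.
  rewrite exchange_big /= (bigD1 p) //= [X in (_ + X)%N]big1 ?addn0 => [|r /negbTE ->]; last first.
    by rewrite big1 // => t _; rewrite muln0.
  by apply: eq_bigr => t _; rewrite eqxx muln1.
rewrite S1 S2 [X in (_ + (_ + X))%N]big1 => [|r _]; last first.
  rewrite big1 // => t _; case: eqP => [->|//]; case: eqP => [->|]; rewrite ?muln0 //.
  by rewrite /inverted ltnn.
rewrite addn0 addnC -big_split /=.
by apply: eq_bigr => t _; rewrite mulnDr.
Qed.

(** For a twisted edge t other than p, [t < p] + [sg t < sg p] is odd exactly when t and p are
    inverted. Turning p on changes [isgn] by the product of these parities. *)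
Lemma isgn_turn_on al p : ~~ al p ->
  isgn al * edge_sign C (push q al) (sg p) = edge_sign C al p * isgn (turn_on al p).
Proof.
move=> pn; rewrite /isgn inversions_turn_on // /edge_sign exprD.
rewrite mulrCA; congr (_ * _).
have -> : (\sum_(r < nedges G' | (r < sg p)%N) push q al r =
    \sum_(t < nedges G | (sg t < sg p)%N) al t)%N.
  rewrite (reindex sg) /=; last first.
    by exists (redge (rinv q)) => e _; [apply: redgeK|apply: redgeVK].
  by apply: eq_bigr => t _; rewrite push_redge.
rewrite [in LHS]big_mkcond [X in _ = (-1) ^+ X * _]big_mkcond /= -exprD -big_split /=.
rewrite -signr_odd -[RHS]signr_odd; congr (_ ^+ nat_of_bool _).
rewrite !(big_morph odd oddD (erefl : odd 0 = false)); apply: eq_bigr => t _.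
case: (eqVneq t p) => [->|tp]; first by rewrite (negbTE pn) !mul0n !if_same.
case at_: (al t); last by rewrite !if_same.
rewrite mul1n /inverted.
have tp' : (t == p :> nat) = false by apply/negbTE.
have stp : (sg t == sg p :> nat) = false.
  by apply/negbTE; rewrite -[_ == _]/(sg t == sg p) (can_eq (redgeK q)).
move: tp' stp.
case: (ltngtP t p); case: (ltngtP (sg t) (sg p)) => //=.
Qed.

Lemma isgn_edge al be :
  isgn al * esgn C (push q al) (push q be) = esgn C al be * isgn be.
Proof.
have pt p : turn_on (push q al) (sg p) = push q (turn_on al p).
  apply/ffunP=> e; rewrite -(redgeVK q e); set x := redge _ e.
  by rewrite push_redge !ffunE redgeK (can_eq (redgeK q)).
case: (pickP (flip01 al be)) => [p hp|h].
  rewrite (esgnE C hp).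
  have hp' : flip01 (push q al) (push q be) (sg p).
    move: hp; rewrite !flip01E push_redge => /andP[-> /eqP ->] /=.
    by rewrite pt.
  rewrite (esgnE C hp'); move: hp; rewrite flip01E => /andP[pn /eqP ->].
  exact: isgn_turn_on.
have -> : esgn C al be = 0 by rewrite /esgn; case: pickP => [p|//]; rewrite h.
rewrite mul0r /esgn; case: pickP => [p|_]; last by rewrite mulr0.
rewrite flip01E => /andP[pn /eqP e].
have := h (redge (rinv q) p); rewrite flip01E => /negbT/negP[].
rewrite -(redgeVK q p) push_redge in pn; rewrite pn /=.
apply/eqP; apply: (can_inj (pushK q)); rewrite e -{1}(redgeVK q p) pt.
by [].
Qed.

Lemma isgn_sq al : isgn al * isgn al = 1.
Proof. by rewrite /isgn -exprD addnn -mul2n exprM sqrrN expr1n expr1n. Qed.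
End InversionSign.

Lemma compat_edge n (G : mgraph) (Ga : ribbon G) p
    (al be : {ffun 'I_(nedges G) -> bool}) f g x :
  be p = ~~ al p -> @compat n G Ga al be f g -> fedge x = p ->
  f (circ Ga al (inl x)) = f (circ Ga al (inl (pf p false false))).
Proof.
move=> bp c; case: x => [[r b] t]; rewrite /fedge /= => e; subst r.
case: b; last exact: compat_pf bp c.
rewrite -circ_along; exact: compat_pf bp c.
Qed.

Lemma pushVK (G G' : mgraph) (Ga : ribbon G) (Ga' : ribbon G') (q : requiv Ga Ga') :
  cancel (push (rinv q)) (push q).
Proof. exact: (pushK (rinv q)). Qed.

Definition tmap (C : numClosedFieldType) (n : nat) (G G' : mgraph) (Ga : ribbon G)
    (Ga' : ribbon G') (q : requiv Ga Ga') (i : nat) :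
  @matmor C (cobj (bracket C n Ga) i) (cobj (bracket C n Ga') i) :=
  fun k l => transport q (isgn C q) (val k) (val l).

Section ChainMap.
Variables (C : numClosedFieldType) (n : nat).
Hypothesis n_gt1 : (1 < n)%N.
Let n_gt0 : (0 < n)%N := ltnW n_gt1.
Variables (G G' : mgraph) (Ga : ribbon G) (Ga' : ribbon G') (q : requiv Ga Ga').
Implicit Types al be : {ffun 'I_(nedges G) -> bool}.

Section Colour.
Variables (s z : C).
Hypotheses (s_neq0 : s != 0) (z_prim : n.-primitive_root z).
Notation evc := (ev idfun (gens_colour n s z)).
Notation trel al be f g := (@trel n G G' Ga Ga' q al be f g).
Notation uedge := (unsigned_edge s z).

Lemma unsigned_push al be f h1 h0 g :
  trel al (push q al) f h0 -> trel be (push q be) h1 g ->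
  uedge h0 g = uedge f h1.
Proof.
move=> t0 t1; have /forallP T0 := t0; have /forallP T1 := t1.
have E : compat h0 g = compat f h1.
  apply/forallP/forallP => [h w|h w'].
    by rewrite -(eqP (T0 w)) -(eqP (T1 w)) h.
  by have [w ->] := gmap_surj q w'; rewrite (eqP (T0 w)) (eqP (T1 w)) h.
rewrite /unsigned_edge E; case: (boolP (compat f h1)) => c; last by rewrite !mul0r.
rewrite -(trel_wt s z erefl t0) -(trel_wt s z erefl t1); congr (_ * (_ * _)).
rewrite /kdiff (reindex (redge q)) /=; last first.
  by exists (redge (rinv q)) => r _; [apply: redgeK|apply: redgeVK].
apply: eq_big => [r|r]; rewrite ?push_redge // => ne.
have bp : push q be (redge q r) = ~~ push q al (redge q r).
  by rewrite !push_redge; case: (al r) ne; case: (be r).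
congr (kappa s z _).
have c' : compat h0 g by rewrite E.
by rewrite -(compat_edge bp c' (fedge_rf q (pf r false false))) -(eqP (T0 (inl _))).
Qed.

(** On each side one intermediate colouring survives, the unsigned entries agree by transport, and
    [isgn_edge] matches the signs. *)
Lemma transport_edge al be ga f g : ga = push q be ->
  \sum_h evc (transport q (isgn C q) al (push q al)) f h *
     evc (cube_edge C n Ga' (push q al) ga) h g =
  \sum_h evc (cube_edge C n Ga al be) f h * evc (transport q (isgn C q) be ga) h g.
Proof.
move=> eg; subst ga.
have [h0 t0] := trel_push (q := q) f (erefl (push q al)).
have [h1 t1] := trel_pull (q := q) g (erefl (push q be)).
under eq_bigr do rewrite transportE (edge_colour n_gt1 s_neq0 z_prim) eqxx mul1r.
under [RHS]eq_bigr do rewrite transportE (edge_colour n_gt1 s_neq0 z_prim) eqxx mul1r.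
rewrite (sum_bool (a := h0)) => [|h /eqP ne]; last first.
  case: (boolP (trel al (push q al) f h)) => t; last by rewrite mulr0 mul0r.
  by case: ne; apply: trel_uniq t t0.
rewrite (sum_bool (a := h1)) => [|h /eqP ne]; last first.
  case: (boolP (trel be (push q be) h g)) => t; last by rewrite !mulr0.
  by case: ne; apply: trel_inj t t1.
rewrite t0 t1 !mulr1 (unsigned_push t0 t1).
by rewrite mulrA isgn_edge mulrAC.
Qed.

Lemma chain_map_colour i (k : cube_vertex G i) (l : cube_vertex G' i.+1)
    (f : {ffun elts (state Ga (val k)) -> 'I_n})
    (g : {ffun elts (state Ga' (val l)) -> 'I_n}) :
  evc (matcomp (cdiff (bracket C n Ga') i) (@tmap C n _ _ _ _ q i) k l) f g =
  evc (matcomp (@tmap C n _ _ _ _ q i.+1) (cdiff (bracket C n Ga) i) k l) f g.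
Proof.
rewrite /matcomp !ev_bigAdd.
set al := val k; set ga := val l.
pose be := push (rinv q) ga; have eg : ga = push q be by rewrite /be pushVK.
have wk : weight al = i := eqP (valP k).
have wl : weight ga = i.+1 := eqP (valP l).
have L : forall b', (\sum_h evc (transport q (isgn C q) al b') f h *
   evc (cube_edge C n Ga' b' ga) h g) =
   \sum_h (b' == push q al)%:R * isgn C q al * (trel al b' f h)%:R *
   (esgn C b' ga * uedge h g).
  move=> b'; apply: eq_bigr => h _.
  by rewrite transportE (edge_colour n_gt1 s_neq0 z_prim).
have R : forall b, (\sum_h evc (cube_edge C n Ga al b) f h *
   evc (transport q (isgn C q) b ga) h g) =
   \sum_h (esgn C al b * uedge f h) *
   ((ga == push q b)%:R * isgn C q b * (trel b ga h g)%:R).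
  move=> b; apply: eq_bigr => h _.
  by rewrite transportE (edge_colour n_gt1 s_neq0 z_prim).
rewrite (sum_cube_vertex (F := fun b' => \sum_h evc (transport q (isgn C q) al b') f h *
   evc (cube_edge C n Ga' b' ga) h g)); last first.
  move=> b' hb; have ne : b' != push q al.
    by apply: contra hb => /eqP ->; rewrite weight_push wk.
  by rewrite L big1 // => h _; rewrite (negbTE ne) !mul0r.
rewrite (sum_cube_vertex (F := fun b => \sum_h evc (cube_edge C n Ga al b) f h *
   evc (transport q (isgn C q) b ga) h g)); last first.
  move=> b hb; have ne : ga != push q b.
    by apply: contra hb => /eqP e; rewrite -(weight_push q) -e wl.
  by rewrite R big1 // => h _; rewrite (negbTE ne) !mul0r mulr0.
rewrite (sum_bool (a := push q al)); last first.
  by move=> b' /negbTE hb; rewrite L big1 // => h _; rewrite hb !mul0r.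
rewrite (sum_bool (a := be)); last first.
  move=> b hb; have ne : ga != push q b.
    by apply: contra hb => /eqP e; rewrite /be e pushK.
  by rewrite R big1 // => h _; rewrite (negbTE ne) !mul0r mulr0.
exact: transport_edge.
Qed.

Lemma matid_colour i (k l : cube_vertex G i)
    (f : {ffun elts (state Ga (val k)) -> 'I_n})
    (g : {ffun elts (state Ga (val l)) -> 'I_n}) :
  evc (@matid C (cobj (bracket C n Ga) i) k l) f g =
  (val k == val l)%:R * (compat f g)%:R.
Proof.
rewrite /matid; case: eqP => [e|ne] /=; last first.
  by rewrite (_ : _ == _ = false) ?mul0r //; apply/negbTE/eqP => /val_inj.
subst l; rewrite eqxx mul1r /=; congr (nat_of_bool _)%:R.
apply/forallP/forallP => h.
  by move=> w; rewrite eq_sym; apply: h.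
by move=> c; have [w ->] := circ_surj c; rewrite eq_sym; apply: h.
Qed.
End Colour.

Lemma transport_deg0 (u : option C) i :
  @mat_deg0 C u n (cobj (bracket C n Ga) i) (cobj (bracket C n Ga') i)
    (@tmap C n _ _ _ _ q i).
Proof.
move=> k l; exists (transport q (isgn C q) (val k) (val l)); first exact: eqc_refl.
have -> : (mshift k)%:~R - (mshift l)%:~R = 0 :> rat.
  by rewrite /= (eqP (valP k)) (eqP (valP l)) subrr.
rewrite /transport; case: eqP => e; last exact: deg_zero.
exact/deg_scale/deg_relabel.
Qed.
End ChainMap.

(** Only proofs change under double inversion. This lets one homotopy statement serve both
    composites. *)
Lemma rinvK (G G' : mgraph) (Ga : ribbon G) (Ga' : ribbon G') (q : requiv Ga Ga') :
  rinv (rinv q) = q.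
Proof. by case: q => *; rewrite /rinv /=; congr REquiv; apply: Prop_irrelevance. Qed.

Section KomIso.
Variables (C : numClosedFieldType) (n : nat).
Hypothesis n_gt1 : (1 < n)%N.
Let n_gt0 : (0 < n)%N := ltnW n_gt1.

Section OneWay.
Variables (G G' : mgraph) (Ga : ribbon G) (Ga' : ribbon G') (q : requiv Ga Ga').

(** A permutation and its inverse have corresponding inversions; the signs of the two transports are
    equal and their product is 1. *)
Lemma isgn_inv al : isgn C (rinv q) (push q al) = isgn C q al.
Proof.
have bij : {on [pred _ | true], bijective (redge q)}.
  by exists (redge (rinv q)) => e _; [apply: redgeK|apply: redgeVK].
rewrite /isgn; congr (_ ^+ _); rewrite /inversions [RHS]exchange_big /=.
rewrite (reindex _ bij); apply: eq_bigr => r _; rewrite (reindex _ bij).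
apply: eq_bigr => t _; rewrite !push_redge /inverted !redgeK andbC.
by congr (_ * _)%N; rewrite mulnC.
Qed.

Lemma gmapK : cancel (gmap q) (gmap (rinv q)).
Proof.
case=> [x|v] /=; first by rewrite rfK.
by congr inr; apply: val_inj; rewrite /= rvK.
Qed.

Lemma tmapK_colour s z i (k l : cube_vertex G i)
    (f : {ffun elts (state Ga (val k)) -> 'I_n})
    (g : {ffun elts (state Ga (val l)) -> 'I_n}) :
  ev idfun (gens_colour (C := C) n s z)
    (matcomp (@tmap C n _ _ _ _ (rinv q) i) (@tmap C n _ _ _ _ q i) k l) f g
  = (val k == val l)%:R * (compat f g)%:R.
Proof.
rewrite /matcomp ev_bigAdd; set al := val k; set ga := val l.
have wk : weight al = i := eqP (valP k).
have E b : (\sum_h ev idfun (gens_colour n s z) (transport q (isgn C q) al b) f h *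
   ev idfun (gens_colour n s z) (transport (rinv q) (isgn C (rinv q)) b ga) h g) =
   \sum_(h : {ffun elts (state Ga' b) -> 'I_n}) (b == push q al)%:R * isgn C q al * (trel q f h)%:R *
    ((ga == push (rinv q) b)%:R * isgn C (rinv q) b * (trel (rinv q) h g)%:R).
  by apply: eq_bigr => h _; rewrite !transportE.
rewrite (sum_cube_vertex (F := fun b => \sum_h ev idfun (gens_colour n s z) (transport q (isgn C q) al b) f h *
   ev idfun (gens_colour n s z) (transport (rinv q) (isgn C (rinv q)) b ga) h g)); last first.
  move=> b hb; have ne : b != push q al.
    by apply: contra hb => /eqP ->; rewrite weight_push wk.
  by rewrite E big1 // => h _; rewrite (negbTE ne) !mul0r.
rewrite (sum_bool (a := push q al)); last first.
  by move=> b /negbTE hb; rewrite E big1 // => h _; rewrite hb !mul0r.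
rewrite E eqxx mul1r pushK isgn_inv.
have [h0 t0] := trel_push (q := q) f (erefl (push q al)).
rewrite (sum_bool (a := h0)) => [|h /eqP ne]; last first.
  case: (boolP (trel q f h)) => t; last by rewrite mulr0 mul0r.
  by case: ne; apply: trel_uniq t t0.
have -> : trel (rinv q) h0 g = compat f g.
  have /forallP T := t0; apply/forallP/forallP => h.
    by move=> w; have := h (gmap q w); rewrite gmapK (eqP (T w)) eq_sym.
  by move=> w'; have [w ->] := gmap_surj q w'; rewrite gmapK (eqP (T w)) eq_sym.
by rewrite t0 mulr1 eq_sym mulrA mulrCA isgn_sq mulr1.
Qed.

Lemma tmap_chain (u : option C) :
  is_chain_map u n (X := bracket C n Ga) (Y := bracket C n Ga') (@tmap C n _ _ _ _ q).
Proof.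
move=> i k l; apply: eqcob_of_colours => // s z s0 z_prim f g.
exact: chain_map_colour.
Qed.

Lemma tmap_homotopic (u : option C) :
  homotopic u n (X := bracket C n Ga) (Y := bracket C n Ga)
    (fun i => matcomp (@tmap C n _ _ _ _ (rinv q) i) (@tmap C n _ _ _ _ q i))
    (fun i => @matid C (cobj (bracket C n Ga) i)).
Proof.
have big0 (D : gens C n) (I : finType) (A B : finType) (F : I -> mor C A B) f g :
    (forall j, ev idfun D (F j) f g = 0) ->
    ev idfun D (\big[Add/Zero]_j F j) f g = 0 :> C.
  by move=> h; rewrite ev_bigAdd big1.
(* The composite already equals the identity, so the zero homotopy suffices. *)
exists (fun i => @matzero C (cobj (bracket C n Ga) i.+1) (cobj (bracket C n Ga) i)).
split=> [|i] k l; apply: eqcob_of_colours => // s z s0 z_prim f g;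
  rewrite /matadd [RHS]/= tmapK_colour matid_colour.
- rewrite [X in _ = _ + X]big0 ?addr0 // => j /=.
  by rewrite big1 // => h _; rewrite mulr0.
- rewrite [X in _ = _ + (X + _)]big0 ?add0r => [|j /=]; last first.
    by rewrite big1 // => h _; rewrite mul0r.
  rewrite [X in _ = _ + X]big0 ?addr0 // => j /=.
  by rewrite big1 // => h _; rewrite mulr0.
Qed.
End OneWay.

Theorem bracket_invariant (u : option C) (G G' : mgraph) (Ga : ribbon G) (Ga' : ribbon G') :
  ribbon_equiv Ga Ga' -> kom_iso u n (bracket C n Ga) (bracket C n Ga').
Proof.
case/requiv_of => q _.
exists (@tmap C n _ _ _ _ q), (@tmap C n _ _ _ _ (rinv q)); split.
- exact: tmap_chain.
- exact: tmap_chain.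
- by split=> i; apply: transport_deg0.
- exact: tmap_homotopic.
- by have := tmap_homotopic (rinv q) u; rewrite rinvK.
Qed.
End KomIso.

(** * Comparison with the n-color complexes *)

Lemma perm_pair (T : eqType) (s : seq T) x y :
  perm_eq s [:: x; y] -> s = [:: x; y] \/ s = [:: y; x].
Proof.
move=> h; have := perm_size h; case: s h => [|a [|b [|c s]]] //= h _.
have := perm_mem h a; rewrite !inE eqxx /= => /esym/orP[] /eqP e; subst a.
  left; have := h; rewrite perm_cons => /perm_small_eq e.
  by congr (_ :: _); apply: e.
right; have : perm_eq [:: y; b] [:: y; x] by rewrite (perm_trans h) // (perm_catC [:: x] [:: y]).
by rewrite perm_cons => /perm_small_eq e; congr (_ :: _); apply: e.
Qed.

Section ColorEdge.
Variables (C : numClosedFieldType) (n : nat).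
Hypothesis n_gt1 : (1 < n)%N.
Let n_gt0 : (0 < n)%N := ltnW n_gt1.
Variable t : C.
Notation evm := (ev idfun (gens_mono n t)).
Notation D := (gens_mono n t).

(** Exponent of x^k times the partner x^(n-1-j) of x^j, with one more x for the dot when n is even;
    adding j gives k + 2m in both parities. *)
Definition split_exp (k j : nat) : nat := (k + (~~ odd n) + (n.-1 - j))%N.

Lemma split_mono (k i j : 'I_n) :
  (if odd n then gen_split D k i j
   else \sum_l gen_dot D k l * gen_split D l i j) = red n t (split_exp k j) i.
Proof.
rewrite /split_exp; case: ifP => odn /=; first by rewrite addn0.
by rewrite red_red // addn1.
Qed.

(** What the comparison needs from the colour maps. Symmetry of the comultiplication is included
    because [enum] and [bcard] may list the two outgoing circles in different orders. *)
Record color_spec (mu : color_maps C n) : Prop := ColorSpec {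
  spec_mul : forall i j k, col_mul mu i j k = red n t (i + j) k;
  spec_comul : forall k i j, col_comul mu k i j = red n t (split_exp k j) i;
  spec_comulC : forall k i j, col_comul mu k i j = col_comul mu k j i;
  spec_eta : forall k l, col_eta mu k l = sqrtC n%:R * red n t (k + n./2) l }.

Lemma enum_double (T : finType) (a b : T) : double a b -> perm_eq (enum T) [:: a; b].
Proof.
case=> ab h; apply: uniq_perm; rewrite ?enum_uniq //= ?inE ?ab //.
by move=> x; rewrite mem_enum !inE; case: (h x) => ->; rewrite eqxx ?orbT.
Qed.

Lemma enum_single (T : finType) (a : T) : single a -> enum T = [:: a].
Proof.
move=> h; apply/perm_small_eq => //; apply: uniq_perm; rewrite ?enum_uniq //.
by move=> x; rewrite mem_enum !inE (h x) eqxx.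
Qed.

Lemma outside_perm (G : mgraph) (S U : {set circle G}) (sU : U \subset S)
    (f : {ffun elts S -> 'I_n}) :
  perm_eq [seq f c | c <- enum (elts S) & val c \notin U]
          [seq f (ffrom (bsplit sU) (inr x)) | x <- enum (elts (S :\: U))].
Proof.
have -> : [seq f (ffrom (bsplit sU) (inr x)) | x <- enum (elts (S :\: U))]
   = [seq f c | c <- [seq ffrom (bsplit sU) (inr x) | x <- enum (elts (S :\: U))]].
  exact: (map_comp f (fun x => ffrom (bsplit sU) (inr x))).
apply: perm_map; apply: uniq_perm.
- by rewrite filter_uniq // enum_uniq.
- rewrite map_inj_uniq ?enum_uniq // => x y /(congr1 val) /= e; exact: val_inj.
move=> c; rewrite mem_filter mem_enum andbT; apply/idP/mapP => [cU|[x _ ->]].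
  have cS : val c \in S :\: U by rewrite inE cU (valP c).
  by exists (mkelt cS); rewrite ?mem_enum //; apply: val_inj.
by have := valP x; rewrite inE => /andP[].
Qed.

Lemma saddle_color (mu : color_maps C n) (G : mgraph) p (S S' : {set circle G}) f g :
  color_spec mu -> evm (saddle C n p S S') f g = color_edge mu p f g.
Proof.
move=> [hm hc hcC he]; rewrite ev_saddle /color_edge.
set U := unaffected p S S'; set sl := bsplit (unaffected_subl p S S').
set sr := bsplit (unaffected_subr p S S').
set fD := finfun _; set gD := finfun _.
have -> : [forall a, g (ffrom sr (inl a)) == f (ffrom sl (inl a))] =
  [forall c : elts S, forall c' : elts S', (val c \in U) && (val c == val c') ==> (f c == g c')].
  apply/forallP/forallP => [h c|h a].
    apply/forallP=> c'; apply/implyP => /andP[cU /eqP e].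
    have := h (mkelt cU); rewrite eq_sym.
    have -> : ffrom sl (inl (mkelt cU)) = c by apply: val_inj.
    by have -> : ffrom sr (inl (mkelt cU)) = c' by apply: val_inj.
  have := forallP (h (ffrom sl (inl a))) (ffrom sr (inl a)).
  by rewrite /= eqxx andbT (valP a) /= eq_sym.
case: ifP => _; last by rewrite mul0r.
rewrite mul1r; have pf := outside_perm (unaffected_subl p S S') f.
have pg := outside_perm (unaffected_subr p S S') g.
have ef : [seq f (ffrom sl (inr x)) | x <- enum (elts (S :\: U))] = [seq fD x | x <- enum (elts (S :\: U))].
  by apply: eq_map => x; rewrite ffunE.
have eg : [seq g (ffrom sr (inr x)) | x <- enum (elts (S' :\: U))] = [seq gD x | x <- enum (elts (S' :\: U))].
  by apply: eq_map => x; rewrite ffunE.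
rewrite -/sl ef in pf; rewrite -/sr eg in pg; rewrite -/U in pf pg.
case: (core_specE D (elts (S :\: U)) (elts (S' :\: U))).
- move=> a b y _ _ dX sY /=; rewrite (enum_single sY) in pg.
  have {}pf := perm_trans pf (perm_map fD (enum_double dX)).
  rewrite (perm_small_eq _ pg) //=.
  by have [->|->] := perm_pair pf; rewrite hm // addnC.
- move=> x a b _ _ sX dY; rewrite split_mono (enum_single sX) in pf *.
  have {}pg := perm_trans pg (perm_map gD (enum_double dY)).
  rewrite (perm_small_eq _ pf) //=.
  by have [->|->] := perm_pair pg; rewrite -hc // hcC.
- move=> x y _ _ sX sY; rewrite (enum_single sX) in pf; rewrite (enum_single sY) in pg.
  rewrite (perm_small_eq _ pf) // (perm_small_eq _ pg) //= he.
  by rewrite ev_mono_dots // !ffunE.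
(* The list lengths are the numbers of affected circles, so the excluded cases fall under the
   default 0 of [color_edge]. *)
- have := perm_size pf; have := perm_size pg; rewrite !size_map -!enumT -!cardE.
  move=> {pf pg}; set s2 := [seq g c | c <- _ & _]; set s1 := [seq f c | c <- _ & _].
  have -> : size [seq c <- enum (elts S') | val c \notin U] = size s2 by rewrite size_map.
  have -> : size [seq c <- enum (elts S) | val c \notin U] = size s1 by rewrite size_map.
  move=> <- <-; by move: s1 s2 => [|? [|? [|? ?]]] [|? [|? [|? ?]]].
Qed.

Lemma Fmor_cube_edge (mu : color_maps C n) (G : mgraph) (Ga : ribbon G)
    (al be : {ffun 'I_(nedges G) -> bool}) f g :
  color_spec mu -> Fmor (n := n) t (cube_edge C n Ga al be) f g = color_diff mu f g.
Proof.
move=> h; rewrite Fmor_ev // /cube_edge /color_diff; case: pickP => [p _|//].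
by rewrite -(saddle_color p f g h).
Qed.
End ColorEdge.

Section ColorSpecs.
Variables (C : numClosedFieldType) (n : nat).
Hypothesis n_gt1 : (1 < n)%N.
Let n_gt0 : (0 < n)%N := ltnW n_gt1.

Lemma red0E k l : (l < n)%N -> red n (0 : C) k l = (k == l)%N%:R.
Proof.
move=> hl; rewrite /red expr0n.
have [lt|ge] := ltnP k n; first by rewrite modn_small // divn_small // mulr1.
rewrite eqn0Ngt divn_gt0 // ge /= mulr0.
by case: eqP => // e; move: ge; rewrite e leqNgt hl.
Qed.

Lemma red1E k l : red n (1 : C) k l = (k %% n == l)%N%:R.
Proof. by rewrite /red expr1n mulr1. Qed.

Lemma split_expE (k j : 'I_n) : (split_exp n k j + j = k + n./2.*2)%N.
Proof. by rewrite /split_exp; have := ltn_ord j; lia. Qed.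

Lemma bigraded_spec : color_spec 0 (bigraded_maps C n).
Proof.
split=> [i j k|k i j|k i j|k l] /=.
- by rewrite -red_coefE // /red_coef subr0.
- rewrite red0E ?ltn_ord //; congr (nat_of_bool _)%:R.
  by rewrite -(split_expE k j) eqn_add2r eq_sym.
- by rewrite addnC.
- by rewrite -red_coefE // /red_coef subr0.
Qed.

Lemma filtered_spec : color_spec 1 (filtered_maps C n).
Proof.
split=> [i j k|k i j|k i j|k l] /=.
- by rewrite -red_coefE.
- rewrite red1E; congr (nat_of_bool _)%:R.
  by rewrite -(split_expE k j) eqn_modDr modn_small // eq_sym.
- by rewrite addnC.
- by rewrite -red_coefE.
Qed.
End ColorSpecs.

(** * Degrees at t = 0, and the complex of modules *)

Section Degree.
Variables (C : numClosedFieldType) (n : nat).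
Hypothesis n_gt1 : (1 < n)%N.
Let n_gt0 : (0 < n)%N := ltnW n_gt1.

Lemma red0_neq0 k l : (l < n)%N -> red n (0 : C) k l != 0 -> k = l.
Proof. by move=> hl; rewrite red0E // pnatr_eq0 eqb0 negbK => /eqP. Qed.

Lemma monom_deg_bij (T A B : finType) (b : fbij T (A + B)%type) (f : {ffun T -> 'I_n}) :
  monom_deg f = \sum_a (n./2%:Z - (f (ffrom b (inl a)))%:Z)
    + monom_deg [ffun x => f (ffrom b (inr x))].
Proof.
rewrite /monom_deg (reindex (ffrom b)) /=; last first.
  by exists (fto b) => x _; rewrite ?ftoK ?ffromK.
by rewrite big_sumType /=; congr (_ + _); apply: eq_bigr => x _; rewrite ffunE.
Qed.

Lemma monom_deg_single (T : finType) (a : T) (f : {ffun T -> 'I_n}) :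
  single a -> monom_deg f = n./2%:Z - (f a)%:Z.
Proof. by move=> h; rewrite /monom_deg (big_pred1 a) // => y; rewrite (h y) /= eqxx. Qed.

Lemma monom_deg_double (T : finType) (a b : T) (f : {ffun T -> 'I_n}) :
  double a b -> monom_deg f = (n./2%:Z - (f a)%:Z) + (n./2%:Z - (f b)%:Z).
Proof.
case=> ab h; rewrite /monom_deg (bigD1 a) //= (big_pred1 b) // => y /=.
by case: (h y) => ->; rewrite ?eqxx ?(negbTE ab) // eq_sym ab.
Qed.

(** At t = 0 reduction preserves exponents or gives 0. The total exponent is unchanged by a fusion,
    grows by m for one circle to one and by 2m for a splitting; with the change in the number of
    circles, the degree always drops by m, which the shift restores. *)
Lemma saddle_degree (G : mgraph) p (S S' : {set circle G}) f g :
  ev idfun (gens_mono n (0 : C)) (saddle C n p S S') f g != 0 ->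
  monom_deg f = n./2%:Z + monom_deg g.
Proof.
rewrite ev_saddle; set sl := bsplit (unaffected_subl p S S').
set sr := bsplit (unaffected_subr p S S'); rewrite mulf_eq0 negb_or => /andP[].
case: forallP => [h _|_]; last by rewrite eqxx.
rewrite (monom_deg_bij sl f) (monom_deg_bij sr g).
set fD := finfun _; set gD := finfun _; move=> core.
have -> : \sum_a (n./2%:Z - (g (ffrom sr (inl a)))%:Z) =
          \sum_a (n./2%:Z - (f (ffrom sl (inl a)))%:Z).
  by apply: eq_bigr => a _; rewrite (eqP (h a)).
rewrite [RHS]addrCA; congr (_ + _).
have hg i : (nat_of_ord (i : 'I_n) < n)%N by [].
case: (core_specE _ _ _) core.
- move=> a b y _ _ dX sY /= /(red0_neq0 (hg _)) e.
  by rewrite (monom_deg_double _ dX) (monom_deg_single _ sY) -e PoszD; ring.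
- move=> x a b _ _ sX dY; rewrite split_mono // => /(red0_neq0 (hg _)) e.
  rewrite (monom_deg_single _ sX) (monom_deg_double _ dY).
  have := split_expE n_gt1 (fD x) (gD b); rewrite e -addnn => /(congr1 Posz).
  rewrite !PoszD => E; have -> : (fD x)%:Z = (gD a)%:Z + (gD b)%:Z - n./2%:Z - n./2%:Z.
    by rewrite E; ring.
  by ring.
- move=> x y _ _ sX sY; rewrite mulf_eq0 negb_or => /andP[_].
  rewrite ev_mono_dots // !ffunE => /(red0_neq0 (hg _)) e.
  by rewrite (monom_deg_single _ sX) (monom_deg_single _ sY) !ffunE -e PoszD; ring.
- by rewrite eqxx.
Qed.

Lemma bracket_diff_deg0 (G : mgraph) (Ga : ribbon G) :
  diff_deg0 (Fcomplex n 0 (bracket C n Ga)).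
Proof.
move=> i [k f] [l g]; rewrite /= Fmor_ev // /cube_edge.
case: pickP => [p hp|_]; last by rewrite /= eqxx.
rewrite [ev _ _ _ _ _]/= mulf_eq0 negb_or => /andP[_ /saddle_degree ->].
by rewrite (flip01_weight hp) mulnS PoszD addrCA addrA.
Qed.

Lemma Fmor_bigAdd (t : C) (A B : finType) (I : finType) (F : I -> mor C A B) f g :
  Fmor (n := n) t (\big[Add/Zero]_i F i) f g = \sum_i Fmor t (F i) f g.
Proof. by rewrite Fmor_ev // ev_bigAdd; apply: eq_bigr => i _; rewrite Fmor_ev. Qed.

Lemma Fcomplex_modcomplex (t : C) (G : mgraph) (Ga : ribbon G) :
  is_modcomplex (Fcomplex n t (bracket C n Ga)).
Proof.
set K := Fcomplex n t (bracket C n Ga).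
move=> i v; rewrite /diff !lfunE /=; apply/ffunP=> y; rewrite !ffunE.
under eq_bigr => x _ do rewrite ffunE mulr_suml.
rewrite exchange_big /= big1 // => w _.
under eq_bigr => x _ do rewrite -mulrA.
rewrite -mulr_sumr [X in _ * X](_ : _ = 0) ?mulr0 //.
have ut t' : Some t = Some t' -> t' = t by case.
(* The square of the differential vanishes already for the cobordisms, under the relation U = t, and
   soundness carries this over to the modules. *)
have := Fmor_sound n_gt1 ut (@bracket_complex C n n_gt1 (Some t) G Ga i (tag w) (tag y))
  (tagged w) (tagged y).
rewrite /matcomp Fmor_bigAdd /= => E; rewrite -[RHS]E.
by rewrite [RHS]sig_big_dep.
Qed.
End Degree.

Section SameHomology.
Variable C : numClosedFieldType.

Lemma same_quotient_refl (V : vectType C) (Z B : {vspace V}) : same_quotient Z B Z B.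
Proof.
exists (idfun : {linear quotmod Z B -> quotmod Z B}); first by exists id.
by move=> z z' e; congr qclass; apply: val_inj.
Qed.

Variables (b : nat -> finType) (d : forall i, b i -> int).
Variables (m1 m2 : forall i, b i -> b i.+1 -> C).
Hypothesis m12 : forall i x y, m1 (i := i) x y = m2 x y.
Let K := ModComplex d m1.
Let L := ModComplex d m2.

(** Bases and degrees being shared, differentials with equal entries are equal by extensionality,
    and the identity of the quotient is the required map. *)
Lemma same_homology_deg i j :
  same_quotient (V := chain K i) (cycles (deg_part K j) i) (boundaries (deg_part K j) i)
    (cycles (deg_part L j) i) (boundaries (deg_part L j) i).
Proof.
rewrite /L; have -> : m2 = m1.
  apply: functional_extensionality_dep => k.
  by apply/funext => x; apply/funext => y.
exact: same_quotient_refl.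
Qed.

Lemma same_homology_full i :
  same_quotient (V := chain K i) (cycles (full_part K) i) (boundaries (full_part K) i)
    (cycles (full_part L) i) (boundaries (full_part L) i).
Proof.
rewrite /L; have -> : m2 = m1.
  apply: functional_extensionality_dep => k.
  by apply/funext => x; apply/funext => y.
exact: same_quotient_refl.
Qed.
End SameHomology.

Theorem theoremG (R : realType) (n : nat) (G : mgraph) (Ga : ribbon G)
    (n_gt1 : (1 < n)%N) (G_conn : gconnected G) :
  (* [[Ga]] is a complex whose class is an invariant, with or without U = t *)
  (forall u : option R[i],
     is_complex u n (bracket R[i] n Ga) /\
     forall (G' : mgraph) (Ga' : ribbon G'),
       gconnected G' -> ribbon_equiv Ga Ga' ->
       kom_iso u n (bracket R[i] n Ga) (bracket R[i] n Ga')) /\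
  (* F is well defined on the category with U = t *)
  (forall (t : R[i]) (A B : finType) (M N : mor R[i] A B),
     eqcob (Some t) n M N -> Fmor (n := n) t M =2 Fmor t N) /\
  (* t = 0 *)
  (let K := Fcomplex n 0 (bracket R[i] n Ga) in
   let L := color_complex (bigraded_maps R[i] n) Ga in
   [/\ is_modcomplex K, diff_deg0 K &
       forall (i : nat) (j : int),
         same_quotient (cycles (deg_part K j) i) (boundaries (deg_part K j) i)
                       (cycles (deg_part L j) i) (boundaries (deg_part L j) i)])
  /\
  (* t = 1 *)
  (let K := Fcomplex n 1 (bracket R[i] n Ga) in
   let L := color_complex (filtered_maps R[i] n) Ga in
   is_modcomplex K /\
   forall i : nat,
     same_quotient (cycles (full_part K) i)
                   (boundaries (full_part K) i)
                   (cycles (full_part L) i)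
                   (boundaries (full_part L) i)).
Proof.
split; last split; last split.
- move=> u; split=> [|G' Ga' _ eqG]; first exact: bracket_complex.
  exact: bracket_invariant.
- move=> t A B M N; apply: Fmor_sound => // t' [<-] //.
- split; [exact: Fcomplex_modcomplex|exact: bracket_diff_deg0|move=> i j].
  apply: same_homology_deg => k x y.
  exact: (Fmor_cube_edge n_gt1 (tagged x) (tagged y) (bigraded_spec R[i] n_gt1)).
- split; [exact: Fcomplex_modcomplex|move=> i].
  apply: same_homology_full => k x y.
  exact: (Fmor_cube_edge n_gt1 (tagged x) (tagged y) (filtered_spec R[i] n_gt1)).
Qed.
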